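(* Let $k\ge 2$ be an integer. There exists $b_k>0$ such that, if $0<b<b_k$ (and $b\le 1$), then $\mathfrak L_k(T(1,b))=k^2\pi^2$ and the corresponding minimal $k$-partition $\mathcal D_k=(D_1,\dots,D_k)$ of $T(1,b)$ is, up to translation of the torus and relabelling, the one represented in $[0,1]\times[0,b]$ (with opposite sides identified) by $$D_i=\left(\tfrac{i-1}{k},\tfrac{i}{k}\right)\times[0,b),\qquad i=1,\dots,k.$$ Moreover one can take $b_k=\frac{2}{k}$ for $k$ even and $b_k=\frac{1}{k}$ for $k$ odd.
   Context: For $a\ge b>0$, $T(a,b)=\mathbb S^1(\frac{a}{2\pi})\times\mathbb S^1(\frac{b}{2\pi})=\mathbb R^2/(a\mathbb Z\times b\mathbb Z)$ is the flat torus, obtained from the rectangle $(0,a)\times(0,b)$ by periodic identification of opposite sides; the Laplacian is $-\partial_x^2-\partial_y^2$. A $k$-partition of $T(a,b)$ is a family $\mathcal D=(D_1,\dots,D_k)$ of $k$ pairwise disjoint nonempty open subsets of $T(a,b)$. For an open set $D$, $\lambda(D)$ is the ground state energy (lowest eigenvalue) of the Dirichlet Laplacian in $D$. The energy of $\mathcal D$ is $\Lambda_k(\mathcal D)=\max_j\lambda(D_j)$, and $\mathfrak L_k(T(a,b))=\inf_{\mathcal D}\Lambda_k(\mathcal D)$ over all $k$-partitions of $T(a,b)$. A minimal $k$-partition is a $k$-partition whose energy is $\mathfrak L_k(T(a,b))$. Minimal partitions are always understood to be strong and regular (i.e. one takes the strong regular representative, disregarding modifications by sets of capacity zero). Strong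 means $\bigcup_i\overline{D_i}$ is the whole torus and $\mathrm{Int}(\overline{D_i})=D_i$ for every $i$. Regular means that the boundary set $N(\mathcal D)=\overline{\bigcup_i\partial D_i}$ satisfies: (i) except at finitely many distinct points $x_i\in N(\mathcal D)$, near which $N(\mathcal D)$ is a union of $\nu(x_i)\ge 3$ smooth curves with one end at $x_i$, $N(\mathcal D)$ is locally diffeomorphic to a regular curve; (ii) at each such $x_i$ the half-curves meet with equal angles. *)

(* Defs.v *)
From HB Require Import structures.
From mathcomp Require Import all_boot all_order all_algebra all_fingroup.
From mathcomp Require Import generic_quotient.
From mathcomp Require Import all_classical all_reals all_analysis.

Set Implicit Arguments.
Unset Strict Implicit.
Unset Printing Implicit Defensive.

Import Order.TTheory GRing.Theory Num.Theory.
Import numFieldNormedType.Exports.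

Local Open Scope classical_set_scope.
Local Open Scope ring_scope.
Local Open Scope quotient_scope.

Section FlatTorus.
Context (R : realType) (a b : R).

Definition lattice_rel : rel (R * R) := fun x y =>
  ((x.1 - y.1) / a \is a Num.int) && ((x.2 - y.2) / b \is a Num.int).

Lemma lattice_rel_refl : reflexive lattice_rel.
Proof. by move=> x; rewrite /lattice_rel !subrr !mul0r !rpred0. Qed.

Lemma lattice_rel_sym : symmetric lattice_rel.
Proof.
by move=> x y; rewrite /lattice_rel -![y.1 - _]opprB -![y.2 - _]opprB !mulNr !rpredN.
Qed.

Lemma lattice_rel_trans : transitive lattice_rel.
Proof.
move=> y x z /andP[h1 h2] /andP[h3 h4].
rewrite /lattice_rel.
have -> : x.1 - z.1 = (x.1 - y.1) + (y.1 - z.1) by rewrite addrA subrK.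
have -> : x.2 - z.2 = (x.2 - y.2) + (y.2 - z.2) by rewrite addrA subrK.
by rewrite [X in X \is a _]mulrDl [X in _ && (X \is a _)]mulrDl !rpredD.
Qed.

Canonical lattice_equiv :=
  EquivRel lattice_rel lattice_rel_refl lattice_rel_sym lattice_rel_trans.

(* T(a, b) = R^2 / (aZ x bZ), with the quotient topology *)
Definition torus := quotient_topology {eq_quot lattice_equiv}.

Definition torus_pi (x : R * R) : torus := \pi_torus x.

Definition translate (t : R * R) (A : set torus) : set torus :=
  [set torus_pi (x + t) | x in torus_pi @^-1` A].

(* a fundamental domain: integrals over the torus are integrals over it of the
   lifted functions *)
Definition cell : set (R * R) := `[0, a[ `*` `[0, b[.

End FlatTorus.

Section Smooth.
Context (R : realType).

(* iterated directional derivatives along the vectors of s *)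
Definition iter_deriv (V : normedModType R) (s : seq (R * R))
    (f : R * R -> V) : R * R -> V :=
  foldr (fun v (g : R * R -> V) => 'D_v g) f s.

(* f is C^infinity on the open set U *)
Definition smooth_on (V : normedModType R) (U : set (R * R))
    (f : R * R -> V) : Prop :=
  forall (s : seq (R * R)) x, U x -> differentiable (iter_deriv s f) x.

End Smooth.

Section DirichletLaplacian.
Context (R : realType) (a b : R).
Local Notation T := (torus a b).
Local Notation pr := (@torus_pi R a b).
Local Notation mu := (@lebesgue_measure R \x @lebesgue_measure R)%E.

Definition dx (f : T -> R) : R * R -> R := 'D_(1, 0) (f \o pr).
Definition dy (f : T -> R) : R * R -> R := 'D_(0, 1) (f \o pr).

(* C_c^infinity(D); supports are compact since the torus is *)
Definition test_function (D : set T) (f : T -> R) : Prop :=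
  smooth_on setT (f \o pr) /\ closure [set p | f p != 0] `<=` D.

Definition L2_cvg (f_ : (R * R -> R)^nat) (f : R * R -> R) : Prop :=
  measurable_fun (cell a b) f /\
  (\int[mu]_(x in cell a b) ((f_ n x - f x) ^+ 2)%:E)%E @[n --> \oo] --> 0%E.

(* u lies in H^1_0(D), the closure of C_c^infinity(D) in H^1, and (gx, gy) is
   its weak gradient *)
Definition H10 (D : set T) (u gx gy : T -> R) : Prop :=
  exists f_ : (T -> R)^nat,
  [/\ forall n, test_function D (f_ n),
      L2_cvg (fun n => f_ n \o pr) (u \o pr),
      L2_cvg (fun n => dx (f_ n)) (gx \o pr) &
      L2_cvg (fun n => dy (f_ n)) (gy \o pr)].

(* l is an eigenvalue of the Dirichlet Laplacian -d_x^2 - d_y^2 in D, i.e. of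
   the self-adjoint operator given by the Dirichlet form on H^1_0(D) *)
Definition dirichlet_eigenvalue (D : set T) (l : R) : Prop :=
  exists u gx gy : T -> R,
  [/\ H10 D u gx gy,
      (0 < \int[mu]_(x in cell a b) ((u (pr x)) ^+ 2)%:E)%E &
      forall f, test_function D f ->
        \int[mu]_(x in cell a b) (gx (pr x) * dx f x + gy (pr x) * dy f x) =
        l * \int[mu]_(x in cell a b) (u (pr x) * f (pr x))].

(* the lowest eigenvalue; by compactness the infimum is a minimum when D is open
   and nonempty *)
Definition ground_energy (D : set T) : \bar R :=
  ereal_inf [set l%:E | l in dirichlet_eigenvalue D].

End DirichletLaplacian.

Section Partitions.
Context (R : realType) (a b : R).
Local Notation T := (torus a b).
Local Notation pr := (@torus_pi R a b).

Definition is_partition k (D : 'I_k -> set T) : Prop :=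
  (forall i, open (D i) /\ D i !=set0) /\
  (forall i j, i != j -> D i `&` D j = set0).

Definition energy k (D : 'I_k -> set T) : \bar R :=
  \big[maxe/-oo%E]_(i < k) ground_energy (D i).

Definition min_energy k : \bar R :=
  ereal_inf [set energy D | D in @is_partition k].

Definition strong k (D : 'I_k -> set T) : Prop :=
  \bigcup_i closure (D i) = setT /\
  forall i, interior (closure (D i)) = D i.

Definition boundary_set k (D : 'I_k -> set T) : set T :=
  closure (\bigcup_i (closure (D i) `\` interior (D i))).

(* near x, a diffeomorphism of plane neighbourhoods maps N onto a piece of a
   straight line *)
Definition regular_curve_near (N : set (R * R)) (x : R * R) : Prop :=
  exists (U V : set (R * R)) (F G : R * R -> R * R),
  [/\ open U /\ U x, open V,
      smooth_on U F /\ smooth_on V G,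
      [/\ forall y, U y -> V (F y) /\ G (F y) = y &
          forall z, V z -> U (G z) /\ F (G z) = z] &
      F @` (N `&` U) = [set z | V z /\ z.2 = 0]].

(* c, restricted to [0, 1[, is an embedded half-curve with end x, smooth and
   regular on ]0, 1[, C^1 up to the end, leaving x with velocity v.  No more
   than C^1 is asked at the end, as only the tangent there is used; for odd
   numbers of half-curves nodal lines need not be smoother *)
Definition half_curve (x v : R * R) (c : R -> R * R) : Prop :=
  [/\ c 0 = x /\ c t @[t --> 0^'+] --> x,
      forall n t, 0 < t < 1 -> derivable (derive1n n c) t 1,
      forall t, 0 < t < 1 -> derive1 c t != 0,
      {in `[0, 1[ &, injective c} &
      v != 0 /\ derive1 c t @[t --> 0^'+] --> v].

(* near x, N is a union of m half-curves with end x, otherwise disjoint and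
   meeting at equal angles 2 pi / m *)
Definition star_near (m : nat) (N : set (R * R)) (x : R * R) : Prop :=
  exists (U : set (R * R)) (c : 'I_m -> R -> R * R) (r : 'I_m -> R) (th : R),
  [/\ open U /\ U x,
      forall i, 0 < r i,
      forall i, half_curve x
        (r i * cos (th + 2 * pi * i%:R / m%:R),
         r i * sin (th + 2 * pi * i%:R / m%:R)) (c i),
      forall i j s t, i != j -> 0 < s < 1 -> 0 < t < 1 -> c i s <> c j t &
      N `&` U = (\bigcup_i c i @` `[0, 1[) `&` U].

Definition regular k (D : 'I_k -> set T) : Prop :=
  let N := boundary_set D in
  exists X : set T,
  [/\ finite_set X, X `<=` N,
      forall x, X (pr x) ->
        exists m, (3 <= m)%N /\ star_near m (pr @^-1` N) x &
      forall x, (N `\` X) (pr x) -> regular_curve_near (pr @^-1` N) x].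

Definition minimal_partition k (D : 'I_k -> set T) : Prop :=
  [/\ is_partition D, energy D = min_energy k, strong D & regular D].

(* D_(i+1), the indices i of 'I_k starting from 0 *)
Definition strip k (i : 'I_k) : set T :=
  [set pr x | x in
     [set x : R * R | i%:R / k%:R < x.1 < i.+1%:R / k%:R /\ 0 <= x.2 < b]].

End Partitions.
Arguments strip {R} a b {k} i.

(* Main.v *)
Require Import Defs.
From mathcomp Require Import all_boot all_order all_algebra all_fingroup.
From mathcomp Require Import generic_quotient.
From mathcomp Require Import all_classical all_reals all_analysis.
From mathcomp Require Import measurable_realfun.
From mathcomp Require Import ring lra.

Set Implicit Arguments.
Unset Strict Implicit.
Unset Printing Implicit Defensive.

Import Order.TTheory GRing.Theory Num.Theory.
Import numFieldNormedType.Exports.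

Local Open Scope classical_set_scope.
Local Open Scope ring_scope.

(** Write [om = k pi].  Each of the [k] strips has the eigenvalue [om ^+ 2], its
    eigenfunction being [sin (om x)] cut off outside the strip
    ([arc_eigenvalue]), so the minimal energy is at most [om ^+ 2].  The converse
    inequality and uniqueness both follow from one stability inequality.

    Take a partition [D] whose energy is below [th ^+ 2], for some [th] with
    [om < th < 2 pi / b], and test functions [f j] of its domains.  They are
    first lifted to functions [u j] of the plane with
    [u j (x + 1, y) = (-1) ^+ k * u j (x, y)], the behaviour of [sin (om x)].
    For [k] even the periodic lift is one.  For [k] odd one may take
    [th < pi / b], and then the one-dimensional Dirichlet inequality on the
    vertical circles shows that each domain contains a full vertical circle
    ([vertical_circle]); every other domain misses that circle, and the lift of
    its test functions can be given opposite signs on both sides of it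
    ([lift_sign]).

    Now let [v j] be the mean of [u j] over vertical circles and
    [g j x = v j x + v j (x + 1 / 2k) + v j (x - 1 / 2k)].  The determinant of
    the matrix [g j (x + i / k)] changes sign when [x] increases by [1 / k],
    hence vanishes somewhere: there are [x0] and a unit vector [c] such that
    [v = \sum_j c j * v j] satisfies the [k] conditions
    [v x + v (x + 1 / 2k) + v (x - 1 / 2k) = 0] at [x = x0 + i / k]
    ([node_zero]).  These conditions are exactly what makes
    [\int (v' ^+ 2 - om ^+ 2 * v ^+ 2)] control the distance of [v] to the
    multiples of [sin (om (x - x0))] ([half_ineq], [stability1]).  Since
    [th * b < 2 pi], Wirtinger's inequality on the vertical circles controls
    what is lost by averaging ([stability2]).  As the [u j] have disjoint
    supports, normalized [u j] satisfy ([partition_stability])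

      C * || \sum_j c j * u j - al * sin (om (x - x0)) || ^+ 2
        <= \sum_j (c j) ^+ 2 * (energy of u j - om ^+ 2).

    The left-hand side is nonnegative, so the energies are not all smaller than
    [om ^+ 2]: this is the lower bound ([partition_lower_bound]).

    If the partition is minimal, the right-hand side can be made arbitrarily
    small.  By compactness, [x0] being in the unit segment, for one fixed [x0] the
    function [sin (om (x - x0))] is an L2 limit of sums [\sum_j u j], with [u j]
    supported in [D j] and bounded gradients ([limiting_profile]).  Suppose that
    [D i] meets one of the strips between consecutive zeros of this sine without
    being dense in it, and let [s > 0] be the absolute value of the sine there.
    Then [cos (pi * u i / s)] is close to [-1] on a square inside [D i], is [1]
    on a square outside [D i], and yet its gradient is small in L1, because
    [u i / s] is close to [1] in [D i] and is [0] elsewhere, so that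
    [sin (pi * u i / s)] is small everywhere: a contradiction ([two_squares],
    [arc_in_closure]).  Hence a domain that meets a strip is dense in it.  Two
    domains cannot meet the same strip, every domain meets one, and there are as
    many strips as domains; so each domain is the interior of the closure of one
    strip, that is, the strip itself ([arcs_of_inclusions]). *)

(** * Calculus of one real variable *)

Section Integrals1.
Context {R : realType}.
Implicit Types (f g F G : R -> R) (a b c x y : R).
Local Notation leb := (@lebesgue_measure R).

Definition segint a b f : R := \int[leb]_(x in `[a, b]) f x.

Lemma integrable_seg f a b : continuous f -> leb.-integrable `[a, b] (EFin \o f).
Proof.
move=> cf; apply: continuous_compact_integrable; first exact: segment_compact.
exact: continuous_subspaceT.
Qed.

Lemma is_derive_continuous f x (l : R) : is_derive x 1 f l -> {for x, continuous f}.
Proof. by move=> [df _]; apply/differentiable_continuous/derivable1_diffP. Qed.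

Lemma isd_eq f x (l l' : R) : is_derive x 1 f l -> l = l' -> is_derive x 1 f l'.
Proof. by move=> ? <-. Qed.

Lemma isd_cst (r x : R) : is_derive x 1 (fun=> r) 0.
Proof. exact: is_derive_cst. Qed.

Lemma isd_id (x : R) : is_derive x 1 (fun y => y) 1.
Proof. exact: is_derive_id. Qed.

Lemma isd_add f g x (l m : R) : is_derive x 1 f l -> is_derive x 1 g m ->
  is_derive x 1 (fun y => f y + g y) (l + m).
Proof. by move=> df dg; exact: (is_deriveD df dg). Qed.

Lemma isd_opp f x (l : R) : is_derive x 1 f l -> is_derive x 1 (fun y => - f y) (- l).
Proof. by move=> df; exact: (is_deriveN df). Qed.

Lemma isd_mul f g x (l m : R) : is_derive x 1 f l -> is_derive x 1 g m ->
  is_derive x 1 (fun y => f y * g y) (l * g x + f x * m).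
Proof.
move=> df dg; apply: (isd_eq (is_deriveM df dg)).
by rewrite /GRing.scale/= addrC (mulrC (g x)).
Qed.

Lemma isd_scale (r : R) f x (l : R) : is_derive x 1 f l ->
  is_derive x 1 (fun y => r * f y) (r * l).
Proof. by move=> df; apply: (isd_eq (isd_mul (isd_cst r x) df)); ring. Qed.

Lemma isd_comp f g x (l m : R) : is_derive x 1 g m -> is_derive (g x) 1 f l ->
  is_derive x 1 (fun y => f (g y)) (m * l).
Proof. by move=> dg df; apply: (isd_eq (is_derive1_comp df dg)); exact: mulrC. Qed.

Lemma isd_sin f x (l : R) : is_derive x 1 f l ->
  is_derive x 1 (fun y => sin (f y)) (l * cos (f x)).
Proof. by move=> df; apply: (isd_comp df). Qed.

Lemma isd_cos f x (l : R) : is_derive x 1 f l ->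
  is_derive x 1 (fun y => cos (f y)) (l * - sin (f x)).
Proof. by move=> df; apply: (isd_comp df). Qed.

Lemma isd_inv f x (l : R) : f x != 0 -> is_derive x 1 f l ->
  is_derive x 1 (fun y => (f y)^-1) (- (l / f x ^+ 2)).
Proof.
move=> f0 df; apply: (isd_eq (is_deriveV f0 df)).
by rewrite /GRing.scale/= mulNr mulrC.
Qed.

Lemma isd_near f g x (l : R) : is_derive x 1 f l -> (\forall y \near x, f y = g y) ->
  is_derive x 1 g l.
Proof.
move=> df fg; have [d1 d2] := df; split.
  exact: (near_eq_derivable fg).
by rewrite -d2; apply/esym/near_eq_derive.
Qed.

Lemma is_derive_mono F g a b : a <= b ->
  (forall x, a <= x <= b -> is_derive x 1 F (g x)) ->
  (forall x, a <= x <= b -> 0 <= g x) -> F a <= F b.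
Proof.
move=> ab dF g0.
have [| |x xab E] := @MVT_segment R F g a b ab.
- by move=> x xab; apply: dF; rewrite !ltW ?(itvP xab).
- apply: derivable_within_continuous => x xab.
  by have [] := dF x; rewrite ?(itvP xab).
by rewrite -subr_ge0 E mulr_ge0 ?subr_ge0// g0// (itvP xab).
Qed.

Lemma segint_FTC f F a b : a <= b -> continuous f ->
  (forall x, a <= x <= b -> is_derive x 1 F (f x)) -> segint a b f = F b - F a.
Proof.
rewrite le_eqVlt => /predU1P[<-|ab] cf dF.
  by rewrite subrr /segint set_itv1 Rintegral_set1.
have cF x : a <= x <= b -> {for x, continuous F}.
  by move=> /dF; exact: is_derive_continuous.
rewrite /segint /Rintegral (@continuous_FTC2 R f F a b) //.
- exact: continuous_subspaceT.
- split.
  + move=> x; rewrite in_itv/= => /andP[ax xb].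
    by have [] := dF x; rewrite ?ltW.
  + by apply: cvg_at_right_filter; apply: cF; rewrite lexx ltW.
  + by apply: cvg_at_left_filter; apply: cF; rewrite lexx ltW.
move=> x; rewrite in_itv/= => /andP[ax xb].
have [dx <-] : is_derive x 1 F (f x) by apply: dF; rewrite !ltW.
by rewrite derive1E.
Qed.

(** The primitive starts left of [a] so as to be differentiable at [a] itself. *)
Lemma segint_prim f a : continuous f ->
  exists F, forall x, a <= x -> is_derive x 1 F (f x).
Proof.
move=> cf; exists (fun x => segint (a - 1) x f) => x ax.
have h1 : x < x + 1 by rewrite ltrDl.
have h2 : a - 1 < x by rewrite (lt_le_trans _ ax)// gtrBl.
have [d1 d2] := @continuous_FTC1_closed R f (a - 1) x (x + 1) h1 (integrable_seg _ _ cf) h2 (cf x).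
by split; [exact: d1|rewrite -derive1E; exact: d2].
Qed.

(** Comparing with a primitive avoids any integrability condition on [g]: it
    serves when the lower bound [g] is a derivative that is only known pointwise. *)
Lemma segint_le_prim f F g a b : a <= b -> continuous f ->
  (forall x, a <= x <= b -> is_derive x 1 F (g x)) ->
  (forall x, a <= x <= b -> g x <= f x) -> F b - F a <= segint a b f.
Proof.
move=> ab cf dF gf; have [A dA] := segint_prim a cf.
have -> : segint a b f = A b - A a by apply: segint_FTC => // x /andP[ax _]; exact: dA.
have : (A - F) a <= (A - F) b.
  apply: (@is_derive_mono _ (fun x => f x - g x)) => // x /andP[ax xb].
    by have ? := dA x ax; have ? := dF x; apply: is_deriveB; apply: dF; rewrite ax.
  by rewrite subr_ge0 gf// ax.
by rewrite !fctE; lra.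
Qed.

Lemma le_segint f g a b : continuous f -> continuous g ->
  (forall x, a <= x <= b -> f x <= g x) -> segint a b f <= segint a b g.
Proof.
by move=> cf cg fg; apply: le_Rintegral => //; exact: integrable_seg.
Qed.

Lemma eq_segint f g a b : (forall x, a <= x <= b -> f x = g x) -> segint a b f = segint a b g.
Proof.
move=> fg; apply: eq_Rintegral => x; rewrite inE/= in_itv/=; exact: fg.
Qed.

Lemma segint_ge0 f a b : (forall x, a <= x <= b -> 0 <= f x) -> 0 <= segint a b f.
Proof. by move=> f0; apply: Rintegral_ge0 => x /=; rewrite in_itv/=; exact: f0. Qed.

Lemma segintD f g a b : continuous f -> continuous g ->
  segint a b (fun x => f x + g x) = segint a b f + segint a b g.
Proof. by move=> cf cg; rewrite /segint RintegralD//; exact: integrable_seg. Qed.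

Lemma segintB f g a b : continuous f -> continuous g ->
  segint a b (fun x => f x - g x) = segint a b f - segint a b g.
Proof. by move=> cf cg; rewrite /segint RintegralB//; exact: integrable_seg. Qed.

Lemma segintZ (r : R) f a b : continuous f ->
  segint a b (fun x => r * f x) = r * segint a b f.
Proof. by move=> cf; rewrite /segint RintegralZl//; exact: integrable_seg. Qed.

Lemma segint_sum (I : finType) (F : I -> R -> R) a b : (forall i, continuous (F i)) ->
  segint a b (fun x => \sum_i F i x) = \sum_i segint a b (F i).
Proof.
move=> cF.
pose P (G : R -> R) (s : R) := continuous G /\ segint a b G = s.
suff : P (fun x => \sum_i F i x) (\sum_i segint a b (F i)) by case.
have -> : (fun x => \sum_i F i x) = \sum_i F i by rewrite funeqE => x; rewrite fct_sumE.
elim/big_ind2 : _ => [|G1 s1 G2 s2 [c1 <-] [c2 <-]|i _].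
- split; first exact: cst_continuous.
  by rewrite /segint (_ : 0 = cst 0)// Rintegral_cst// mul0r.
- split; first by move=> x; apply: continuousD; [exact: c1|exact: c2].
  exact: segintD.
- by split.
Qed.

Lemma segint_cst (r : R) a b : a <= b -> segint a b (fun=> r) = r * (b - a).
Proof.
move=> ab; have -> : r * (b - a) = r * b - r * a by ring.
apply: (@segint_FTC _ (fun x => r * x)) => //; first exact: cst_continuous.
move=> x _; apply: (isd_eq (isd_scale r (isd_id x))); ring.
Qed.

Lemma segint_chasles f a b c : a <= b -> b <= c -> continuous f ->
  segint a c f = segint a b f + segint b c f.
Proof.
move=> ab bc cf; have [A dA] := segint_prim a cf.
have ac := le_trans ab bc.
have E u v : a <= u -> u <= v -> segint u v f = A v - A u.
  by move=> au uv; apply: segint_FTC => // x /andP[ux _]; apply: dA; rewrite (le_trans au).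
by rewrite !E//; ring.
Qed.

(** As a function of the origin the left-hand side has derivative
    [f (x + T) - f x = 0]. *)
Lemma segint_periodic f (T x : R) : 0 <= T -> continuous f ->
  (forall y, f (y + T) = f y) -> segint x (x + T) f = segint 0 T f.
Proof.
move=> T0 cf fT; have [A dA] := segint_prim (Num.min x 0) cf.
have m x' : Num.min x 0 <= x' -> segint x' (x' + T) f = A (x' + T) - A x'.
  move=> mx; apply: segint_FTC; rewrite ?lerDl// => y /andP[xy _].
  by apply: dA; rewrite (le_trans mx).
have dG y : Num.min x 0 <= y -> is_derive y 1 (fun y => A (y + T) - A y) 0.
  move=> my; have dA1 := dA y my.
  have dA2 : is_derive (y + T) 1 A (f (y + T)) by apply: dA; rewrite (le_trans my)// lerDl.
  apply: (isd_eq (isd_add (isd_comp (isd_add (isd_id y) (isd_cst T y)) dA2) (isd_opp dA1))).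
  by rewrite fT; ring.
have mono (F : R -> R) u v : (forall y, Num.min x 0 <= y -> is_derive y 1 F 0) ->
    Num.min x 0 <= u -> u <= v -> F u <= F v.
  move=> dF mu uv; apply: (@is_derive_mono F (fun=> 0)) => // y /andP[uy _].
  by apply: dF; rewrite (le_trans mu).
have cst u v : Num.min x 0 <= u -> u <= v -> A (u + T) - A u = A (v + T) - A v.
  move=> mu uv; apply/eqP; rewrite eq_le; apply/andP; split.
    exact: (mono (fun y => A (y + T) - A y)).
  rewrite -lerN2; apply: (mono (fun y => - (A (y + T) - A y))) => // y my.
  by rewrite -oppr0; apply: is_deriveN; exact: dG.
have -> : segint 0 T f = segint 0 (0 + T) f by rewrite add0r.
have mx : Num.min x 0 <= x by rewrite ge_min lexx.
have m0 : Num.min x 0 <= 0 by rewrite ge_min lexx orbT.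
rewrite (m x mx) (m 0 m0).
have [x0|x0] := leP x 0; first exact: cst.
by apply/esym/cst => //; exact: ltW.
Qed.

End Integrals1.

(** * Continuity and integrals over rectangles *)

Section ContRules.
Context {R : realType} {T : topologicalType}.
Implicit Types (f g : T -> R).

Lemma ct_cst (r : R) : continuous (fun _ : T => r).
Proof. exact: cst_continuous. Qed.

Lemma ct_add f g : continuous f -> continuous g -> continuous (fun x => f x + g x).
Proof. by move=> cf cg x; apply: continuousD; [exact: cf|exact: cg]. Qed.

Lemma ct_opp f : continuous f -> continuous (fun x => - f x).
Proof. by move=> cf x; apply: continuousN; exact: cf. Qed.

Lemma ct_mul f g : continuous f -> continuous g -> continuous (fun x => f x * g x).
Proof. by move=> cf cg x; apply: continuousM; [exact: cf|exact: cg]. Qed.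

Lemma ct_exp f n : continuous f -> continuous (fun x => f x ^+ n).
Proof.
move=> cf; elim: n => [|n IHn]; first by under eq_fun do rewrite expr0; exact: ct_cst.
by under eq_fun do rewrite exprS; exact: ct_mul.
Qed.

Lemma ct_norm f : continuous f -> continuous (fun x => `|f x|).
Proof. by move=> cf x; apply: continuous_comp; [exact: cf|exact: norm_continuous]. Qed.

Lemma ct_comp f (g : R -> R) : continuous g -> continuous f -> continuous (fun x => g (f x)).
Proof. by move=> cg cf x; apply: continuous_comp; [exact: cf|exact: cg]. Qed.

Lemma ct_sin f : continuous f -> continuous (fun x => sin (f x)).
Proof. by apply: ct_comp; exact: continuous_sin. Qed.

Lemma ct_cos f : continuous f -> continuous (fun x => cos (f x)).
Proof. by apply: ct_comp; exact: continuous_cos. Qed.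

Lemma ct_sum (I : finType) (F : I -> T -> R) : (forall i, continuous (F i)) ->
  continuous (fun x => \sum_i F i x).
Proof.
move=> cF.
have -> : (fun x => \sum_i F i x) = \sum_i F i by rewrite funeqE => x; rewrite fct_sumE.
elim/big_ind : _ => [|G1 G2 c1 c2|i _]; [exact: ct_cst|exact: (ct_add c1 c2)|exact: cF].
Qed.

End ContRules.

Section ContId.
Context {R : realType}.
Lemma ct_id : continuous (fun x : R => x).
Proof. by move=> x; exact: cvg_id. Qed.
Lemma ct_fst : continuous (fun p : R * R => p.1).
Proof. by move=> p; exact: cvg_fst. Qed.
Lemma ct_snd : continuous (fun p : R * R => p.2).
Proof. by move=> p; exact: cvg_snd. Qed.
Lemma ct_pair (T : topologicalType) (f g : T -> R) : continuous f -> continuous g ->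
  continuous (fun x => (f x, g x)).
Proof. by move=> cf cg x; exact: (cvg_pair (cf x) (cg x)). Qed.
Lemma ct_comp2 (T : topologicalType) (f g : T -> R) (F : R * R -> R) :
  continuous F -> continuous f -> continuous g -> continuous (fun x => F (f x, g x)).
Proof.
move=> cF cf cg x; apply: (@continuous_comp _ _ _ (fun x => (f x, g x)) F).
  exact: ct_pair.
exact: cF.
Qed.
End ContId.

(** Proves continuity by following the structure of the function, up to the
    hypotheses in the context. *)
Ltac cont := lazymatch goal with
  | |- continuous (fun _ => ?c) => exact (@ct_cst _ _ c)
  | |- continuous (fun x => x) => exact (@ct_id _)
  | |- continuous (fun x => fst x) => exact (@ct_fst _)
  | |- continuous (fun x => snd x) => exact (@ct_snd _)
  | |- continuous (fun x => @?f x + @?g x) => refine (@ct_add _ _ f g _ _); cont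
  | |- continuous (fun x => @?f x * @?g x) => refine (@ct_mul _ _ f g _ _); cont
  | |- continuous (fun x => - @?f x) => refine (@ct_opp _ _ f _); cont
  | |- continuous (fun x => @?f x ^+ ?n) => refine (@ct_exp _ _ f n _); cont
  | |- continuous (fun x => sin (@?f x)) => refine (@ct_sin _ _ f _); cont
  | |- continuous (fun x => cos (@?f x)) => refine (@ct_cos _ _ f _); cont
  | |- continuous (fun x => `|@?f x|) => refine (@ct_norm _ _ f _); cont
  | _ => try assumption
  end.

Section Integrals2.
Context {R : realType}.
Implicit Types (F G : R * R -> R) (a b c d x y : R).
Local Notation leb := (@lebesgue_measure R).

Lemma ct_slice1 F y : continuous F -> continuous (fun x => F (x, y)).
Proof. by move=> cF; apply: ct_comp2; cont. Qed.

Lemma ct_slice2 F x : continuous F -> continuous (fun y => F (x, y)).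
Proof. by move=> cF; apply: ct_comp2; cont. Qed.

Lemma box_bounded F a b c d : continuous F ->
  exists M, 0 <= M /\ forall x y, a <= x <= b -> c <= y <= d -> `|F (x, y)| <= M.
Proof.
move=> cF; have cK : compact (`[a, b] `*` `[c, d] : set (R * R)).
  by apply: compact_setX; exact: segment_compact.
have /compact_bounded[M [Mr HM]] : compact (F @` (`[a, b] `*` `[c, d])).
  by apply: continuous_compact => //; exact: continuous_subspaceT.
exists (`|M| + 1); split; first by rewrite addr_ge0.
move=> x y xab ycd; apply: (HM (`|M| + 1)); first by rewrite (le_lt_trans (ler_norm M))// ltrDl.
by exists (x, y) => //; split => /=; rewrite in_itv.
Qed.

(** Continuity under the integral sign, continuous functions being bounded on
    rectangles. *)
Lemma ct_segint F c d : continuous F -> continuous (fun x => segint c d (fun y => F (x, y))).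
Proof.
move=> cF; move=> x0.
have [M [M0 HM]] := box_bounded (x0 - 1) (x0 + 1) c d cF.
have h1 x : [set` `]x0 - 1, x0 + 1[] x -> leb.-integrable `[c, d] (EFin \o (fun y => F (x, y))).
  by move=> _; exact: (integrable_seg c d (ct_slice2 cF)).
have h2 : {ae leb, forall y, y \in `[c, d] ->
    {in [set` `]x0 - 1, x0 + 1[], continuous (fun x => F (x, y))}}.
  by apply: aeW => y _ x _; exact: (ct_slice1 cF).
have h3 : leb.-integrable `[c, d] (EFin \o (fun=> M)) by exact: (integrable_seg c d (@ct_cst R R M)).
have h4 x : [set` `]x0 - 1, x0 + 1[] x ->
    {ae leb, forall y, y \in `[c, d] -> `|F (x, y)| <= M}.
  rewrite /= in_itv/= => /andP[x1 x2]; apply: aeW => y; rewrite /= in_itv/= => ycd.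
  by apply: (HM x y _ ycd); rewrite !ltW.
have := @continuity_under_integral R _ (measurableTypeR R) leb (fun x y => F (x, y)) `[c, d]
  (measurable_itv _) (x0 - 1) (x0 + 1) h1 h2 (fun=> M) h3 h4.
by apply; rewrite inE/= in_itv/= gtrBl ltrDl ltr01.
Qed.

(** Differentiation under the integral sign, [Fx] being bounded on a rectangle
    around the segment. *)
Lemma isd_segint F Fx c d x0 : continuous F -> continuous Fx ->
  (forall x y, is_derive x 1 (fun x => F (x, y)) (Fx (x, y))) ->
  is_derive x0 1 (fun x => segint c d (fun y => F (x, y))) (segint c d (fun y => Fx (x0, y))).
Proof.
move=> cF cFx dF.
have [M [M0 HM]] := box_bounded (x0 - 1) (x0 + 1) c d cFx.
have E x y : (partial1of2 (fun x y => F (x, y))) x y = Fx (x, y).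
  by rewrite partial1of2E; have [_ ->] := dF x y.
have i1 : [set` `]x0 - 1, x0 + 1[] x0 by rewrite /= in_itv/= gtrBl ltrDl ltr01.
have H := @derivable_under_integral R _ (measurableTypeR R) leb (fun x y => F (x, y)) `[c, d]
  (measurable_itv _) x0 (x0 - 1) (x0 + 1) i1 _ _ (fun=> M) (fun=> M0).
have H' := @differentiation_under_integral R _ (measurableTypeR R) leb (fun x y => F (x, y)) `[c, d]
  (measurable_itv _) x0 (x0 - 1) (x0 + 1) i1 _ _ (fun=> M) (fun=> M0).
have h1 x : [set` `]x0 - 1, x0 + 1[] x -> leb.-integrable `[c, d] (EFin \o (fun y => F (x, y))).
  by move=> _; exact: (integrable_seg c d (ct_slice2 cF)).
have h2 x y : [set` `]x0 - 1, x0 + 1[] x -> y \in `[c, d] ->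
    derivable (fun x => F (x, y)) x 1 by move=> _ _; have [] := dF x y.
have h3 : leb.-integrable `[c, d] (EFin \o (fun=> M)) by exact: (integrable_seg c d (@ct_cst R R M)).
have h4 x y : [set` `]x0 - 1, x0 + 1[] x -> y \in `[c, d] ->
    `|(partial1of2 (fun x y => F (x, y))) x y| <= M.
  by rewrite E /= !in_itv/= => /andP[x1 x2] ycd; apply: (HM x y _ ycd); rewrite !ltW.
split; first exact: (H h1 h2 h3 h4).
rewrite -derive1E (H' h1 h2 h3 h4); apply: eq_Rintegral => y _; exact: E.
Qed.

Definition boxint a b c d F : R := segint a b (fun x => segint c d (fun y => F (x, y))).

Lemma boxintD a b c d F G : continuous F -> continuous G ->
  boxint a b c d (fun p => F p + G p) = boxint a b c d F + boxint a b c d G.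
Proof.
move=> cF cG; rewrite /boxint -segintD; try exact: ct_segint.
by congr segint; rewrite funeqE => x; rewrite segintD//; exact: ct_slice2.
Qed.

Lemma boxintZ r a b c d F : continuous F ->
  boxint a b c d (fun p => r * F p) = r * boxint a b c d F.
Proof.
move=> cF; rewrite /boxint -segintZ; try exact: ct_segint.
by congr segint; rewrite funeqE => x; rewrite segintZ//; exact: ct_slice2.
Qed.

Lemma boxintB a b c d F G : continuous F -> continuous G ->
  boxint a b c d (fun p => F p - G p) = boxint a b c d F - boxint a b c d G.
Proof.
move=> cF cG; rewrite /boxint -segintB; try exact: ct_segint.
by congr segint; rewrite funeqE => x; rewrite segintB//; exact: ct_slice2.
Qed.

Lemma boxint_sum (I : finType) (F : I -> R * R -> R) a b c d : (forall i, continuous (F i)) ->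
  boxint a b c d (fun p => \sum_i F i p) = \sum_i boxint a b c d (F i).
Proof.
move=> cF; rewrite /boxint -segint_sum; last by move=> i; exact: ct_segint.
by congr segint; rewrite funeqE => x; rewrite segint_sum// => i; exact: ct_slice2.
Qed.

Lemma le_boxint a b c d F G : continuous F -> continuous G ->
  (forall x y, a <= x <= b -> c <= y <= d -> F (x, y) <= G (x, y)) ->
  boxint a b c d F <= boxint a b c d G.
Proof.
move=> cF cG FG; apply: le_segint; try exact: ct_segint.
move=> x xab; apply: le_segint; try exact: ct_slice2.
by move=> y; exact: FG.
Qed.

Lemma boxint_ge0 a b c d F :
  (forall x y, a <= x <= b -> c <= y <= d -> 0 <= F (x, y)) -> 0 <= boxint a b c d F.
Proof. by move=> F0; apply: segint_ge0 => x xab; apply: segint_ge0 => y; exact: F0. Qed.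

Lemma eq_boxint a b c d F G :
  (forall x y, a <= x <= b -> c <= y <= d -> F (x, y) = G (x, y)) ->
  boxint a b c d F = boxint a b c d G.
Proof. by move=> FG; apply: eq_segint => x xab; apply: eq_segint => y; exact: FG. Qed.

End Integrals2.

(** * One-dimensional energy inequalities *)

Section DirichletInequality.
Context {R : realType}.
Implicit Types (f g w : R -> R) (a b x y th : R).

(** Jacobi transformation: the function [cos (th * (x - m))], with [m] the middle
    of the segment, is a positive solution of [q'' = - th ^+ 2 * q] there since
    [th * l < pi]. Completing a square, [w' ^+ 2 - th ^+ 2 * w ^+ 2] is at least
    the derivative of [- th * tan (th * (x - m)) * w ^+ 2], which vanishes at both
    ends. *)
Lemma dirichlet_ineq w w' s l th : 0 < l -> 0 <= th -> th * l < pi ->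
  continuous w -> continuous w' -> (forall x, is_derive x 1 w (w' x)) ->
  w s = 0 -> w (s + l) = 0 ->
  th ^+ 2 * segint s (s + l) (fun x => w x ^+ 2) <= segint s (s + l) (fun x => w' x ^+ 2).
Proof.
move=> l0 th0 thl cw cw' dw ws we.
have sl : s <= s + l by rewrite lerDl ltW.
rewrite -subr_ge0 -segintZ; last by cont.
rewrite -segintB; [|by cont|by cont].
pose m := s + l / 2.
pose K x := th * (sin (th * (x - m)) / cos (th * (x - m))) * w x ^+ 2.
suff : - (K (s + l)) - - (K s) <= segint s (s + l) (fun x => w' x ^+ 2 - th ^+ 2 * w x ^+ 2).
  by rewrite /K ws we expr0n/= !mulr0 oppr0 subrr.
have cosp x : s <= x <= s + l -> 0 < cos (th * (x - m)).
  move=> /andP[sx xs]; apply: cos_gt0_pihalf.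
  have := pi_gt0 R => pi0; rewrite /m.
  have : th * - (l/2) <= th * (x - (s + l/2)) by apply: ler_wpM2l => //; lra.
  have : th * (x - (s + l/2)) <= th * (l/2) by apply: ler_wpM2l => //; lra.
  by move: thl; rewrite mulrA mulrN mulrA => ? ? ?; lra.
pose tn x := sin (th * (x - m)) / cos (th * (x - m)).
apply: (@segint_le_prim R _ (fun x => - K x)
  (fun x => - (th * (th * (1 + tn x ^+ 2)) * w x ^+ 2 + th * tn x * (2 * w x * w' x))) _ _ sl).
- by cont.
- move=> x xs /=.
  have c0 := cosp x xs.
  have dl : is_derive x 1 (fun x => th * (x - m)) th.
    refine (isd_eq (isd_scale th (isd_add (isd_id x) (isd_cst (- m) x))) _); ring.
  have dt : is_derive x 1 tn (th * (1 + tn x ^+ 2)).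
    have dv := isd_inv (lt0r_neq0 c0) (isd_cos dl).
    apply: (isd_eq (isd_mul (isd_sin dl) dv)); rewrite /tn.
    by field; rewrite gt_eqF.
  apply: (isd_eq (isd_opp (isd_mul (isd_scale th dt) (isd_mul (dw x) (dw x))))).
  by rewrite /tn; ring.
- move=> x xs.
  have := sqr_ge0 (w' x + th * tn x * w x); nra.
Qed.

End DirichletInequality.

Section CircleInequalities.
Context {R : realType}.
Implicit Types (f g w v : R -> R) (a b x y th : R).

Lemma segint_variance f b (r : R) : 0 < b -> continuous f ->
  segint 0 b (fun y => (f y - r) ^+ 2) =
  segint 0 b (fun y => (f y - segint 0 b f / b) ^+ 2) + b * (segint 0 b f / b - r) ^+ 2.
Proof.
move=> b0 cf.
have E s : segint 0 b (fun y => (f y - s) ^+ 2) =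
    segint 0 b (fun y => f y ^+ 2) - 2 * s * segint 0 b f + s ^+ 2 * b.
  rewrite -segintZ// -segintB; [|by cont|by cont].
  have -> : s ^+ 2 * b = segint 0 b (fun=> s ^+ 2) by rewrite segint_cst ?ltW// subr0.
  rewrite -segintD; [|by cont|by cont].
  by apply: eq_segint => x _; ring.
by rewrite !E; field; rewrite gt_eqF.
Qed.

(** A periodic function with a zero satisfies Dirichlet conditions on the period
    that starts there. *)
Lemma dirichlet_periodic g g' b th y0 : 0 < b -> 0 <= th -> th * b < pi ->
  continuous g -> continuous g' -> (forall x, is_derive x 1 g (g' x)) ->
  (forall x, g (x + b) = g x) -> (forall x, g' (x + b) = g' x) -> g y0 = 0 ->
  th ^+ 2 * segint 0 b (fun x => g x ^+ 2) <= segint 0 b (fun x => g' x ^+ 2).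
Proof.
move=> b0 th0 thb cg cg' dg pg pg' gy0.
rewrite -(@segint_periodic _ (fun x => g x ^+ 2) b y0 (ltW b0)); [|by cont|by move=> y; rewrite pg].
rewrite -(@segint_periodic _ (fun x => g' x ^+ 2) b y0 (ltW b0)); [|by cont|by move=> y; rewrite pg'].
by apply: (dirichlet_ineq b0 th0 thb cg cg' dg) => //; rewrite pg.
Qed.

(** A periodic [g] takes the same value at two opposite points, by the
    intermediate value theorem applied to [g (y + b / 2) - g y]. Subtracting this
    value gives Dirichlet conditions on two segments of length [b / 2], and the
    mean is the constant that minimizes the distance to [g]. *)
Lemma wirtinger g g' b th : 0 < b -> 0 <= th -> th * b < 2 * pi ->
  continuous g -> continuous g' -> (forall x, is_derive x 1 g (g' x)) ->
  (forall x, g (x + b) = g x) -> (forall x, g' (x + b) = g' x) ->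
  th ^+ 2 * segint 0 b (fun x => (g x - segint 0 b g / b) ^+ 2) <= segint 0 b (fun x => g' x ^+ 2).
Proof.
move=> b0 th0 thb cg cg' dg pg pg'.
have b20 : 0 < b / 2 by lra.
pose h y := g (y + b / 2) - g y.
have ch : continuous h.
  by apply: ct_add; [apply: ct_comp => //; cont|cont].
have hb : h (b / 2) = - h 0.
  by rewrite /h add0r -splitr -{1}[b]add0r pg; ring.
have [y0 _ hy0] : exists2 y0, y0 \in `[0, b / 2] & h y0 = 0.
  apply: IVT; [exact: ltW|exact: continuous_subspaceT|].
  rewrite hb ge_min le_max.
  by rewrite oppr_le0 oppr_ge0; case: (leP (h 0) 0) => [_|/ltW ->]; rewrite ?orbT.
pose w y := g y - g y0.
have cw : continuous w by rewrite /w; cont.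
have dw x : is_derive x 1 w (g' x).
  by apply: (isd_eq (isd_add (dg x) (isd_cst (- g y0) x))); ring.
have w0 : w y0 = 0 by rewrite /w subrr.
have w1 : w (y0 + b / 2) = 0 by exact: hy0.
have w2 : w (y0 + b / 2 + b / 2) = 0 by rewrite -addrA -splitr /w pg subrr.
have thb2 : th * (b / 2) < pi by lra.
have D1 := dirichlet_ineq b20 th0 thb2 cw cg' dw w0 w1.
have D2 := dirichlet_ineq b20 th0 thb2 cw cg' dw w1 w2.
have E f : continuous f -> (forall x, f (x + b) = f x) ->
    segint 0 b f = segint y0 (y0 + b / 2) f + segint (y0 + b / 2) (y0 + b / 2 + b / 2) f.
  move=> cf pf; rewrite -segint_chasles// ?lerDl ?ltW//.
  by rewrite -addrA -splitr segint_periodic// ltW.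
have := @segint_variance g b (g y0) b0 cg.
rewrite (E (fun y => (g y - g y0) ^+ 2)); [|by cont|by move=> x; rewrite pg].
rewrite (E (fun y => g' y ^+ 2)); [|by cont|by move=> x; rewrite pg'].
have : 0 <= b * (segint 0 b g / b - g y0) ^+ 2 by rewrite mulr_ge0 ?sqr_ge0// ltW.
have := sqr_ge0 th.
set A := th ^+ 2; move: D1 D2; rewrite /w -/A.
set v1 := segint y0 _ _; set v2 := segint y0 _ _; set v3 := segint _ _ _; set v4 := segint _ _ _.
set v5 := segint 0 b (fun y => _); set v6 := b * _.
move=> D1 D2 A0 h6 E5; apply: (le_trans _ (lerD D1 D2)).
by rewrite -mulrDr; apply: ler_wpM2l => //; lra.
Qed.

(** The variance is nonnegative. *)
Lemma jensen f b : 0 < b -> continuous f ->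
  (segint 0 b f) ^+ 2 / b <= segint 0 b (fun y => f y ^+ 2).
Proof.
move=> b0 cf; have := @segint_variance f b 0 b0 cf; rewrite subr0.
have -> : segint 0 b (fun y => (f y - 0) ^+ 2) = segint 0 b (fun y => f y ^+ 2).
  by apply: eq_segint => y _; rewrite subr0.
move=> ->; have -> : b * (segint 0 b f / b) ^+ 2 = segint 0 b f ^+ 2 / b by field; rewrite gt_eqF.
by rewrite lerDr; apply: segint_ge0 => y _; exact: sqr_ge0.
Qed.

(** On a quarter of the period of the sine, let [ph] be the solution of
    [ph'' = - om ^+ 2 * ph] with the end values of [v]. Then [w = v - ph] vanishes
    at both ends, and the quadratic form of [v] is that of [w] plus a boundary
    term, equal to [- 2 * om * v s * v (s + l)]. As [om * l = pi / 2] is half of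
    what the Dirichlet inequality would allow, the form of [w] is coercive; the
    remaining terms convert a part [de] of it into the L2 norm of [v]. *)
Lemma half_ineq v v' s l om de : 0 < om -> om * l = pi / 2 -> 0 <= de <= 1 ->
  continuous v -> continuous v' -> (forall x, is_derive x 1 v (v' x)) ->
  de * om ^+ 2 * (segint s (s + l) (fun x => v x ^+ 2) / 2 - l * (v s ^+ 2 + v (s + l) ^+ 2))
    - 2 * om * v s * v (s + l)
  <= segint s (s + l) (fun x => v' x ^+ 2 - om ^+ 2 * v x ^+ 2).
Proof.
move=> om0 oml /andP[de0 de1] cv cv' dv.
have pi0 := pi_gt0 R.
have l0 : 0 < l by rewrite -(pmulr_rgt0 _ om0) oml; lra.
have sl : s <= s + l by rewrite lerDl ltW.
set p := v s; set q := v (s + l).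
pose ph x := p * cos (om * (x - s)) + q * sin (om * (x - s)).
pose ph' x := om * (q * cos (om * (x - s)) - p * sin (om * (x - s))).
have dl x : is_derive x 1 (fun x => om * (x - s)) om.
  by apply: (isd_eq (isd_scale om (isd_add (isd_id x) (isd_cst (- s) x)))); ring.
have cl : continuous (fun x => om * (x - s)) by cont.
have cph : continuous ph by rewrite /ph; cont.
have cph' : continuous ph' by rewrite /ph'; cont.
have dph x : is_derive x 1 ph (ph' x).
  apply: (isd_eq (isd_add (isd_scale p (isd_cos (dl x))) (isd_scale q (isd_sin (dl x))))).
  by rewrite /ph'; ring.
have dph' x : is_derive x 1 ph' (- om ^+ 2 * ph x).
  apply: (isd_eq (isd_scale om (isd_add (isd_scale q (isd_cos (dl x)))
    (isd_opp (isd_scale p (isd_sin (dl x))))))).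
  by rewrite /ph; ring.
have phs : ph s = p by rewrite /ph subrr mulr0 cos0 sin0; ring.
have ph's : ph' s = om * q by rewrite /ph' subrr mulr0 cos0 sin0; ring.
have al : s + l - s = l by ring.
have phe : ph (s + l) = q by rewrite /ph al oml cos_pihalf sin_pihalf; ring.
have ph'e : ph' (s + l) = - om * p by rewrite /ph' al oml cos_pihalf sin_pihalf; ring.
pose w x := v x - ph x.
pose w' x := v' x - ph' x.
have cw : continuous w by rewrite /w; cont.
have cw' : continuous w' by rewrite /w'; cont.
have dw x : is_derive x 1 w (w' x) by exact: (isd_add (dv x) (isd_opp (dph x))).
have ws : w s = 0 by rewrite /w phs subrr.
have we : w (s + l) = 0 by rewrite /w phe subrr.
(* The factor 3 / 2 lies between 1 and 2, the bound of [dirichlet_ineq] for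
   [om * l = pi / 2]. *)
have D : (3 / 2 * om) ^+ 2 * segint s (s + l) (fun x => w x ^+ 2) <= segint s (s + l) (fun x => w' x ^+ 2).
  by apply: (dirichlet_ineq l0 _ _ cw cw' dw) => //; [lra|rewrite (_ : _ * l = 3 / 2 * (om * l)); [rewrite oml; lra|ring]].
pose G x := ph x * ph' x + 2 * (w x * ph' x).
pose gG x := ph' x ^+ 2 - om ^+ 2 * ph x ^+ 2 + 2 * (w' x * ph' x) - 2 * om ^+ 2 * (w x * ph x).
have EG : segint s (s + l) gG = - 2 * om * p * q.
  rewrite (_ : - 2 * om * p * q = G (s + l) - G s); last first.
    by rewrite /G ws we phs phe ph's ph'e; ring.
  apply: segint_FTC => //; first by rewrite /gG; cont.
  move=> x _.
  apply: (isd_eq (isd_add (isd_mul (dph x) (dph' x)) (isd_scale 2 (isd_mul (dw x) (dph' x))))).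
  by rewrite /gG; ring.
have EQ : segint s (s + l) (fun x => v' x ^+ 2 - om ^+ 2 * v x ^+ 2) =
    segint s (s + l) (fun x => w' x ^+ 2) - om ^+ 2 * segint s (s + l) (fun x => w x ^+ 2) - 2 * om * p * q.
  have -> : - (2 * om * p * q) = segint s (s + l) gG by rewrite EG; ring.
  rewrite -segintZ; last by cont.
  rewrite -segintB; [|by cont|by cont].
  rewrite -segintD; [|by cont|by rewrite /gG; cont].
  by apply: eq_segint => x _; rewrite /gG /w /w'; ring.
rewrite EQ.
have B : segint s (s + l) (fun x => v x ^+ 2) <=
    2 * segint s (s + l) (fun x => w x ^+ 2) + 2 * (p ^+ 2 + q ^+ 2) * l.
  have -> : 2 * (p ^+ 2 + q ^+ 2) * l = segint s (s + l) (fun=> 2 * (p ^+ 2 + q ^+ 2)).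
    by rewrite segint_cst//; ring.
  rewrite -segintZ; last by cont.
  rewrite -segintD; [|by cont|by cont].
  apply: le_segint; [by cont|by cont|move=> x _].
  have -> : v x = w x + ph x by rewrite /w; ring.
  have h1 := sqr_ge0 (w x - ph x).
  have h2 := sqr_ge0 (p * sin (om * (x - s)) - q * cos (om * (x - s))).
  have h3 := cos2Dsin2 (om * (x - s)).
  have : ph x ^+ 2 + (p * sin (om * (x - s)) - q * cos (om * (x - s))) ^+ 2 = p ^+ 2 + q ^+ 2.
    rewrite -[RHS]mulr1 -h3 /ph; ring.
  by move=> h4; nra.
have W0 : 0 <= segint s (s + l) (fun x => w x ^+ 2) by apply: segint_ge0 => x _; exact: sqr_ge0.
move: B D W0.
set A := segint _ _ _; set W := segint _ _ _; set W' := segint _ _ _ => B D W0.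
have o2 := sqr_ge0 om.
have H1 : A / 2 - l * (p ^+ 2 + q ^+ 2) <= W by nra.
have H2 : de * om ^+ 2 * (A / 2 - l * (p ^+ 2 + q ^+ 2)) <= de * om ^+ 2 * W.
  by apply: ler_wpM2l => //; apply: mulr_ge0.
have H3 : de * (om ^+ 2 * W) <= 1 * (om ^+ 2 * W).
  by apply: ler_wpM2r => //; apply: mulr_ge0.
have D' : 9 / 4 * (om ^+ 2 * W) <= W' by apply: le_trans D; rewrite le_eqVlt; apply/orP; left; apply/eqP; field.
have h0 : 0 <= om ^+ 2 * W by apply: mulr_ge0.
rewrite -mulrA in H2.
by rewrite lerD2r -mulrA; lra.
Qed.

End CircleInequalities.

(** * Antiperiodic functions with vanishing sums at the nodes *)

Section StabilityOnCircle.
Context {R : realType}.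
Implicit Types (f z v : R -> R) (x : R).

Lemma segint_split f a d n : 0 <= d -> continuous f ->
  segint a (a + n%:R * d) f = \sum_(i < n) segint (a + i%:R * d) (a + i%:R * d + d) f.
Proof.
move=> d0 cf; elim: n => [|n IHn]; first by rewrite big_ord0 mul0r addr0 /segint set_itv1 Rintegral_set1.
rewrite big_ord_recr/= -IHn -segint_chasles ?lerDl// ?mulr_ge0//.
by congr (segint _ _ _); rewrite -natr1; ring.
Qed.

(** Small enough for the loss [de * om ^+ 2 * l * (v s ^+ 2 + v (s + l) ^+ 2)] of
    [half_ineq], summed over the half-intervals, to be absorbed by the gain
    [2 * om * S] of [stability_core], in which the values at the midpoints are
    bounded by means of powers of [4]. *)
Definition stab_de (k : nat) : R := (2 * (1 + k%:R * 4 ^+ k))^-1.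

Lemma stab_de_gt0 k : 0 < stab_de k.
Proof.
have h : 0 <= k%:R * 4 ^+ k :> R by rewrite mulr_ge0// exprn_ge0.
by rewrite /stab_de invr_gt0; lra.
Qed.

Lemma stab_de_le1 k : stab_de k <= 1.
Proof.
have h : 0 <= k%:R * 4 ^+ k :> R by rewrite mulr_ge0// exprn_ge0.
by rewrite /stab_de invf_le1; lra.
Qed.

(** Let [P i] and [Q i] be the values of [z] at the nodes [x0 + i / k] and at the
    following midpoints. The conditions say that [P i.+1 = - (Q i.+1 + Q i)], so
    the sum of the boundary terms [- 2 * om * P * Q] of [half_ineq] over the [2k]
    half-intervals is [2 * om * S] with [S = \sum_i P i ^+ 2]. As the midpoint
    value [Q 0] vanishes, all [Q i] are controlled by [S], and [2 * om * S] pays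
    for the terms in which the end values are lost. *)
Lemma stability_core k z z' sg x0 : (0 < k)%N ->
  continuous z -> continuous z' -> (forall x, is_derive x 1 z (z' x)) ->
  (forall x, z (x + 1) = sg * z x) -> (forall x, z' (x + 1) = sg * z' x) -> sg ^+ 2 = 1 ->
  (forall i : nat, z (x0 + i%:R / k%:R) + z (x0 + i%:R / k%:R + (2 * k%:R)^-1)
     + z (x0 + i%:R / k%:R - (2 * k%:R)^-1) = 0) ->
  z (x0 + (2 * k%:R)^-1) = 0 ->
  stab_de k * (k%:R * pi) ^+ 2 / 2 * segint 0 1 (fun x => z x ^+ 2)
    <= segint 0 1 (fun x => z' x ^+ 2 - (k%:R * pi) ^+ 2 * z x ^+ 2).
Proof.
move=> k0 cz cz' dz pz pz' sg2 cond q0.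
set om : R := k%:R * pi; set h : R := (2 * k%:R)^-1; set de := stab_de k.
have kR : 0 < k%:R :> R by rewrite ltr0n.
have pi0 := pi_gt0 R.
have om0 : 0 < om by rewrite mulr_gt0.
have h0 : 0 < h by rewrite invr_gt0 mulr_gt0.
have omh : om * h = pi / 2 by rewrite /om /h; field; rewrite gt_eqF.
have dh : k%:R^-1 = 2 * h :> R by rewrite /h; field; rewrite gt_eqF.
have de01 : 0 <= de <= 1 by rewrite ltW ?stab_de_gt0//= stab_de_le1.
pose X i := x0 + i%:R * (2 * h).
pose P i := z (X i); pose Q i := z (X i + h).
have XS i : X i + h + h = X i.+1 by rewrite /X -natr1; ring.
have Xk : X k = x0 + 1 by rewrite /X -dh mulfV// gt_eqF.
have hQ0 : Q 0 = 0 by rewrite /Q /X mul0r addr0.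
have hQk : Q k = 0 by rewrite /Q Xk addrAC pz q0 mulr0.
have hPk : P k ^+ 2 = P 0 ^+ 2 by rewrite /P Xk pz exprMn sg2 mul1r /X mul0r addr0.
have rec i : P i.+1 = - (Q i.+1 + Q i).
  have := cond i.+1; rewrite dh -/h -/(X i.+1) -/(P i.+1) -/(Q i.+1).
  have -> : X i.+1 - h = X i + h by rewrite -XS; ring.
  by rewrite -/(Q i) => E; lra.
pose S := \sum_(i < k) P i.+1 ^+ 2.
have S0 : 0 <= S by apply: sumr_ge0 => i _; exact: sqr_ge0.
have PS i : (i < k)%N -> P i.+1 ^+ 2 <= S.
  move=> ik; rewrite /S (bigD1 (Ordinal ik))//= lerDl.
  by apply: sumr_ge0 => j _; exact: sqr_ge0.
have QS i : (i <= k)%N -> Q i ^+ 2 <= 4 ^+ i * S.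
  elim: i => [_|i IHi ik]; first by rewrite hQ0 expr0n/= expr0 mul1r.
  have := IHi (ltnW ik); have := PS i ik; have := rec i.
  have : 1 <= 4 ^+ i :> R by apply: exprn_ege1; lra.
  rewrite [4 ^+ i.+1]exprS; set A := 4 ^+ i => A1 E1 E2 E3.
  have -> : Q i.+1 = - P i.+1 - Q i by lra.
  have := sqr_ge0 (P i.+1 - Q i).
  have : S <= A * S by rewrite ler_peMl.
  have : (- P i.+1 - Q i) ^+ 2 + (P i.+1 - Q i) ^+ 2 = 2 * P i.+1 ^+ 2 + 2 * Q i ^+ 2 by ring.
  lra.
have sQ : \sum_(i < k) Q i ^+ 2 <= k%:R * 4 ^+ k * S.
  apply: (@le_trans _ _ (\sum_(i < k) 4 ^+ k * S)).
    apply: ler_sum => i _; apply: (le_trans (QS i (ltnW (ltn_ord i)))).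
    by apply: ler_wpM2r => //; apply: ler_weXn2l; [lra|exact: ltnW].
  by rewrite sumr_const card_ord -[_ *+ k]mulr_natl mulrA.
have sP : \sum_(i < k) P i ^+ 2 = S.
  rewrite /S -(prednK k0) big_ord_recl [in RHS]big_ord_recr/= prednK// hPk addrC.
  by congr (_ + _); apply: eq_bigr.
have sPQ : \sum_(i < k) Q i * P i = \sum_(i < k) Q i.+1 * P i.+1.
  rewrite -(prednK k0) big_ord_recl [in RHS]big_ord_recr/= prednK// hQk hQ0 !mul0r addrC.
  by congr (_ + _); apply: eq_bigr.
have sPQ2 : \sum_(i < k) (Q i * P i + Q i * P i.+1) = - S.
  rewrite big_split/= sPQ -big_split/= /S -sumrN.
  by apply: eq_bigr => i _; rewrite rec; ring.
have cq : continuous (fun x => z' x ^+ 2 - om ^+ 2 * z x ^+ 2) by cont.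
have cz2 : continuous (fun x => z x ^+ 2) by cont.
have pq y : z' (y + 1) ^+ 2 - om ^+ 2 * z (y + 1) ^+ 2 = z' y ^+ 2 - om ^+ 2 * z y ^+ 2.
  by rewrite pz pz' !exprMn sg2 !mul1r.
have pz2 y : z (y + 1) ^+ 2 = z y ^+ 2 by rewrite pz exprMn sg2 mul1r.
have split f : continuous f -> (forall y, f (y + 1) = f y) -> segint 0 1 f =
    \sum_(i < k) (segint (X i) (X i + h) f + segint (X i + h) (X i + h + h) f).
  move=> cf pf; rewrite -(@segint_periodic _ _ _ x0 ler01 cf pf).
  have -> : x0 + 1 = x0 + k%:R * (2 * h) by rewrite -dh mulfV// gt_eqF.
  rewrite segint_split//; last by lra.
  apply: eq_bigr => i _; rewrite -segint_chasles// ?lerDl ?ltW//.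
  by congr segint; rewrite /X; ring.
rewrite (split _ cq pq) (split _ cz2 pz2).
set A := \sum_(i < k) _; set B := \sum_(i < k) _.
have key : de * om ^+ 2 * (A / 2 - h * (S + 2 * (\sum_(i < k) Q i ^+ 2) + S)) + 2 * om * S <= B.
  have -> : 2 * om * S = - (2 * om * \sum_(i < k) (Q i * P i + Q i * P i.+1)) by rewrite sPQ2; ring.
  rewrite -{1}sP {1}/S /A mulr_suml [2 * _]mulr_sumr -!big_split/= [h * _]mulr_sumr -sumrB.
  rewrite [X in X - _]mulr_sumr [X in _ - X]mulr_sumr -sumrB.
  apply: ler_sum => i _.
  have H1 := half_ineq (X i) om0 omh de01 cz cz' dz.
  have H2 := half_ineq (X i + h) om0 omh de01 cz cz' dz.
  move: (lerD H1 H2); rewrite XS -/(P i) -/(Q i) -/(P i.+1).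
  apply: le_trans; rewrite le_eqVlt; apply/orP; left; apply/eqP; ring.
apply: le_trans key.
have E : de * (2 * (1 + k%:R * 4 ^+ k)) = 1.
  have h1 : 0 <= k%:R * 4 ^+ k :> R by rewrite mulr_ge0// exprn_ge0.
  by rewrite /de /stab_de mulVf// gt_eqF//; lra.
have E1 : S + 2 * (\sum_(i < k) Q i ^+ 2) + S <= 2 * (1 + k%:R * 4 ^+ k) * S by lra.
have E2 : de * om ^+ 2 * h * (S + 2 * (\sum_(i < k) Q i ^+ 2) + S) <= 2 * om * S.
  apply: (@le_trans _ _ (de * om ^+ 2 * h * (2 * (1 + k%:R * 4 ^+ k) * S))).
    apply: ler_wpM2l => //; case/andP: de01 => d0 _.
    by rewrite mulr_ge0 ?mulr_ge0 ?sqr_ge0// ltW.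
  have -> : de * om ^+ 2 * h * (2 * (1 + k%:R * 4 ^+ k) * S) =
    de * (2 * (1 + k%:R * 4 ^+ k)) * (om * h) * om * S by ring.
  rewrite E omh mul1r; apply: ler_wpM2r => //; apply: ler_wpM2r; first exact: ltW.
  have := @pihalf_lt2 R; lra.
have -> : de * om ^+ 2 * (A / 2 - h * (S + 2 * (\sum_(i < k) Q i ^+ 2) + S)) =
  de * om ^+ 2 / 2 * A - de * om ^+ 2 * h * (S + 2 * (\sum_(i < k) Q i ^+ 2) + S) by ring.
lra.
Qed.

End StabilityOnCircle.

(** * The stability inequality in one and two variables *)

Section StabilityOnTorus.
Context {R : realType}.
Implicit Types (v : R -> R) (x y : R) (f fx fy : R * R -> R).

Lemma sinDnpi k x : sin (x + k%:R * pi) = (-1) ^+ k * sin x :> R.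
Proof.
elim: k => [|k IHk]; first by rewrite mul0r addr0 mul1r.
by rewrite -natr1 mulrDl mul1r addrA sinDpi IHk exprS; ring.
Qed.

Lemma cosDnpi k x : cos (x + k%:R * pi) = (-1) ^+ k * cos x :> R.
Proof.
elim: k => [|k IHk]; first by rewrite mul0r addr0 mul1r.
by rewrite -natr1 mulrDl mul1r addrA cosDpi IHk exprS; ring.
Qed.

(** Subtracting the multiple of the sine that agrees with [v] at the first
    midpoint changes neither the conditions, which the sine satisfies, nor the
    quadratic form, since the sine is in its kernel. This reduces to
    [stability_core]. *)
Lemma stability1 k v v' x0 : (0 < k)%N ->
  continuous v -> continuous v' -> (forall x, is_derive x 1 v (v' x)) ->
  (forall x, v (x + 1) = (-1) ^+ k * v x) -> (forall x, v' (x + 1) = (-1) ^+ k * v' x) ->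
  (forall i : nat, v (x0 + i%:R / k%:R) + v (x0 + i%:R / k%:R + (2 * k%:R)^-1)
     + v (x0 + i%:R / k%:R - (2 * k%:R)^-1) = 0) ->
  stab_de k * (k%:R * pi) ^+ 2 / 2 *
    segint 0 1 (fun x => (v x - v (x0 + (2 * k%:R)^-1) * sin (k%:R * pi * (x - x0))) ^+ 2)
    <= segint 0 1 (fun x => v' x ^+ 2 - (k%:R * pi) ^+ 2 * v x ^+ 2).
Proof.
move=> k0 cv cv' dv pv pv' cond.
set om : R := k%:R * pi; set h : R := (2 * k%:R)^-1; set al := v (x0 + h).
have kR : 0 < k%:R :> R by rewrite ltr0n.
have omh : om * h = pi / 2 by rewrite /om /h; field; rewrite gt_eqF.
have sg2 : ((-1) ^+ k) ^+ 2 = 1 :> R by rewrite sqrr_sign.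
pose s x := al * sin (om * (x - x0)).
pose s' x := al * (om * cos (om * (x - x0))).
have dl x : is_derive x 1 (fun x => om * (x - x0)) om.
  by apply: (isd_eq (isd_scale om (isd_add (isd_id x) (isd_cst (- x0) x)))); ring.
have cs : continuous s by rewrite /s; cont.
have cs' : continuous s' by rewrite /s'; cont.
have ds x : is_derive x 1 s (s' x) by exact: (isd_scale al (isd_sin (dl x))).
have ds' x : is_derive x 1 s' (- om ^+ 2 * s x).
  by apply: (isd_eq (isd_scale al (isd_scale om (isd_cos (dl x))))); rewrite /s; ring.
have shift x : om * (x + 1 - x0) = om * (x - x0) + k%:R * pi by rewrite /om; ring.
have ps x : s (x + 1) = (-1) ^+ k * s x by rewrite /s shift sinDnpi; ring.
have ps' x : s' (x + 1) = (-1) ^+ k * s' x by rewrite /s' shift cosDnpi; ring.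
pose z x := v x - s x; pose z' x := v' x - s' x.
have cz : continuous z by rewrite /z; cont.
have cz' : continuous z' by rewrite /z'; cont.
have dz x : is_derive x 1 z (z' x) by exact: (isd_add (dv x) (isd_opp (ds x))).
have pz x : z (x + 1) = (-1) ^+ k * z x by rewrite /z pv ps; ring.
have pz' x : z' (x + 1) = (-1) ^+ k * z' x by rewrite /z' pv' ps'; ring.
have condz i : z (x0 + i%:R / k%:R) + z (x0 + i%:R / k%:R + h) + z (x0 + i%:R / k%:R - h) = 0.
  have E0 : om * (x0 + i%:R / k%:R - x0) = 0 + i%:R * pi by rewrite /om; field; rewrite gt_eqF.
  have E1 : om * (x0 + i%:R / k%:R + h - x0) = pi / 2 + i%:R * pi.
    by rewrite -omh /om; field; rewrite gt_eqF.
  have E2 : om * (x0 + i%:R / k%:R - h - x0) = - (pi / 2) + i%:R * pi.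
    by rewrite -omh /om; field; rewrite gt_eqF.
  have := cond i; rewrite /z /s E0 E1 E2 !sinDnpi sin0 sinN sin_pihalf => c; lra.
have z0 : z (x0 + h) = 0.
  rewrite /z /s (_ : x0 + h - x0 = h); last by ring.
  by rewrite omh sin_pihalf /al; ring.
have := stability_core k0 cz cz' dz pz pz' sg2 condz z0.
suff -> : segint 0 1 (fun x => v' x ^+ 2 - om ^+ 2 * v x ^+ 2) =
  segint 0 1 (fun x => z' x ^+ 2 - om ^+ 2 * z x ^+ 2) by [].
pose G x := 2 * (v x * s' x) - s x * s' x.
pose g x := 2 * (v' x * s' x + v x * (- om ^+ 2 * s x)) - (s' x * s' x + s x * (- om ^+ 2 * s x)).
have cg : continuous g by rewrite /g; cont.
have Eg : segint 0 1 g = 0.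
  have -> : segint 0 1 g = G (0 + 1) - G 0.
    rewrite add0r; apply: segint_FTC => // x _.
    by apply: (isd_eq (isd_add (isd_scale 2 (isd_mul (dv x) (ds' x)))
      (isd_opp (isd_mul (ds x) (ds' x))))); rewrite /g; ring.
  rewrite /G pv ps' ps; have := sg2; set e := (-1) ^+ k; clearbody e => e2.
  have -> : 2 * (e * v 0 * (e * s' 0)) - e * s 0 * (e * s' 0) =
    e ^+ 2 * (2 * (v 0 * s' 0) - s 0 * s' 0) by ring.
  by rewrite e2; ring.
have -> : segint 0 1 (fun x => v' x ^+ 2 - om ^+ 2 * v x ^+ 2) =
    segint 0 1 (fun x => z' x ^+ 2 - om ^+ 2 * z x ^+ 2) + segint 0 1 g.
  rewrite -segintD; [|by cont|exact: cg].
  by apply: eq_segint => x _; rewrite /g /z /z'; ring.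
by rewrite Eg addr0.
Qed.

(** Derivatives are taken along the axes, and are explicit arguments, because all
    the estimates are made slice by slice. *)
Definition C1 f fx fy :=
  [/\ continuous f, continuous fx, continuous fy,
      forall x y, is_derive x 1 (fun x => f (x, y)) (fx (x, y)) &
      forall x y, is_derive y 1 (fun y => f (x, y)) (fy (x, y))].

Lemma isd_unique (g : R -> R) x (l m : R) : is_derive x 1 g l -> is_derive x 1 g m -> l = m.
Proof. by move=> [_ <-] [_ <-]. Qed.

Lemma C1_shift (s : R) (u ux uy : R * R -> R) : C1 u ux uy -> (forall x y, u (x + 1, y) = s * u (x, y)) ->
  forall x y, ux (x + 1, y) = s * ux (x, y) /\ uy (x + 1, y) = s * uy (x, y).
Proof.
move=> [_ _ _ d1 d2] us x y; split.
  have H1 := isd_comp (isd_add (isd_id x) (isd_cst 1 x)) (d1 (x + 1) y).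
  have E : (fun z : R => u (z + 1, y)) = (fun z => s * u (z, y)).
    by rewrite funeqE => z; exact: us.
  by rewrite /= E in H1; have := isd_unique H1 (isd_scale s (d1 x y)); rewrite addr0 mul1r.
have H1 := d2 (x + 1) y.
have E : (fun z : R => u (x + 1, z)) = (fun z => s * u (x, z)).
  by rewrite funeqE => z; exact: us.
by rewrite E in H1; exact: (isd_unique H1 (isd_scale s (d2 x y))).
Qed.

Lemma per_derive2 (b : R) (F Fy : R * R -> R) (x y : R) :
  (forall x y : R, is_derive y 1 (fun y => F (x, y)) (Fy (x, y))) ->
  (forall x y, F (x, y + b) = F (x, y)) -> Fy (x, y + b) = Fy (x, y).
Proof.
move=> dF pF.
have H1 := isd_comp (isd_add (isd_id y) (isd_cst b y)) (dF x (y + b)).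
have E : (fun y : R => F (x, y + b)) = (fun y => F (x, y)).
  by rewrite funeqE => t; exact: pF.
by rewrite /= E in H1; have := isd_unique H1 (dF x y); rewrite addr0 mul1r.
Qed.

(** The first term comes from the gap of the Wirtinger inequality on vertical
    circles, the second one from the inequality for vertical means. *)
Definition stab_cst n (th : R) : R :=
  Num.min ((th ^+ 2 - (n%:R * pi) ^+ 2) / 2) (stab_de n * (n%:R * pi) ^+ 2 / 4).

Lemma stab_cst_gt0 n th : (0 < n)%N -> n%:R * pi < th -> 0 < stab_cst n th.
Proof.
move=> n0 nth; have om0 : 0 < n%:R * pi :> R by rewrite mulr_gt0 ?ltr0n// pi_gt0.
have th0 := lt_trans om0 nth.
rewrite /stab_cst lt_min; apply/andP; split; apply: divr_gt0 => //.
  by rewrite subr_gt0 ltr_sqr// ?nnegrE ltW.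
by rewrite mulr_gt0 ?stab_de_gt0// exprn_gt0.
Qed.

(** Split [f] into its vertical mean [m] and [f - m]. The conditions and
    [stability1] deal with [m]. For [f - m] the vertical derivative alone has
    energy at least [th ^+ 2] times the norm, by Wirtinger, and
    [th ^+ 2 > om ^+ 2]. *)
Lemma stability2 k b th x0 f fx fy : (0 < k)%N -> 0 < b -> k%:R * pi < th -> th * b < 2 * pi ->
  C1 f fx fy ->
  (forall x y, f (x + 1, y) = (-1) ^+ k * f (x, y)) -> (forall x y, f (x, y + b) = f (x, y)) ->
  (forall i : nat, let v x := segint 0 b (fun y => f (x, y)) in
     v (x0 + i%:R / k%:R) + v (x0 + i%:R / k%:R + (2 * k%:R)^-1)
       + v (x0 + i%:R / k%:R - (2 * k%:R)^-1) = 0) ->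
  exists al, stab_cst k th *
     boxint 0 1 0 b (fun p => (f p - al * sin (k%:R * pi * (p.1 - x0))) ^+ 2)
   <= boxint 0 1 0 b (fun p => fx p ^+ 2 + fy p ^+ 2 - (k%:R * pi) ^+ 2 * f p ^+ 2).
Proof.
move=> k0 b0 omth thb Cf fper1 fperb cond; have [cf cfx cfy dfx dfy] := Cf.
set om : R := k%:R * pi.
have kR : 0 < k%:R :> R by rewrite ltr0n.
have om0 : 0 < om by rewrite mulr_gt0// pi_gt0.
have th0 : 0 <= th by rewrite ltW// (lt_trans om0).
have fxper1 x y : fx (x + 1, y) = (-1) ^+ k * fx (x, y) by have [] := C1_shift Cf fper1 x y.
have fyperb x y : fy (x, y + b) = fy (x, y) by exact: (per_derive2 x y dfy fperb).
pose m x := b^-1 * segint 0 b (fun y => f (x, y)).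
pose m' x := b^-1 * segint 0 b (fun y => fx (x, y)).
have cv : continuous (fun x => segint 0 b (fun y => f (x, y))) by exact: ct_segint.
have cv' : continuous (fun x => segint 0 b (fun y => fx (x, y))) by exact: ct_segint.
have cm : continuous m by rewrite /m; cont.
have cm' : continuous m' by rewrite /m'; cont.
have dm x : is_derive x 1 m (m' x) by exact: (isd_scale b^-1 (isd_segint 0 b x cf cfx dfx)).
have RIs (g : R * R -> R) x c : (forall x y, g (x + 1, y) = c * g (x, y)) -> continuous g ->
    segint 0 b (fun y => g (x + 1, y)) = c * segint 0 b (fun y => g (x, y)).
  move=> gp cg; rewrite -segintZ; last exact: ct_slice2.
  by apply: eq_segint => y _; exact: gp.
have pm x : m (x + 1) = (-1) ^+ k * m x by rewrite /m (RIs f x _ fper1 cf); ring.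
have pm' x : m' (x + 1) = (-1) ^+ k * m' x by rewrite /m' (RIs fx x _ fxper1 cfx); ring.
have condm i : m (x0 + i%:R / k%:R) + m (x0 + i%:R / k%:R + (2 * k%:R)^-1)
       + m (x0 + i%:R / k%:R - (2 * k%:R)^-1) = 0.
  by rewrite /m -!mulrDr cond mulr0.
have S1 := stability1 k0 cm cm' dm pm pm' condm.
set al := m (x0 + (2 * k%:R)^-1) in S1; exists al; rewrite /stab_cst -/om in S1 *.
set c1 := stab_de k * om ^+ 2 in S1 *.
have c10 : 0 < c1 by rewrite mulr_gt0 ?stab_de_gt0// exprn_gt0.
set s := fun x => al * sin (om * (x - x0)) in S1.
have cs : continuous s by rewrite /s; cont.
have cs2 : continuous (fun p : R * R => s p.1) by exact: (ct_comp cs (@ct_fst R)).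
have cm2 : continuous (fun p : R * R => m p.1) by exact: (ct_comp cm (@ct_fst R)).
pose W := boxint 0 1 0 b (fun p => (f p - m p.1) ^+ 2).
pose I1 := segint 0 1 (fun x => (m x - s x) ^+ 2).
pose Q1 := segint 0 1 (fun x => m' x ^+ 2 - om ^+ 2 * m x ^+ 2).
have cW : continuous (fun x => segint 0 b (fun y => (f (x, y) - m x) ^+ 2)).
  by apply: (@ct_segint _ (fun p => (f p - m p.1) ^+ 2)); cont.
have W0 : 0 <= W by apply: boxint_ge0 => x y _ _; exact: sqr_ge0.
have I0 : 0 <= I1 by apply: segint_ge0 => x _; exact: sqr_ge0.
have mE x : segint 0 b (fun y => f (x, y)) / b = m x by rewrite /m mulrC.
have var x r : segint 0 b (fun y => (f (x, y) - r) ^+ 2) =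
    segint 0 b (fun y => (f (x, y) - m x) ^+ 2) + b * (m x - r) ^+ 2.
  have cfx2 : continuous (fun y => f (x, y)) by exact: ct_slice2.
  by rewrite (segint_variance r b0 cfx2) mE.
have lower : (th ^+ 2 - om ^+ 2) * W + b * Q1 <=
    boxint 0 1 0 b (fun p => fx p ^+ 2 + fy p ^+ 2 - om ^+ 2 * f p ^+ 2).
  rewrite /W /boxint /Q1 -segintZ; last exact: cW.
  rewrite -segintZ; last by cont.
  rewrite -segintD; [|by cont|by cont].
  apply: le_segint; [by cont| |].
    by apply: (@ct_segint _ (fun p => fx p ^+ 2 + fy p ^+ 2 - om ^+ 2 * f p ^+ 2)); cont.
  move=> x _.
  have c1x : continuous (fun y => fx (x, y)) by exact: ct_slice2.
  have c2x : continuous (fun y => fy (x, y)) by exact: ct_slice2.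
  have c3x : continuous (fun y => f (x, y)) by exact: ct_slice2.
  rewrite segintB; [|by cont|by cont].
  rewrite segintD; [|by cont|by cont].
  rewrite segintZ; last by cont.
  have J := jensen b0 c1x.
  have Wi := wirtinger b0 th0 thb c3x c2x (dfy x) (fperb x) (fyperb x).
  rewrite mE in Wi.
  have -> : segint 0 b (fun y => f (x, y) ^+ 2) =
      segint 0 b (fun y => (f (x, y) - m x) ^+ 2) + b * m x ^+ 2.
    rewrite -{2}[m x]subr0 -var; by apply: eq_segint => y _; rewrite subr0.
  have EJ : b * m' x ^+ 2 = segint 0 b (fun y => fx (x, y)) ^+ 2 / b.
    by rewrite /m'; field; rewrite gt_eqF.
  rewrite -EJ in J; move: J Wi.
  set A := segint 0 b _; set B := segint 0 b _; set D := segint 0 b _.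
  move=> J Wi; lra.
have E : boxint 0 1 0 b (fun p => (f p - s p.1) ^+ 2) = W + b * I1.
  rewrite /W /boxint /I1 -segintZ; last by cont.
  rewrite -segintD; [|by cont|by cont].
  by apply: eq_segint => x _; rewrite (var x (s x)).
have -> : boxint 0 1 0 b (fun p => (f p - al * sin (om * (p.1 - x0))) ^+ 2) = W + b * I1 by [].
apply: le_trans lower; rewrite mulrDr; apply: lerD.
  apply: ler_wpM2r => //; rewrite ge_min; apply/orP; left.
  have : 0 <= th ^+ 2 - om ^+ 2 by rewrite subr_ge0 ler_sqr ?nnegrE// ltW.
  by lra.
rewrite mulrCA; apply: ler_wpM2l; first exact: ltW.
apply: le_trans S1; apply: ler_wpM2r => //; rewrite ge_min; apply/orP; right.
by lra.
Qed.

End StabilityOnTorus.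

(** * Choice of the origin and of the combination *)

Section NodeZero.
Context {R : realType}.

(** The cyclic shift has a single orbit. *)
Lemma odd_cycle n : odd_perm (perm (@ordS_inj n.+1)) = odd n.
Proof.
set s := perm _.
have sX i (j : 'I_n.+1) : ((s ^+ i)%g j = (j + i) %% n.+1 :> nat)%N.
  elim: i => [|i IHi]; first by rewrite expg0 perm1 addn0 modn_small.
  by rewrite expgSr permM permE /= IHi -addn1 modnDml -addnA addn1.
have orb : porbit s ord0 = [set: 'I_n.+1]%SET.
  apply/setP => j; rewrite inE; apply/porbitP; exists j.
  by apply/val_inj; rewrite /= sX add0n modn_small.
have : porbits s = [set [set: 'I_n.+1]]%SET.
  apply/setP => A; rewrite inE; apply/imsetP/eqP => [[j _ ->]|->].
    have : j \in porbit s ord0 by rewrite orb inE.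
    by rewrite -eq_porbit_mem orb => /eqP ->.
  by exists ord0 => //; rewrite orb.
by rewrite /odd_perm => ->; rewrite cards1 card_ord /= addbT negbK.
Qed.

Lemma ct_prod (T : topologicalType) (I : finType) (F : I -> T -> R) :
  (forall i, continuous (F i)) -> continuous (fun x => \prod_i F i x).
Proof.
move=> cF.
have -> : (fun x => \prod_i F i x) = \prod_i F i by rewrite funeqE => x; rewrite fct_prodE.
elim/big_ind : _ => [|G1 G2 c1 c2|i _]; [exact: ct_cst|exact: (ct_mul c1 c2)|exact: cF].
Qed.

(** Translation by [1 / k] permutes the columns of the matrix [g j (x + i / k)]
    cyclically, which multiplies the determinant by [(-1) ^+ (k - 1)], and
    multiplies the last column by [(-1) ^+ k]. The determinant thus changes sign
    and has a zero [x0]; [c] is a unit vector of the kernel there. The conditions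
    at other nodes follow by antiperiodicity. *)
Lemma node_zero n (g : 'I_n.+1 -> R -> R) : (forall j, continuous (g j)) ->
  (forall j x, g j (x + 1) = (-1) ^+ n.+1 * g j x) ->
  exists x0 (c : 'I_n.+1 -> R), [/\ 0 <= x0 <= 1, \sum_j c j ^+ 2 = 1 &
    forall i : nat, \sum_j c j * g j (x0 + i%:R / n.+1%:R) = 0].
Proof.
move=> cg pg.
have k0 : n.+1%:R != 0 :> R by rewrite pnatr_eq0.
pose M x : 'M[R]_n.+1 := \matrix_(j, i) g j (x + i%:R / n.+1%:R).
pose D x := \det (M x).
have cD : continuous D.
  rewrite (_ : D = fun x => \sum_(s : 'S_n.+1) (-1) ^+ s * \prod_i g i (x + (s i)%:R / n.+1%:R)).
    apply: ct_sum => s; apply: ct_mul; first exact: ct_cst.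
    apply: ct_prod => i; apply: ct_comp; first exact: cg.
    by cont.
  rewrite funeqE => x; rewrite /D /determinant; apply: eq_bigr => s _.
  by congr (_ * _); apply: eq_bigr => i _; rewrite mxE.
pose sg : R := (-1) ^+ n.+1.
pose e : 'rV[R]_n.+1 := \row_i (if i == ord_max then sg else 1).
pose s := perm (@ordS_inj n.+1).
have MS x : M (x + n.+1%:R^-1) = col_perm s (M x) *m diag_mx e.
  apply/matrixP => j i; rewrite mul_mx_diag !mxE permE /=.
  have -> : x + n.+1%:R^-1 + i%:R / n.+1%:R = x + i.+1%:R / n.+1%:R.
    by rewrite -natr1; field.
  have [->|ni] := eqVneq i ord_max.
    by rewrite /= modnn mul0r addr0 divff// pg mulrC.
  rewrite mulr1 modn_small// ltnS ltn_neqAle -ltnS ltn_ord andbT.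
  by apply: contra ni => /eqP E; apply/eqP/val_inj.
have DS x : D (x + n.+1%:R^-1) = - D x.
  rewrite /D MS det_mulmx det_diag col_permE det_mulmx det_perm odd_permV odd_cycle.
  rewrite (bigD1 ord_max)//= big1 ?mulr1; last by move=> i /negbTE ni; rewrite mxE ni.
  rewrite mxE eqxx -mulrA -signr_odd /sg -[(-1) ^+ n.+1]signr_odd /=.
  by case: (odd n) => /=; ring.
have [x0 x01 D0] : exists2 x0, x0 \in `[0, n.+1%:R^-1] & D x0 = 0.
  apply: IVT; [by rewrite invr_ge0|exact: continuous_subspaceT|].
  have -> : D n.+1%:R^-1 = - D 0 by rewrite -DS add0r.
  rewrite ge_min le_max oppr_le0 oppr_ge0.
  by case: (leP (D 0) 0) => [_|/ltW ->]; rewrite ?orbT.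
have /eqP/det0P[v v0 vM] := D0.
pose N := \sum_j v 0 j ^+ 2.
have N0 : 0 < N.
  have [j vj] : exists j, v 0 j != 0.
    apply/existsP; apply: contraNT v0 => /existsPn v0; apply/eqP/rowP => j.
    by rewrite mxE; apply/eqP; have := v0 j; rewrite negbK.
  rewrite /N (bigD1 j)//= ltr_pwDl// ?sumr_ge0//; last by move=> i _; exact: sqr_ge0.
  by rewrite exprn_even_gt0.
exists x0, (fun j => v 0 j / Num.sqrt N); split.
- have /andP[-> /= x1] : 0 <= x0 <= n.+1%:R^-1 by move: x01; rewrite in_itv.
  by rewrite (le_trans x1)// invf_le1// ?ltr0n// ler1n.
- under eq_bigr do rewrite exprMn exprVn sqr_sqrtr ?(ltW N0)//.
  by rewrite -mulr_suml divff// gt_eqF.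
have base (i : 'I_n.+1) : \sum_j v 0 j * g j (x0 + i%:R / n.+1%:R) = 0.
  have /rowP /(_ i) := vM; rewrite !mxE => E0; rewrite -[RHS]E0.
  by apply: eq_bigr => j _; rewrite mxE.
move=> i; transitivity ((\sum_j v 0 j * g j (x0 + i%:R / n.+1%:R)) / Num.sqrt N).
  by rewrite mulr_suml; apply: eq_bigr => j _; ring.
suff -> : \sum_j v 0 j * g j (x0 + i%:R / n.+1%:R) = 0 by rewrite mul0r.
rewrite (divn_eq i n.+1); set r := (i %% n.+1)%N; have rn : (r < n.+1)%N by rewrite ltn_mod.
elim: (i %/ n.+1)%N => [|q IHq]; first by rewrite mul0n add0n (base (Ordinal rn)).
rewrite -[RHS](mulr0 sg) -[in RHS]IHq mulr_sumr; apply: eq_bigr => j _.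
rewrite mulrCA -pg; congr (_ * g j _).
rewrite mulSn -addnA natrD mulrDl divff// ; ring.
Qed.

End NodeZero.

Section StabilityFamily.
Context {R : realType}.

Lemma isd_sum (I : finType) (F : I -> R -> R) (F' : I -> R) (x : R) :
  (forall i, is_derive x 1 (F i) (F' i)) ->
  is_derive x 1 (fun y => \sum_i F i y) (\sum_i F' i).
Proof.
move=> dF.
have -> : (fun y => \sum_i F i y) = \sum_i F i by rewrite funeqE => y; rewrite fct_sumE.
elim/big_ind2 : _ => [|G1 s1 G2 s2 d1 d2|i _]; [exact: isd_cst|exact: (isd_add d1 d2)|exact: dF].
Qed.

Lemma C1_sum (I : finType) (c : I -> R) (u ux uy : I -> R * R -> R) :
  (forall i, C1 (u i) (ux i) (uy i)) ->
  C1 (fun p => \sum_i c i * u i p) (fun p => \sum_i c i * ux i p) (fun p => \sum_i c i * uy i p).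
Proof.
move=> Cu; split.
- by apply: ct_sum => i; have [? _ _ _ _] := Cu i; cont.
- by apply: ct_sum => i; have [_ ? _ _ _] := Cu i; cont.
- by apply: ct_sum => i; have [_ _ ? _ _] := Cu i; cont.
- by move=> x y; apply: isd_sum => i; have [_ _ _ dx _] := Cu i; exact: isd_scale.
- by move=> x y; apply: isd_sum => i; have [_ _ _ _ dy] := Cu i; exact: isd_scale.
Qed.

Lemma sqr_sum_orth (I : finType) (c a : I -> R) : (forall i j, i != j -> a i * a j = 0) ->
  (\sum_i c i * a i) ^+ 2 = \sum_i c i ^+ 2 * a i ^+ 2.
Proof.
move=> aa; rewrite expr2 mulr_suml; apply: eq_bigr => i _.
rewrite mulr_sumr (bigD1 i)//= big1 ?addr0; first by ring.
move=> j ji; rewrite mulrACA aa ?mulr0//.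
by rewrite eq_sym.
Qed.

(** [node_zero], applied to the sums of three values of the vertical means, gives
    [x0] and [c]; since the functions have disjoint supports the quadratic form of
    their combination is the combination of their forms. *)
Lemma stability_family n b th (u ux uy : 'I_n.+1 -> R * R -> R) :
  let k := n.+1 in let om := k%:R * pi in
  0 < b -> om < th -> th * b < 2 * pi ->
  (forall j, C1 (u j) (ux j) (uy j)) ->
  (forall j x y, u j (x + 1, y) = (-1) ^+ k * u j (x, y)) ->
  (forall j x y, u j (x, y + b) = u j (x, y)) ->
  (forall i j, i != j -> forall p,
     [/\ u i p * u j p = 0, ux i p * ux j p = 0 & uy i p * uy j p = 0]) ->
  exists x0 (c : 'I_n.+1 -> R) al, [/\ 0 <= x0 <= 1, \sum_j c j ^+ 2 = 1 &
    stab_cst k th *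
    boxint 0 1 0 b (fun p => (\sum_j c j * u j p - al * sin (om * (p.1 - x0))) ^+ 2)
    <= \sum_j c j ^+ 2 *
      boxint 0 1 0 b (fun p => ux j p ^+ 2 + uy j p ^+ 2 - om ^+ 2 * u j p ^+ 2)].
Proof.
move=> k om b0 omth thb Cu per1 perb orth.
pose v j x := segint 0 b (fun y => u j (x, y)).
have cu j : continuous (u j) by have [] := Cu j.
have cv j : continuous (v j) by exact: ct_segint.
have pv j x : v j (x + 1) = (-1) ^+ k * v j x.
  rewrite /v -segintZ; last exact: ct_slice2.
  by apply: eq_segint => y _; exact: per1.
pose h : R := (2 * k%:R)^-1.
pose g j x := v j x + v j (x + h) + v j (x - h).
have cg j : continuous (g j).
  have c1 : continuous (fun x => v j (x + h)) by apply: ct_comp; [exact: cv|cont].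
  have c2 : continuous (fun x => v j (x - h)) by apply: ct_comp; [exact: cv|cont].
  by have := cv j; rewrite /g => ?; cont.
have pg j x : g j (x + 1) = (-1) ^+ k * g j x.
  by rewrite /g (addrAC x 1 h) (addrAC x 1 (- h)) !pv; ring.
have [x0 [c [x01 c1 gc]]] := node_zero cg pg.
have Cf := C1_sum c Cu.
have [||i v'|al S] := @stability2 R k b th x0 _ _ _ isT b0 omth thb Cf.
- by move=> x y; rewrite mulr_sumr; apply: eq_bigr => j _; rewrite per1; ring.
- by move=> x y; apply: eq_bigr => j _; rewrite perb.
- have E x : v' x = \sum_j c j * v j x.
    rewrite /v' segint_sum; last by move=> j; have := ct_slice2 (x:=x) (cu j) => ?; cont.
    by apply: eq_bigr => j _; rewrite segintZ//; exact: ct_slice2.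
  rewrite !E -[RHS](gc i) -!big_split/=.
  by apply: eq_bigr => j _; rewrite /g; ring.
exists x0, c, al; split=> //.
apply: (le_trans S).
have cE j : continuous (fun p => ux j p ^+ 2 + uy j p ^+ 2 - om ^+ 2 * u j p ^+ 2).
  by have [? ? ? _ _] := Cu j; cont.
rewrite le_eqVlt; apply/orP; left; apply/eqP.
transitivity (boxint 0 1 0 b (fun p => \sum_j c j ^+ 2 *
  (ux j p ^+ 2 + uy j p ^+ 2 - om ^+ 2 * u j p ^+ 2))); last first.
  rewrite boxint_sum; last by move=> j; exact: (ct_mul (@ct_cst _ _ (c j ^+ 2)) (cE j)).
  by apply: eq_bigr => j _; rewrite boxintZ//; exact: cE.
apply: eq_boxint => x y _ _.
rewrite !sqr_sum_orth; [|by move=> i j /orth /(_ (x, y))[]..].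
rewrite mulr_sumr -big_split/= -sumrB; apply: eq_bigr => j _. rewrite /om; ring.
Qed.

End StabilityFamily.

Local Open Scope quotient_scope.

(** * Test functions on the torus *)

Section TorusFunctions.
Context {R : realType} (b : R).
Hypothesis b0 : 0 < b.
Local Notation pr := (@torus_pi R 1 b).
Implicit Types (D : set (torus 1 b)) (f : torus 1 b -> R) (p q : R * R).

Lemma pr_eqP p q : pr p = pr q <-> lattice_rel 1 b p q.
Proof.
split=> h.
  have /eqmodP : p = q %[mod {eq_quot (lattice_equiv 1 b)}] by exact: h.
  by [].
have : p = q %[mod {eq_quot (lattice_equiv 1 b)}] by apply/eqmodP.
exact.
Qed.

Lemma pr_continuous : continuous pr.
Proof. exact: pi_continuous. Qed.

Lemma pr_shift1 x y (m : int) : pr (x + m%:~R, y) = pr (x, y).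
Proof.
apply/pr_eqP; rewrite /lattice_rel/= subrr mul0r rpred0 andbT divr1.
by rewrite addrAC subrr add0r rpred_int.
Qed.

Lemma pr_shift2 x y (m : int) : pr (x, y + m%:~R * b) = pr (x, y).
Proof.
apply/pr_eqP; rewrite /lattice_rel/= subrr mul0r rpred0 /=.
by rewrite addrAC subrr add0r mulfK ?gt_eqF// rpred_int.
Qed.

Lemma pr_per1 x y : pr (x + 1, y) = pr (x, y).
Proof. exact: (pr_shift1 x y 1). Qed.

Lemma pr_perb x y : pr (x, y + b) = pr (x, y).
Proof. by have := pr_shift2 x y 1; rewrite mul1r. Qed.

Lemma open_pr D : open D -> open (pr @^-1` D).
Proof. by []. Qed.

Lemma slice_derive1 (F : R * R -> R) x y : derivable F (x, y) (1, 0) ->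
  is_derive x 1 (fun x => F (x, y)) ('D_(1, 0) F (x, y)).
Proof.
have E : (fun h : R => h^-1 *: ((F \o shift (x, y)) (h *: (1, 0) : R * R) - F (x, y))) =
    (fun h : R => h^-1 *: (((fun x => F (x, y)) \o shift x) (h *: (1 : R)) - F (x, y))).
  rewrite funeqE => h /=; congr (_ *: (F _ - _)).
  by apply/pair_equal_spec; split => /=; rewrite ?scaler0 ?add0r.
rewrite /derivable /derive E => dF; split.
  by [].
by [].
Qed.

Lemma slice_derive2 (F : R * R -> R) x y : derivable F (x, y) (0, 1) ->
  is_derive y 1 (fun y => F (x, y)) ('D_(0, 1) F (x, y)).
Proof.
have E : (fun h : R => h^-1 *: ((F \o shift (x, y)) (h *: (0, 1) : R * R) - F (x, y))) =
    (fun h : R => h^-1 *: (((fun y => F (x, y)) \o shift y) (h *: (1 : R)) - F (x, y))).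
  rewrite funeqE => h /=; congr (_ *: (F _ - _)).
  by apply/pair_equal_spec; split => /=; rewrite ?scaler0 ?add0r.
by rewrite /derivable /derive E => dF; split.
Qed.

Lemma test_C1 D f : test_function D f -> C1 (f \o pr) (dx f) (dy f).
Proof.
move=> [sf _].
have d0 p : differentiable (f \o pr) p by exact: (sf [::] p I).
have d1 p : differentiable (dx f) p by exact: (sf [:: (1, 0)] p I).
have d2 p : differentiable (dy f) p by exact: (sf [:: (0, 1)] p I).
split.
- by move=> p; exact: differentiable_continuous.
- by move=> p; exact: differentiable_continuous.
- by move=> p; exact: differentiable_continuous.
- by move=> x y; apply: slice_derive1; exact: diff_derivable.
- by move=> x y; apply: slice_derive2; exact: diff_derivable.
Qed.

(** The support of [f] is closed and contained in [D]. *)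
Lemma test_near0 D f p : test_function D f -> ~ D (pr p) -> \forall q \near p, f (pr q) = 0.
Proof.
move=> [_ sD] nD.
have : nbhs p (pr @^-1` (~` closure [set t | f t != 0])).
  apply: open_nbhs_nbhs; split; last by move=> /sD.
  by apply: open_pr; exact: closed_openC (@closed_closure _ _).
apply: filterS => q /= nq; apply/eqP; apply: contrapT => /negP fq.
by apply: nq; exact: subset_closure.
Qed.

Lemma test_zero D f p : test_function D f -> ~ D (pr p) ->
  [/\ f (pr p) = 0, dx f p = 0 & dy f p = 0].
Proof.
move=> tf nD; have N := test_near0 tf nD; split.
- exact: nbhs_singleton N.
- by rewrite /dx (near_eq_derive (g := cst 0))// derive_cst.
- by rewrite /dy (near_eq_derive (g := cst 0))// derive_cst.
Qed.

Definition sqnorm f : R := boxint 0 1 0 b (fun p => f (pr p) ^+ 2).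
Definition dirichlet f : R := boxint 0 1 0 b (fun p => dx f p ^+ 2 + dy f p ^+ 2).

(** Otherwise [f] has a zero on every vertical circle, and [dirichlet_periodic],
    integrated over these circles, bounds its energy from below. *)
Lemma vertical_circle D f th : test_function D f -> 0 <= th -> th * b < pi ->
  dirichlet f < th ^+ 2 * sqnorm f -> exists xi, forall y, D (pr (xi, y)).
Proof.
move=> tf th0 thb EN; apply: contrapT => nxi.
have [cf cfx cfy dfx dfy] := test_C1 tf.
suff : th ^+ 2 * sqnorm f <= dirichlet f by rewrite leNgt EN.
rewrite /sqnorm -boxintZ; last by cont.
apply: le_segint.
- by apply: (@ct_segint _ (fun p => th ^+ 2 * (f (pr p)) ^+ 2)); cont.
- exact: (ct_segint (ct_add (ct_exp cfx) (ct_exp cfy))).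
move=> x _.
have [y0 nD] : exists y0, ~ D (pr (x, y0)).
  by apply/existsNP => h; apply: nxi; exists x.
have c1 : continuous (fun y => f (pr (x, y))) by exact: (ct_slice2 cf).
have c2 : continuous (fun y => dy f (x, y)) by exact: (ct_slice2 cfy).
have c3 : continuous (fun y => dx f (x, y)) by exact: (ct_slice2 cfx).
rewrite segintZ; last by cont.
have pf y : f (pr (x, y + b)) = f (pr (x, y)) by rewrite pr_perb.
have pfy y : dy f (x, y + b) = dy f (x, y).
  by apply: (@per_derive2 _ b (f \o pr) (dy f) x y dfy) => s t; rewrite /= pr_perb.
have [fz _ _] := test_zero tf nD.
apply: (le_trans (dirichlet_periodic b0 th0 thb c1 c2 (dfy x) pf pfy fz)).
apply: le_segint; [exact: (ct_exp c2)|exact: (ct_add (ct_exp c3) (ct_exp c2))|move=> y _].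
by rewrite lerDr sqr_ge0.
Qed.

End TorusFunctions.

(** * Lifts with the symmetry of the sine, and stability for partitions *)

Section Lifts.
Context {R : realType} (b : R).
Hypothesis b0 : 0 < b.
Local Notation pr := (@torus_pi R 1 b).
Implicit Types (D : set (torus 1 b)) (f : torus 1 b -> R) (p q : R * R).

Lemma test_near0_grad D f p : test_function D f -> ~ D (pr p) ->
  \forall q \near p, [/\ f (pr q) = 0, dx f q = 0 & dy f q = 0].
Proof.
move=> tf nD; have /near_join := test_near0 tf nD.
apply: filterS => q N; split.
- exact: nbhs_singleton N.
- by rewrite /dx (near_eq_derive (g := cst 0))// derive_cst.
- by rewrite /dy (near_eq_derive (g := cst 0))// derive_cst.
Qed.

Lemma floor_near (x : R) : x \isn't a Num.int ->
  \forall y \near x, Num.floor y = Num.floor x.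
Proof.
move=> nx; have /andP[le lt] := floor_itv x.
have lt' : (Num.floor x)%:~R < x.
  by rewrite lt_neqAle le andbT; apply: contra nx => /eqP <-; rewrite rpred_int.
have H1 : \forall y \near x, (Num.floor x)%:~R < y by exact: lt_nbhsr lt'.
have H2 : \forall y \near x, y < (Num.floor x + 1)%:~R by exact: lt_nbhsl lt.
near=> y; apply: floor_def; apply/andP; split; last by near: y.
by apply: ltW; near: y.
Unshelve. all: by end_near. Qed.

(** Changes sign across each of the lines [x = xi + m], [m] an integer. *)
Definition flip (xi x : R) : R := (-1) ^ (Num.floor (x - xi)).

Lemma flip_sqr xi x : flip xi x ^+ 2 = 1.
Proof.
rewrite /flip; case: (Num.floor _) => m.
  by rewrite -[_ ^ Posz m]/((-1) ^+ m) sqrr_sign.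
by rewrite -[_ ^ Negz m]/((-1) ^- m.+1) exprVn sqrr_sign invr1.
Qed.

Lemma flip_shift xi x : flip xi (x + 1) = - flip xi x.
Proof.
rewrite /flip addrAC floorDrz ?rpred1// floor1 expfzDr ?expr1z ?mulrN1//.
Qed.

Lemma ct_near (T : topologicalType) (F G : T -> R) (p : T) : {for p, continuous F} ->
  (\forall q \near p, F q = G q) -> {for p, continuous G}.
Proof.
move=> cF E; rewrite /prop_for /continuous_at -(nbhs_singleton E).
by apply: cvg_trans cF; exact: near_eq_cvg E.
Qed.

(** The sign is locally constant where [f] may be nonzero. *)
Lemma lift_C1 D f (e : R -> R) : test_function D f ->
  (forall p, (\forall y \near p.1, e y = e p.1) \/ ~ D (pr p)) ->
  C1 (fun p => e p.1 * f (pr p)) (fun p => e p.1 * dx f p) (fun p => e p.1 * dy f p).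
Proof.
move=> tf eD; have [cf cfx cfy dfx dfy] := test_C1 tf.
have loc p : \forall q \near p, [/\ e p.1 * f (pr q) = e q.1 * f (pr q),
    e p.1 * dx f q = e q.1 * dx f q & e p.1 * dy f q = e q.1 * dy f q].
  have [ep|nD] := eD p.
    have : \forall q \near p, e q.1 = e p.1 by exact: (cvg_fst ep).
    by apply: filterS => q ->.
  by apply: filterS (test_near0_grad tf nD) => q [-> -> ->]; rewrite !mulr0.
have locx x y : \forall t \near x, e x * f (pr (t, y)) = e t * f (pr (t, y)).
  have c : (fun t : R => (t, y)) @ x --> (x, y).
    by have h := @ct_pair R R (fun t => t) (fun=> y) (@ct_id R) (@ct_cst R R y); exact: (h x).
  have H := c _ (loc (x, y)).
  have {}H : nbhs x ((fun t : R => (t, y)) @^-1` _) := H.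
  by apply: filterS H => t [].
split.
- move=> p; apply: (@ct_near _ (fun q => e p.1 * f (pr q))); last by apply: filterS (loc p) => q [].
  by have h := ct_mul (@ct_cst _ _ (e p.1)) cf; exact: h.
- move=> p; apply: (@ct_near _ (fun q => e p.1 * dx f q)); last by apply: filterS (loc p) => q [].
  by have h := ct_mul (@ct_cst _ _ (e p.1)) cfx; exact: h.
- move=> p; apply: (@ct_near _ (fun q => e p.1 * dy f q)); last by apply: filterS (loc p) => q [].
  by have h := ct_mul (@ct_cst _ _ (e p.1)) cfy; exact: h.
- by move=> x y; apply: isd_near (locx x y); exact: (isd_scale (e x) (dfx x y)).
- by move=> x y; exact: (isd_scale (e x) (dfy x y)).
Unshelve. all: by end_near. Qed.

(** For [k] odd, the test functions of [D] vanish near the circle above [xi], so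
    the sign may flip there, once in every period. *)
Lemma lift_sign k D : (odd k -> exists xi, forall y, ~ D (pr (xi, y))) ->
  exists e : R -> R, [/\ forall x, e x ^+ 2 = 1, forall x, e (x + 1) = (-1) ^+ k * e x &
    forall f, test_function D f ->
    C1 (fun p => e p.1 * f (pr p)) (fun p => e p.1 * dx f p) (fun p => e p.1 * dy f p)].
Proof.
case: (boolP (odd k)) => ok.
  move=> /(_ isT)[xi nD]; exists (flip xi); split.
  - exact: flip_sqr.
  - by move=> x; rewrite flip_shift -signr_odd ok expr1 mulN1r.
  - move=> f tf; apply: (lift_C1 tf) => -[x y] /=.
    have [/intrP[m xm]|nx] := boolP (x - xi \is a Num.int).
      right; rewrite (_ : x = xi + m%:~R); last by rewrite -xm; ring.
      by rewrite pr_shift1.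
    left; have c : (fun t : R => t - xi) @ x --> x - xi.
      by have h := @ct_add R R (fun t => t) (fun=> - xi) (@ct_id R) (@ct_cst R R (- xi)); exact: (h x).
    have H := c _ (floor_near nx).
    have {}H : nbhs x ((fun t : R => t - xi) @^-1` _) := H.
    by apply: filterS H => t /= E; rewrite /flip E.
move=> _; exists (fun=> 1); split.
- by move=> x; rewrite expr1n.
- by move=> x; rewrite -signr_odd (negbTE ok) mulr1.
- by move=> f tf; apply: (@lift_C1 D f (fun=> 1) tf) => p; left; near=> y.
Unshelve. all: by end_near. Qed.

(** For [k] odd, the circle that [D j] misses is provided by the next domain. The
    signs [e j] depend on the domains only: this is what allows the test functions
    to vary while [e] is fixed. *)
Lemma partition_stability n th (D : 'I_n.+1 -> set (torus 1 b)) :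
  let k := n.+1 in let om := k%:R * pi in
  (0 < n)%N -> om < th -> th * b < 2 * pi ->
  (forall i j, i != j -> D i `&` D j = set0) ->
  (odd k -> forall j, exists xi, forall y, D j (pr (xi, y))) ->
  exists e : 'I_n.+1 -> R -> R, [/\ forall j x, e j x ^+ 2 = 1,
    forall j x, e j (x + 1) = (-1) ^+ k * e j x,
    forall j f, test_function (D j) f ->
      C1 (fun p => e j p.1 * f (pr p)) (fun p => e j p.1 * dx f p) (fun p => e j p.1 * dy f p) &
    forall f : 'I_n.+1 -> torus 1 b -> R,
      (forall j, test_function (D j) (f j)) -> (forall j, 0 < sqnorm (f j)) ->
    exists x0 (c : 'I_n.+1 -> R) al, [/\ 0 <= x0 <= 1, \sum_j c j ^+ 2 = 1 &
    stab_cst k th *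
    boxint 0 1 0 b (fun p => (\sum_j c j * ((Num.sqrt (sqnorm (f j)))^-1 * (e j p.1 * f j (pr p)))
      - al * sin (om * (p.1 - x0))) ^+ 2)
    <= \sum_j c j ^+ 2 * (dirichlet (f j) / sqnorm (f j) - om ^+ 2)]].
Proof.
move=> k om n0 omth thb DD circ.
have H j : exists e : R -> R, [/\ forall x, e x ^+ 2 = 1, forall x, e (x + 1) = (-1) ^+ k * e x &
    forall f, test_function (D j) f ->
    C1 (fun p => e p.1 * f (pr p)) (fun p => e p.1 * dx f p) (fun p => e p.1 * dy f p)].
  apply: lift_sign => ok; have [xi hxi] := circ ok (ordS j); exists xi => y Dj.
  have jS : j != ordS j.
    apply/eqP => /(congr1 val) /=; have := ltn_ord j; rewrite leq_eqVlt => /orP[/eqP jn|jn].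
      by rewrite jn modnn => j0; move: jn n0; rewrite j0 => -[<-].
    by rewrite modn_small// => /eqP; rewrite eqn_leq ltnn andbF.
  have : (D j `&` D (ordS j)) (pr (xi, y)) by split.
  by rewrite DD.
have [e He] := choice H.
exists e; split.
- by move=> j; have [] := He j.
- by move=> j; have [] := He j.
- by move=> j f tf; have [_ _ +] := He j; exact.
move=> f tf Nf.
pose r j := (Num.sqrt (sqnorm (f j)))^-1.
have r2 j : r j ^+ 2 = (sqnorm (f j))^-1.
  by rewrite /r exprVn sqr_sqrtr// ltW.
pose u j p := r j * (e j p.1 * f j (pr p)).
pose ux j p := r j * (e j p.1 * dx (f j) p).
pose uy j p := r j * (e j p.1 * dy (f j) p).
have Cu j : C1 (u j) (ux j) (uy j).
  have [_ _ /(_ _ (tf j))[c1 c2 c3 d1 d2]] := He j.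
  rewrite /u /ux /uy; split.
  - exact: (ct_mul (@ct_cst _ _ (r j)) c1).
  - exact: (ct_mul (@ct_cst _ _ (r j)) c2).
  - exact: (ct_mul (@ct_cst _ _ (r j)) c3).
  - by move=> x y; exact: (isd_scale (r j) (d1 x y)).
  - by move=> x y; exact: (isd_scale (r j) (d2 x y)).
have per1 j x y : u j (x + 1, y) = (-1) ^+ k * u j (x, y).
  by rewrite /u /= pr_per1; have [_ -> _] := He j; ring.
have perb j x y : u j (x, y + b) = u j (x, y) by rewrite /u /= pr_perb.
have uz j p : ~ D j (pr p) -> [/\ u j p = 0, ux j p = 0 & uy j p = 0].
  move=> nD; have [z1 z2 z3] := test_zero (tf j) nD.
  by split; [rewrite /u z1|rewrite /ux z2|rewrite /uy z3]; rewrite mulr0 mulr0.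
have orth i j : i != j -> forall p,
     [/\ u i p * u j p = 0, ux i p * ux j p = 0 & uy i p * uy j p = 0].
  move=> ij p.
  have [nD|nD] : ~ D i (pr p) \/ ~ D j (pr p).
    apply/not_andP => -[Di Dj].
    have : (D i `&` D j) (pr p) by split.
    by rewrite DD.
  - by have [-> -> ->] := uz i p nD; split; rewrite mul0r.
  - by have [-> -> ->] := uz j p nD; split; rewrite mulr0.
have [x0 [c [al [x01 c1 S]]]] := stability_family b0 omth thb Cu per1 perb orth.
exists x0, c, al; split=> //; apply: (le_trans S).
rewrite le_eqVlt; apply/orP; left; apply/eqP; apply: eq_bigr => j _; congr (_ * _).
have [cf cfx cfy _ _] := test_C1 (tf j).
have e2 x := let: And3 h _ _ := He j in h x.
transitivity (boxint 0 1 0 b (fun p => r j ^+ 2 * (dx (f j) p ^+ 2 + dy (f j) p ^+ 2)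
    - om ^+ 2 * r j ^+ 2 * (f j (pr p)) ^+ 2)).
  apply: eq_boxint => x y _ _; rewrite /ux /uy /u /= !exprMn e2; ring.
have c1' : continuous (fun p => dx (f j) p ^+ 2 + dy (f j) p ^+ 2).
  exact: (ct_add (ct_exp cfx) (ct_exp cfy)).
have c2' : continuous (fun p => f j (pr p) ^+ 2) by exact: (ct_exp cf).
rewrite boxintB; [|exact: (ct_mul (@ct_cst _ _ _) c1')|exact: (ct_mul (@ct_cst _ _ _) c2')].
rewrite (boxintZ _ _ _ _ _ c1') (boxintZ _ _ _ _ _ c2').
rewrite -/(sqnorm (f j)) -/(dirichlet (f j)) r2.
by field; rewrite gt_eqF.
Qed.

End Lifts.

(** * Lebesgue integrals over the fundamental cell *)

Section CellIntegrals.
Context {R : realType}.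
Local Notation leb := (@lebesgue_measure R).
Local Notation mu := (@lebesgue_measure R \x @lebesgue_measure R)%E.
Implicit Types (F : R * R -> R).

Lemma floor_approx (x : R) :
  (Num.floor (n.+1%:R * x))%:~R / n.+1%:R @[n --> \oo] --> x.
Proof.
apply/cvgrPdist_le => e e0; near=> n.
have n0 : 0 < n.+1%:R :> R by rewrite ltr0n.
have /andP[l1 l2] := floor_itv (n.+1%:R * x).
set m : R := (Num.floor _)%:~R in l1 *.
have l2' : n.+1%:R * x < m + 1 by move: l2; rewrite intrD.
have -> : x - m / n.+1%:R = (n.+1%:R * x - m) / n.+1%:R by field; rewrite gt_eqF.
rewrite ger0_norm; last by rewrite divr_ge0 ?subr_ge0// ltW.
apply: (@le_trans _ _ n.+1%:R^-1).
  by rewrite ler_pdivrMr// mulVf ?gt_eqF//; lra.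
near: n; have [N _ HN] := @near_infty_natSinv_lt R (PosNum e0).
by exists N => // n Nn; apply: ltW; exact: HN.
Unshelve. all: by end_near. Qed.

(** The sigma-algebra is the product one, so measurability is obtained by
    approximation: [F] is the limit of [F (floor (n * x) / n, y)], and each of
    these functions is continuous in [y] on countably many vertical bands. *)
Lemma measurable_cont2 F : continuous F ->
  measurable_fun [set: measurableTypeR R * measurableTypeR R] F.
Proof.
move=> cF.
pose h n (p : R * R) : R := F ((Num.floor (n.+1%:R * p.1))%:~R / n.+1%:R, p.2).
apply: (@measurable_fun_cvg _ (measurableTypeR R * measurableTypeR R)%type R setT h); last first.
  move=> [x y] _ /=.
  apply: (@cvg_comp _ _ _ (fun n : nat => (Num.floor (n.+1%:R * x))%:~R / n.+1%:R : R) (fun t => F (t, y)) _ (nbhs x)).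
    exact: floor_approx.
  exact: (ct_slice1 cF).
move=> n _ Y mY; rewrite setTI.
have -> : h n @^-1` Y = \bigcup_(m : int)
    ([set x : R | Num.floor (n.+1%:R * x) = m] `*` [set y | Y (F (m%:~R / n.+1%:R, y))]).
  apply/seteqP; split => [[x y] hY|[x y] [m _ [/= xm hY]]].
    by exists (Num.floor (n.+1%:R * x)).
  by rewrite /h/= xm.
apply: countable_bigcupT_measurable => [|m]; first exact/countableP.
apply: measurableX.
  have -> : [set x : R | Num.floor (n.+1%:R * x) = m] =
      (fun x => n.+1%:R * x) @^-1` `[m%:~R, (m + 1)%:~R[.
    apply/seteqP; split => x /=; rewrite in_itv/=; first by move=> <-; exact: floor_itv.
    exact: floor_def.
  rewrite -[X in measurable X]setTI.
  have c : continuous (fun x : R => n.+1%:R * x) by cont.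
  exact: (continuous_measurable_fun c).
rewrite -[X in measurable X]setTI.
exact: (continuous_measurable_fun (@ct_slice2 _ _ (m%:~R / n.+1%:R) cF)).
Qed.

Variable b : R.
Hypothesis b0 : 0 < b.

Lemma measurable_cell : measurable (cell 1 b : set (measurableTypeR R * measurableTypeR R)).
Proof. by apply: measurableX; exact: measurable_itv. Qed.

Lemma cell_finite : (mu (cell 1 b) < +oo)%E.
Proof.
have -> : mu (cell 1 b) = (leb `[0%R, 1%R[%classic * leb `[0%R, b[%classic)%E.
  by apply: product_measure1E; exact: measurable_itv.
by rewrite !lebesgue_measure_itv/= !lte_fin ltr01 b0 -!EFinB -EFinM ltry.
Qed.

Lemma cont_measurable F : continuous F ->
  measurable_fun (cell 1 b : set (measurableTypeR R * measurableTypeR R)) F.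
Proof. by move=> cF; apply: measurable_funTS; exact: measurable_cont2. Qed.

Lemma cont_cell_bounded F : continuous F -> exists M, forall p, cell 1 b p -> `|F p| <= M.
Proof.
move=> cF; have [M [_ HM]] := @box_bounded R F 0 1 0 b cF.
exists M => -[x y] [/=]; rewrite !in_itv/= => /andP[x0 x1] /andP[y0 y1].
by apply: HM; rewrite ?x0 ?y0 ltW.
Qed.

Lemma bounded_integrable F :
  measurable_fun (cell 1 b : set (measurableTypeR R * measurableTypeR R)) F ->
  (exists M, forall p, cell 1 b p -> `|F p| <= M) -> mu.-integrable (cell 1 b) (EFin \o F).
Proof.
move=> mF [M HM]; apply: measurable_bounded_integrable => //; [exact: measurable_cell|exact: cell_finite|].
exists M; split; first exact: num_real.
by move=> N MN p cp; apply: (le_trans (HM p cp)); exact: ltW.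
Qed.

Lemma cont_integrable F : continuous F -> mu.-integrable (cell 1 b) (EFin \o F).
Proof.
by move=> cF; apply: bounded_integrable; [exact: cont_measurable|exact: cont_cell_bounded].
Qed.

(** Fubini on a half-open rectangle; the missing sides are null sets. *)
Lemma cell_integral F : continuous F ->
  (\int[mu]_(p in cell 1 b) (F p)%:E = (boxint 0 1 0 b F)%:E)%E.
Proof.
move=> cF.
have iF := cont_integrable cF.
pose G := (EFin \o F) \_ (cell 1 b).
have iG : mu.-integrable setT G.
  by apply/integrable_restrict => //; rewrite ?setTI//; exact: measurable_cell.
rewrite integral_mkcond -/G -(@integral12_prod_meas1 _ _ _ _ _ leb leb G iG).
pose V x := segint 0 b (fun y => F (x, y)).
have cV : continuous V by exact: ct_segint.
have segE (H : R -> R) (c : R) : continuous H ->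
    (\int[leb]_(y in `[0%R, c[) (H y)%:E = (segint 0 c H)%:E)%E.
  move=> cH; rewrite integral_itv_bndo_bndc; last first.
    by apply/measurable_EFinP; apply: measurable_funTS; exact: continuous_measurable_fun.
  rewrite /segint /Rintegral fineK//; apply: integrable_fin_num => //; exact: integrable_seg.
rewrite /boxint -(segE V 1 cV) [RHS]integral_mkcond.
apply: eq_integral => x _; rewrite /G patchE.
case: ifPn => [|] xI.
  transitivity (\int[leb]_y (((fun y : R => (F (x, y))%:E) \_ `[0%R, b[) y))%E.
    apply: eq_integral => y _; rewrite /= !patchE /cell.
    by rewrite in_setX /= xI.
  by rewrite -integral_mkcond segE//; exact: ct_slice2.
transitivity (\int[leb]_y (cst 0 y))%E; last by rewrite integral0.
apply: eq_integral => y _; rewrite /= patchE /cell in_setX /=.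
by rewrite (negbTE xI).
Qed.

Lemma cell_Rintegral F : continuous F -> \int[mu]_(p in cell 1 b) F p = boxint 0 1 0 b F.
Proof. by move=> cF; rewrite /Rintegral cell_integral. Qed.

End CellIntegrals.

(** * Test functions of nearly the energy of an eigenvalue *)

Section EigenvalueTest.
Context {R : realType} (b : R).
Hypothesis b0 : 0 < b.
Local Notation mu := (@lebesgue_measure R \x @lebesgue_measure R)%E.
Local Notation pr := (@torus_pi R 1 b).
Local Notation cell := (cell 1 b : set (measurableTypeR R * measurableTypeR R)).
Local Notation integ h := (mu.-integrable cell (EFin \o h)).
Implicit Types (h g : R * R -> R) (D : set (torus 1 b)) (f : torus 1 b -> R).

Lemma integ_sqr h (d : R) : measurable_fun cell h ->
  (\int[mu]_(p in cell) ((h p) ^+ 2)%:E <= d%:E)%E -> integ (fun p => h p ^+ 2).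
Proof.
move=> mh hd; apply/integrableP; split.
  by apply/measurable_EFinP; exact: measurable_funX.
apply: le_lt_trans (ltry d); apply: le_trans hd.
rewrite le_eqVlt; apply/orP; left; apply/eqP; apply: eq_integral => p _ /=.
by rewrite ger0_norm// sqr_ge0.
Qed.

Lemma integ_le h g : measurable_fun cell h -> integ g -> (forall p, `|h p| <= g p) -> integ h.
Proof.
move=> mh ig hg; apply: le_integrable ig; [exact: measurable_cell|exact/measurable_EFinP|].
move=> p _ /=; rewrite lee_fin; apply: (le_trans (hg p)); exact: ler_norm.
Qed.

Lemma integD h g : integ h -> integ g -> integ (fun p => h p + g p).
Proof.
move=> ih ig; have := integrableD (measurable_cell b) ih ig.
by apply: eq_integrable => //; exact: measurable_cell.
Qed.

Lemma integZ (c : R) h : integ h -> integ (fun p => c * h p).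
Proof.
move=> ih; have := integrableZl (measurable_cell b) c ih.
by apply: eq_integrable => //; exact: measurable_cell.
Qed.

Lemma integ_mul h g : measurable_fun cell h -> measurable_fun cell g ->
  integ (fun p => h p ^+ 2) -> integ (fun p => g p ^+ 2) -> integ (fun p => h p * g p).
Proof.
move=> mh mg ih ig; apply: integ_le (integD ih ig) _; first exact: measurable_funM.
move=> p; rewrite normrM -(real_normK (num_real (h p))) -(real_normK (num_real (g p))).
have := sqr_ge0 (`|h p| - `|g p|); have := sqr_ge0 (`|h p|); have := sqr_ge0 (`|g p|).
have -> : (`|h p| - `|g p|) ^+ 2 = `|h p| ^+ 2 - 2 * (`|h p| * `|g p|) + `|g p| ^+ 2 by ring.
by lra.
Qed.

Lemma L2_near (F : (R * R -> R)^nat) (U : R * R -> R) (d : R) : L2_cvg 1 b F U -> 0 < d ->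
  \forall n \near \oo, (\int[mu]_(p in cell) ((F n p - U p) ^+ 2)%:E <= d%:E)%E.
Proof.
move=> [_ FU] d0.
have : nbhs (0%E : \bar R) [set x : \bar R | (x < d%:E)%E].
  by apply: open_nbhs_nbhs; split; [exact: open_ereal_lt_ereal|rewrite /= lte_fin].
move=> nb.
have H : \forall n \near \oo, (\int[mu]_(p in cell) ((F n p - U p) ^+ 2)%:E < d%:E)%E := FU _ nb.
by apply: filterS H => n /ltW.
Qed.

Lemma young (eta s t : R) : 0 < eta -> s * t <= eta^-1 / 2 * s ^+ 2 + eta / 2 * t ^+ 2.
Proof.
move=> eta0; rewrite -subr_ge0.
have -> : eta^-1 / 2 * s ^+ 2 + eta / 2 * t ^+ 2 - s * t = eta^-1 / 2 * (s - eta * t) ^+ 2.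
  by field; rewrite gt_eqF.
by rewrite mulr_ge0 ?sqr_ge0// divr_ge0// invr_ge0 ltW.
Qed.

Lemma young_up (eta F G : R) : 0 < eta ->
  G ^+ 2 <= F * G + (eta^-1 / 2 * (G - F) ^+ 2 + eta / 2 * G ^+ 2).
Proof. by move=> eta0; have := young (G - F) G eta0; lra. Qed.

Lemma young_lo (eta F G : R) : 0 < eta ->
  F * G <= G ^+ 2 + (eta^-1 / 2 * (G - F) ^+ 2 + eta / 2 * G ^+ 2).
Proof. by move=> eta0; have := young (- (G - F)) G eta0; rewrite sqrrN; lra. Qed.

(** Replaces [\int F * G] by [\int G ^+ 2], for [F] close to [G], at the cost of
    the fraction [eta] of the masses. *)
Lemma young_both (eta d N FG GG DD : R) : 0 < eta -> d <= eta ^+ 2 * N -> DD <= d ->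
  GG <= FG + (eta^-1 / 2 * DD + eta / 2 * GG) ->
  FG <= GG + (eta^-1 / 2 * DD + eta / 2 * GG) ->
  (1 - eta / 2) * GG <= FG + eta / 2 * N /\
  `|FG - GG| <= eta / 2 * N + eta / 2 * GG.
Proof.
move=> eta0 dN Hd up lo.
have dd : eta^-1 / 2 * DD <= eta / 2 * N.
  apply: (@le_trans _ _ (eta^-1 / 2 * (eta ^+ 2 * N))).
    by apply: ler_wpM2l; [rewrite divr_ge0// invr_ge0 ltW|exact: le_trans Hd dN].
  by rewrite le_eqVlt; apply/orP; left; apply/eqP; field; rewrite gt_eqF.
split; first by lra.
by rewrite ler_norml; apply/andP; split; lra.
Qed.

Lemma quotient_bound (l eps eta N X Y GX GY U : R) :
  0 < eps -> 0 < eta <= 1 -> eta * (2 * (`|l| + 1) + eps) <= eps -> 0 <= N ->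
  (1 - eta / 2) * X <= GX + eta / 2 * N -> (1 - eta / 2) * Y <= GY + eta / 2 * N ->
  `|U - N| <= eta / 2 * N + eta / 2 * N -> GX + GY = l * U ->
  X + Y <= (l + eps) * N.
Proof.
move=> eps0 /andP[eta0 eta1] etaE N0 kX kY kU W.
have lU : l * U <= l * N + `|l| * (eta * N).
  rewrite -lerBlDl -mulrBr; apply: (le_trans (ler_norm _)); rewrite normrM.
  by apply: ler_wpM2l => //; apply: (le_trans kU); lra.
have big : (1 - eta / 2) * (X + Y) <= (l + (`|l| + 1) * eta) * N.
  by rewrite mulrDr; move: kX kY W lU; set a1 := (1 - _) * X; set a2 := (1 - _) * Y; lra.
have fin : (l + (`|l| + 1) * eta) * N <= (1 - eta / 2) * ((l + eps) * N).
  rewrite mulrA; apply: ler_wpM2r => //.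
  have hl := ler_norm l; have hl0 := normr_ge0 l.
  have : eta * (l + eps) <= eta * (`|l| + 1 + eps) by apply: ler_wpM2l; [exact: ltW|lra].
  have : 0 <= eta * `|l| by rewrite mulr_ge0// ltW.
  have : 0 <= eta * eps by rewrite mulr_ge0// ltW.
  by lra.
have e2 : 0 < 1 - eta / 2 by lra.
by rewrite -(ler_pM2l e2); exact: le_trans big fin.
Qed.

(** For a test function close to the eigenfunction in norm, a fixed part of the
    mass [r] remains. *)
Lemma lower_mass (r d N eta : R) : 0 < r -> 0 < eta <= 1 -> d = eta ^+ 2 * (r / 8) ->
  r <= 2 * d + 2 * N -> 0 < N /\ d <= eta ^+ 2 * N.
Proof.
move=> r0 /andP[eta0 eta1] dE rN.
have d8 : d <= r / 8.
  by rewrite dE ler_piMl//; [lra|exact: exprn_ile1 (ltW eta0) eta1].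
split; first by lra.
by rewrite dE; apply: ler_wpM2l; [exact: sqr_ge0|lra].
Qed.

(** Let [f] be a term of the sequence of test functions that converges to an
    eigenfunction [u] of gradient [(gx, gy)]. The weak equation, tested with [f],
    says that [\int (gx * dx f + gy * dy f) = l * \int u * f]; up to small errors
    this is [dirichlet f = l * sqnorm f]. The mass of [u] is only known to be
    positive in the extended sense, hence the real [r] below it. *)
Lemma eigenvalue_test D (l eps : R) : dirichlet_eigenvalue D l -> 0 < eps ->
  exists f, [/\ test_function D f, 0 < sqnorm f & dirichlet f <= (l + eps) * sqnorm f].
Proof.
move=> [u [gx [gy [[f_ [tf cu cx cy] upos weak]]]]] eps0.
have [r r0 rU] : exists2 r : R, 0 < r & (r%:E <= \int[mu]_(x in cell) ((u (pr x)) ^+ 2)%:E)%E.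
  case E : (\int[mu]_(x in cell) ((u (pr x)) ^+ 2)%:E)%E upos => [r| |] // r0.
    by exists r => //; rewrite -lte_fin.
  by exists 1 => //; rewrite leey.
pose A := `|l| + 1.
have A1 : 1 <= A by rewrite lerDr.
pose eta := Num.min 1 (eps / (2 * A + eps)).
have eta0 : 0 < eta by rewrite lt_min ltr01 divr_gt0//; lra.
have eta1 : eta <= 1 by rewrite ge_min lexx.
have eta01 : 0 < eta <= 1 by rewrite eta0 eta1.
have etaE : eta * (2 * A + eps) <= eps.
  by rewrite -ler_pdivlMr; [rewrite ge_min lexx orbT|lra].
(* The error has to be small with respect to the mass, of which only the
   lower bound [r] is known beforehand. *)
pose d := eta ^+ 2 * (r / 8).
have d0 : 0 < d by rewrite mulr_gt0 ?exprn_gt0// divr_gt0.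
have [n [nu nx ny]] : exists n, [/\
    (\int[mu]_(p in cell) ((f_ n (pr p) - u (pr p)) ^+ 2)%:E <= d%:E)%E,
    (\int[mu]_(p in cell) ((dx (f_ n) p - gx (pr p)) ^+ 2)%:E <= d%:E)%E &
    (\int[mu]_(p in cell) ((dy (f_ n) p - gy (pr p)) ^+ 2)%:E <= d%:E)%E].
  near \oo => n; exists n; split; near: n.
  - exact: (L2_near cu d0).
  - exact: (L2_near cx d0).
  - exact: (L2_near cy d0).
set f := f_ n in nu nx ny; have {}tf : test_function D f by exact: tf.
have [cf cfx cfy _ _] := test_C1 tf.
have [mU _] := cu; have [mX _] := cx; have [mY _] := cy.
have mF := cont_measurable (b:=b) cf; have mFx := cont_measurable (b:=b) cfx.
have mFy := cont_measurable (b:=b) cfy.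
have c2 : continuous (fun p : R * R => f (pr p) ^+ 2) by exact: ct_exp cf.
have c2x : continuous (fun p : R * R => dx f p ^+ 2) by exact: ct_exp cfx.
have c2y : continuous (fun p : R * R => dy f p ^+ 2) by exact: ct_exp cfy.
have iF2 : integ (fun p => f (pr p) ^+ 2) by exact: (cont_integrable b0 c2).
have iX2 : integ (fun p => dx f p ^+ 2) by exact: (cont_integrable b0 c2x).
have iY2 : integ (fun p => dy f p ^+ 2) by exact: (cont_integrable b0 c2y).
have mA : measurable_fun cell (fun p => f (pr p) - u (pr p)) by exact: (measurable_funB mF mU).
have mB : measurable_fun cell (fun p => dx f p - gx (pr p)) by exact: (measurable_funB mFx mX).
have mC : measurable_fun cell (fun p => dy f p - gy (pr p)) by exact: (measurable_funB mFy mY).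
have iA := integ_sqr mA nu; have iB := integ_sqr mB nx; have iC := integ_sqr mC ny.
pose II h : R := \int[mu]_(p in cell) h p.
have IID h g : integ h -> integ g -> II (fun p => h p + g p) = II h + II g.
  by move=> ih ig; rewrite /II RintegralD//; exact: measurable_cell.
have IIZ c h : integ h -> II (fun p => c * h p) = c * II h.
  by move=> ih; rewrite /II RintegralZl//; exact: measurable_cell.
have IIle h g : integ h -> integ g -> (forall p, h p <= g p) -> II h <= II g.
  by move=> ih ig hg; apply: le_Rintegral => //; exact: measurable_cell.
have IIfin h : integ h -> (forall p, 0 <= h p) ->
    (\int[mu]_(p in cell) (h p)%:E = (II h)%:E)%E.
  move=> ih h0; rewrite /II /Rintegral fineK//.
  by apply: integrable_fin_num => //; exact: measurable_cell.
have dA : II (fun p => (f (pr p) - u (pr p)) ^+ 2) <= d.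
  by rewrite -lee_fin -IIfin// => p; exact: sqr_ge0.
have dB : II (fun p => (dx f p - gx (pr p)) ^+ 2) <= d.
  by rewrite -lee_fin -IIfin// => p; exact: sqr_ge0.
have dC : II (fun p => (dy f p - gy (pr p)) ^+ 2) <= d.
  by rewrite -lee_fin -IIfin// => p; exact: sqr_ge0.
have NE : sqnorm f = II (fun p => f (pr p) ^+ 2).
  by rewrite /II (cell_Rintegral b0 c2).
have dirichlet' : dirichlet f = II (fun p => dx f p ^+ 2) + II (fun p => dy f p ^+ 2).
  by rewrite -(IID _ _ iX2 iY2) /II (cell_Rintegral b0 (ct_add c2x c2y)).
have Nlow : r <= 2 * d + 2 * sqnorm f.
  have i2 : integ (fun p => 2 * (f (pr p) - u (pr p)) ^+ 2 + 2 * f (pr p) ^+ 2).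
    by exact: (integD (integZ 2 iA) (integZ 2 iF2)).
  have h2 : forall p, 0 <= 2 * (f (pr p) - u (pr p)) ^+ 2 + 2 * f (pr p) ^+ 2.
    by move=> p; rewrite addr_ge0// mulr_ge0// sqr_ge0.
  rewrite NE -lee_fin; apply: (le_trans rU).
  apply: (@le_trans _ _ (\int[mu]_(p in cell)
      (2 * (f (pr p) - u (pr p)) ^+ 2 + 2 * f (pr p) ^+ 2)%:E)%E).
    apply: ge0_le_integral.
    - exact: measurable_cell.
    - by move=> p _; rewrite lee_fin sqr_ge0.
    - by apply/measurable_EFinP; exact: measurable_funX.
    - by have /integrableP[+ _] := i2.
    - move=> p _; rewrite lee_fin.
      rewrite -subr_ge0 [X in 0 <= X](_ : _ = (2 * f (pr p) - u (pr p)) ^+ 2) ?sqr_ge0//.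
      by ring.
  rewrite (IIfin _ i2 h2) (IID _ _ (integZ 2 iA) (integZ 2 iF2)) (IIZ _ _ iA) (IIZ _ _ iF2).
  by rewrite lee_fin lerD2r ler_pM2l.
have [N0 dN] := lower_mass r0 eta01 (erefl d) Nlow.
exists f; split=> //.
(* The products of the weak equation, tested with [f], are integrable:
   [u * f = f ^+ 2 - (f - u) * f]. *)
have iUF : integ (fun p => u (pr p) * f (pr p)).
  have := integD iF2 (integZ (-1) (integ_mul mA mF iA iF2)).
  by congr (integrable _ _ _); rewrite funeqE => p /=; congr EFin; ring.
have iGX : integ (fun p => gx (pr p) * dx f p).
  have := integD iX2 (integZ (-1) (integ_mul mB mFx iB iX2)).
  by congr (integrable _ _ _); rewrite funeqE => p /=; congr EFin; ring.
have iGY : integ (fun p => gy (pr p) * dy f p).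
  have := integD iY2 (integZ (-1) (integ_mul mC mFy iC iY2)).
  by congr (integrable _ _ _); rewrite funeqE => p /=; congr EFin; ring.
have W := weak f tf; rewrite -/(II _) -[X in _ = _ * X]/(II _) (IID _ _ iGX iGY) in W.
have key (F G : R * R -> R) : integ (fun p => F p * G p) -> integ (fun p => G p ^+ 2) ->
    integ (fun p => (G p - F p) ^+ 2) -> II (fun p => (G p - F p) ^+ 2) <= d ->
    (1 - eta / 2) * II (fun p => G p ^+ 2) <= II (fun p => F p * G p) + eta / 2 * sqnorm f /\
    `|II (fun p => F p * G p) - II (fun p => G p ^+ 2)| <= eta / 2 * sqnorm f + eta / 2 * II (fun p => G p ^+ 2).
  move=> i1 i2 i3 Hd.
  have J1 := integZ (eta^-1 / 2) i3.
  have J2 := integZ (eta / 2) i2.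
  have J := integD J1 J2.
  have up : II (fun p => G p ^+ 2) <= II (fun p => F p * G p) +
      (eta^-1 / 2 * II (fun p => (G p - F p) ^+ 2) + eta / 2 * II (fun p => G p ^+ 2)).
    rewrite -(IIZ _ _ i3) -(IIZ _ _ i2) -(IID _ _ J1 J2) -(IID _ _ i1 J).
    apply: (IIle _ _ i2 (integD i1 J)) => p.
    exact: young_up.
  have lo : II (fun p => F p * G p) <= II (fun p => G p ^+ 2) +
      (eta^-1 / 2 * II (fun p => (G p - F p) ^+ 2) + eta / 2 * II (fun p => G p ^+ 2)).
    rewrite -(IIZ _ _ i3) -(IIZ _ _ i2) -(IID _ _ J1 J2) -(IID _ _ i2 J).
    apply: (IIle _ _ i1 (integD i2 J)) => p.
    exact: young_lo.
  exact: young_both eta0 dN Hd up lo.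
have [kX _] := key (gx \o pr) (dx f) iGX iX2 iB dB.
have [kY _] := key (gy \o pr) (dy f) iGY iY2 iC dC.
have [_ kU] := key (u \o pr) (f \o pr) iUF iF2 iA dA.
rewrite -NE in kU.
by rewrite dirichlet'; exact: quotient_bound eps0 eta01 etaE (ltW N0) kX kY kU W.
Unshelve. all: by end_near. Qed.

End EigenvalueTest.

(** * A smooth function vanishing on a half-line *)

Section Smooth1.
Context {R : realType}.
Implicit Types (f g : R -> R) (x z : R).

(** Plain [n]-fold differentiability, with which sums, products and compositions
    are handled by induction. *)
Fixpoint Cn n f : Prop :=
  if n is n'.+1 then exists g, (forall x : R, is_derive x 1 f (g x)) /\ Cn n' g else True.

Lemma Cn_pred n f : Cn n.+1 f -> Cn n f.
Proof.
elim: n f => [//|n IHn] f [g [dg Cg]]; exists g; split=> //; exact: IHn.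
Qed.

Lemma Cn_cst n (c : R) : Cn n (fun=> c).
Proof. by elim: n c => [//|n IHn] c; exists (fun=> 0); split=> // x; exact: isd_cst. Qed.

Lemma Cn_id n : Cn n (fun x : R => x).
Proof. by case: n => [//|n]; exists (fun=> 1); split; [exact: isd_id|exact: Cn_cst]. Qed.

Lemma Cn_add n f g : Cn n f -> Cn n g -> Cn n (fun x => f x + g x).
Proof.
elim: n f g => [//|n IHn] f g [f' [df Cf]] [g' [dg Cg]].
exists (fun x => f' x + g' x); split=> [x|]; [exact: isd_add|exact: IHn].
Qed.

Lemma Cn_mul n f g : Cn n f -> Cn n g -> Cn n (fun x => f x * g x).
Proof.
elim: n f g => [//|n IHn] f g Cf Cg.
have Cf0 := Cn_pred Cf; have Cg0 := Cn_pred Cg.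
have [f' [df Cf']] := Cf; have [g' [dg Cg']] := Cg.
exists (fun x => f' x * g x + f x * g' x); split=> [x|]; first exact: isd_mul.
by apply: Cn_add; apply: IHn.
Qed.

Lemma Cn_comp n f g : Cn n f -> Cn n g -> Cn n (fun x => f (g x)).
Proof.
elim: n f g => [//|n IHn] f g Cf Cg.
have Cg0 := Cn_pred Cg.
have [f' [df Cf']] := Cf; have [g' [dg Cg']] := Cg.
exists (fun x => g' x * f' (g x)); split=> [x|]; first exact: isd_comp.
by apply: Cn_mul => //; exact: IHn.
Qed.

Lemma Cn_sincos n : Cn n (@sin R) /\ Cn n (@cos R).
Proof.
elim: n => [//|n [IHs IHc]]; split.
  by exists cos; split=> // x; exact: is_derive_sin.
exists (fun x => (-1) * sin x); split.
  by move=> x; apply: (isd_eq (is_derive_cos x)); ring.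
by apply: Cn_mul => //; exact: Cn_cst.
Qed.

Definition smooth1 f := forall n, Cn n f.

Lemma smooth1_deriv f : smooth1 f ->
  exists g, (forall x : R, is_derive x 1 f (g x)) /\ smooth1 g.
Proof.
move=> sf; have [g [dg _]] := sf 1%N; exists g; split=> // n.
have [h [dh Ch]] := sf n.+1.
suff -> : g = h by [].
by rewrite funeqE => x; exact: isd_unique (dg x) (dh x).
Qed.

(** Each power [z ^+ n] is at most [n`! * expR z], a term of the exponential
    series. *)
Lemma exp_poly (P : {poly R}) : exists C, 0 <= C /\ forall z, 0 <= z -> `|P.[z]| <= C * expR z.
Proof.
have mono n : exists C : R, 0 <= C /\ forall z, 0 <= z -> z ^+ n <= C * expR z.
  case: n => [|n].
    exists 1; split=> // z z0; rewrite expr0 mul1r.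
    by have := expR_ge1Dx z; lra.
  exists (n.+1)`!%:R; split=> // z z0.
  rewrite mulrC -ler_pdivrMr ?ltr0n ?fact_gt0//; apply: le_trans (expR_ge1Dxn n z0).
  by rewrite lerDr.
elim/poly_ind: P => [|P c [C [C0 HC]]].
  by exists 0; split=> // z _; rewrite horner0 normr0 mul0r.
have [K HK] := choice mono.
have {C C0 HC} [D [D0 HD]] : exists D, 0 <= D /\ forall z, 0 <= z -> `|P.[z]| * z <= D * expR z.
  have -> : P = \poly_(i < size P) P`_i by rewrite coefK.
  exists (\sum_(i < size P) `|P`_i| * K i.+1); split.
    apply: sumr_ge0 => i _; apply: mulr_ge0 => //.
    by have [] := HK i.+1.
  move=> z z0; rewrite horner_poly.
  apply: (@le_trans _ _ ((\sum_(i < size P) `|P`_i| * z ^+ i) * z)).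
    apply: ler_wpM2r => //; apply: (le_trans (ler_norm_sum _ _ _)).
    apply: ler_sum => i _; rewrite normrM [`|z ^+ i|]ger0_norm// exprn_ge0//.
  rewrite mulr_suml mulr_suml; apply: ler_sum => i _.
  rewrite -!mulrA -exprSr; apply: ler_wpM2l => //.
  by have [_] := HK i.+1; exact.
exists (D + `|c|); split; first by rewrite addr_ge0.
move=> z z0; rewrite hornerMXaddC (le_trans (ler_normD _ _))// mulrDl; apply: lerD.
  by rewrite normrM [`|z|]ger0_norm//; exact: HD.
by rewrite ler_peMr// (le_trans _ (expR_ge1Dx z))// lerDl.
Qed.

(** The functions [P (1 / x) * e ^ (- 1 / x)], [P] a polynomial, extended by [0]:
    the family generated by [e ^ (- 1 / x)] under differentiation. *)
Definition flat (P : {poly R}) (x : R) : R := if 0 < x then P.[x^-1] * expR (- x^-1) else 0.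

Lemma flat_le0 P x : x <= 0 -> flat P x = 0.
Proof. by move=> x0; rewrite /flat ltNge x0. Qed.

Lemma flat_quadratic P : exists C, forall x, `|flat P x| <= C * x ^+ 2.
Proof.
have [C [C0 HC]] := exp_poly (P * 'X^2).
exists C => x; rewrite /flat; case: ifPn => [x0|_]; last first.
  by rewrite normr0 mulr_ge0// sqr_ge0.
have z0 : 0 <= x^-1 by rewrite invr_ge0 ltW.
have := HC _ z0; rewrite hornerM hornerXn normrM [`|x^-1 ^+ 2|]ger0_norm ?exprn_ge0//.
move=> H; rewrite normrM [`|expR _|]ger0_norm ?expR_ge0//.
have : `|P.[x^-1]| * x^-1 ^+ 2 * (expR (- x^-1) * x ^+ 2) <= C * expR x^-1 * (expR (- x^-1) * x ^+ 2).
  by apply: ler_wpM2r => //; rewrite mulr_ge0 ?expR_ge0// sqr_ge0.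
have -> : C * expR x^-1 * (expR (- x^-1) * x ^+ 2) = C * x ^+ 2.
  by rewrite -[RHS]mulr1 -(expRxMexpNx_1 x^-1); ring.
by apply: le_trans; rewrite le_eqVlt; apply/orP; left; apply/eqP; field; rewrite gt_eqF.
Qed.

(** The difference quotients at [0] are at most [`|C| * `|h|]. *)
Lemma isd_quadratic f C : (forall x, `|f x| <= C * x ^+ 2) -> is_derive (0 : R) 1 f 0.
Proof.
move=> H.
have f0 : f 0 = 0.
  by apply/eqP; rewrite -normr_le0 (le_trans (H 0))// expr0n/= mulr0.
have L : (fun h : R => h^-1 *: ((f \o shift 0) (h *: (1 : R)) - f 0)) @ 0^' --> (0 : R).
  apply/cvgrPdist_le => e e0; near=> h.
  have h0 : h != 0 by near: h; exact: nbhs_dnbhs_neq.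
  rewrite f0 subr0 sub0r normrN /= addr0 /GRing.scale/= mulr1 normrM normfV.
  rewrite ler_pdivrMl ?normr_gt0//; apply: (le_trans (H h)).
  rewrite -[h ^+ 2](real_normK (num_real h)) expr2 mulrCA; apply: ler_wpM2l => //.
  have hs : `|h| <= e / (`|C| + 1).
    near: h; apply: dnbhs0_le; rewrite divr_gt0// ltr_wpDl.
  have C1 : 0 < `|C| + 1 by rewrite ltr_wpDl.
  apply: (@le_trans _ _ ((`|C| + 1) * `|h|)).
    by apply: ler_wpM2r => //; have := ler_norm C; lra.
  by rewrite mulrC -ler_pdivlMr.
split; first by apply/cvg_ex; exists 0.
by apply/cvg_lim.
Unshelve. all: by end_near. Qed.

(** Away from [0] this is the product rule; at [0] the function is quadratically
    small. *)
Lemma flat_derive P x : is_derive x 1 (flat P) (flat ('X^2 * (P - P^`())) x).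
Proof.
have [x0|x0|->] := ltgtP x 0.
- rewrite flat_le0; last exact: ltW.
  apply: (isd_near (isd_cst 0 x)).
  by near=> y; rewrite flat_le0//; apply: ltW; near: y; exact: lt_nbhsl.
- have dv : is_derive x 1 (fun x => x^-1) (- (1 / x ^+ 2)).
    by exact: (isd_inv (f := fun x => x) (lt0r_neq0 x0) (isd_id x)).
  have dP : is_derive x^-1 1 (horner P) (P^`()).[x^-1] by exact: is_derive_poly.
  have d1 := isd_mul (isd_comp dv dP) (isd_comp (isd_opp dv) (is_derive_expR (- x^-1))).
  apply: (@isd_near _ (fun y => P.[y^-1] * expR (- y^-1))).
    apply: (isd_eq d1); rewrite /flat x0 hornerM hornerXn hornerD hornerN.
    by field; rewrite gt_eqF.
  by near=> y; rewrite /flat ifT//; near: y; exact: lt_nbhsr.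
- by rewrite flat_le0//; have [C HC] := flat_quadratic P; exact: isd_quadratic HC.
Unshelve. all: by end_near. Qed.

Lemma flat_smooth P : smooth1 (flat P).
Proof.
move=> n; elim: n P => [//|n IHn] P.
by exists (flat ('X^2 * (P - P^`()))); split => // x; exact: flat_derive.
Qed.

(** The function [x * e ^ (- 1 / x)], which resembles [x - 1] at infinity,
    extended by [0]. *)
Definition rho (x : R) : R := x * flat 1 x.
Definition rho' : R -> R := flat (1 + 'X).

Lemma rho_smooth : smooth1 rho.
Proof. by move=> n; apply: Cn_mul; [exact: Cn_id|exact: flat_smooth]. Qed.

Lemma rho_derive x : is_derive x 1 rho (rho' x).
Proof.
apply: (isd_eq (isd_mul (isd_id x) (flat_derive 1 x))).
rewrite /rho' /flat derivC subr0 mulr1 hornerD !hornerC hornerX hornerXn; case: ifPn => x0.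
  by field; rewrite gt_eqF.
by rewrite mulr0 mulr0 addr0.
Qed.

Lemma rho_le0 x : x <= 0 -> rho x = 0.
Proof. by move=> x0; rewrite /rho flat_le0// mulr0. Qed.

Lemma rho_bounds x : 0 <= x -> x - 1 <= rho x <= x.
Proof.
rewrite le_eqVlt => /predU1P[<-|x0]; first by rewrite rho_le0// lexx andbT; lra.
rewrite /rho /flat x0 hornerC mul1r.
have z0 : 0 < x^-1 by rewrite invr_gt0.
have e1 := expR_ge1Dx (- x^-1).
have e2 : expR (- x^-1) <= 1 by rewrite -expR0 ler_expR; lra.
have xz : x * x^-1 = 1 by rewrite mulfV// gt_eqF.
have a : x * (1 + - x^-1) <= x * expR (- x^-1) by rewrite ler_pM2l.
have c : x * expR (- x^-1) <= x * 1 by rewrite ler_pM2l.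
by apply/andP; split; lra.
Qed.

Lemma rho'_bounds x : 0 <= rho' x <= 1.
Proof.
rewrite /rho' /flat; case: ifPn => x0; last by rewrite lexx ler01.
rewrite hornerD hornerC hornerX.
have z0 : 0 < x^-1 by rewrite invr_gt0.
rewrite mulr_ge0 ?expR_ge0//=; last by lra.
rewrite -[leRHS](expRxMexpNx_1 x^-1); apply: ler_wpM2r; [exact: expR_ge0|exact: expR_ge1Dx].
Qed.

(** With [rho'_bounds]: [rho'] tends to [1] at infinity, which makes the gradients
    of the approximations below converge. *)
Lemma rho'_lower x : 0 < x -> 1 - x^-1 ^+ 2 <= rho' x.
Proof.
move=> x0; rewrite /rho' /flat x0 hornerD hornerC hornerX.
have z0 : 0 < x^-1 by rewrite invr_gt0.
have : (1 + x^-1) * (1 + - x^-1) <= (1 + x^-1) * expR (- x^-1).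
  by apply: ler_wpM2l; [lra|exact: expR_ge1Dx].
by lra.
Qed.

End Smooth1.

(** * Test functions of the part of the torus above an arc *)

Section Arcs.
Context {R : realType} (b : R).
Hypothesis b0 : 0 < b.
Local Notation pr := (@torus_pi R 1 b).
Implicit Types (x y r z : R).

Definition arc (s d : R) : set (torus 1 b) :=
  [set pr p | p in [set p : R * R | s < p.1 < s + d]].

(** The representative of [x - s] modulo [1] between [0] and [1]. *)
Definition frac_from (s x : R) : R := x - s - (Num.floor (x - s))%:~R.

Lemma frac_from_itv s x : 0 <= frac_from s x < 1.
Proof.
rewrite /frac_from; have /andP[l] := floor_itv (x - s); rewrite intrD => r.
by rewrite subr_ge0 l /=; move: r; rewrite -[1%:~R]/(1 : R); lra.
Qed.

Lemma frac_from_eq s x (m : int) : 0 <= x - s - m%:~R < 1 -> frac_from s x = x - s - m%:~R.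
Proof.
move=> /andP[l r]; rewrite /frac_from (@floor_def _ _ m)// intrD -[1%:~R]/(1 : R).
by apply/andP; split; lra.
Qed.

Lemma frac_from_shift s x (m : int) : frac_from s (x + m%:~R) = frac_from s x.
Proof.
have h := frac_from_itv s x.
rewrite (@frac_from_eq s (x + m%:~R) (Num.floor (x - s) + m)).
  by rewrite /frac_from intrD; ring.
by move: h; rewrite /frac_from intrD (_ : x + m%:~R - s - ((Num.floor (x - s))%:~R + m%:~R) =
  x - s - (Num.floor (x - s))%:~R) //; ring.
Qed.

Lemma frac_from_per s x : frac_from s (x + 1) = frac_from s x.
Proof. exact: (frac_from_shift s x 1). Qed.

Lemma arcP s d x y : d < 1 -> arc s d (pr (x, y)) <-> 0 < frac_from s x < d.
Proof.
move=> d1; split.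
  move=> [[x' y'] /= /andP[l r]] /pr_eqP /andP[/= + _]; rewrite divr1 => /intrP[m Em].
  have -> : x = x' + (- m)%:~R by rewrite mulrNz -Em; ring.
  rewrite frac_from_shift (_ : frac_from s x' = x' - s); first by apply/andP; split; lra.
  rewrite -[RHS]subr0 -[0 in RHS]/(0%:~R); apply: frac_from_eq.
  by rewrite subr0; apply/andP; split; lra.
move=> /andP[l r]; exists (x + (- Num.floor (x - s))%:~R, y); last exact: pr_shift1.
by move: l r; rewrite /frac_from /= mulrNz => l r; apply/andP; split; lra.
Qed.

Variables (s d : R).
Hypothesis d01 : 0 < d < 1.

Definition clip (G : R -> R) (r : R) : R := if 0 < r < d then G r else 0.
(** The [1]-periodic function equal to [G (x - s)] between [s] and [s + d], and to
    [0] on the rest of the period. *)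
Definition periodize (G : R -> R) (x : R) : R := clip G (frac_from s x).
Local Notation W := periodize.

Lemma periodize_per G x : W G (x + 1) = W G x.
Proof. by rewrite /periodize frac_from_per. Qed.

Lemma periodize_clip G x (m : int) : d - 1 < x - s - m%:~R < 1 -> W G x = clip G (x - s - m%:~R).
Proof.
have /andP[d0 d1] := d01.
move=> /andP[l r]; have [h|h] := leP 0 (x - s - m%:~R).
  by rewrite /periodize (@frac_from_eq _ _ m)// h.
rewrite /periodize (@frac_from_eq _ _ (m - 1)); last first.
  by rewrite intrB -[1%:~R]/(1 : R); apply/andP; split; lra.
rewrite /clip intrB -[1%:~R]/(1 : R); case: ifPn => [/andP[_ k]|_]; first by lra.
by rewrite ltNge (ltW h).
Qed.

(** The same translate serves for all [G], so that a function and its derivative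
    can be compared near [x]. *)
Lemma periodize_local x : exists m : int, \forall y \near x,
  forall G, W G y = clip G (y - s - m%:~R).
Proof.
have /andP[d0 d1] := d01.
pose m := Num.floor (x - s + (1 - d) / 2); exists m.
have /andP[l r] := floor_itv (x - s + (1 - d) / 2).
rewrite -/m in l r; rewrite intrD -[1%:~R]/(1 : R) in r.
near=> y => G; apply: periodize_clip; apply/andP; split.
  have : s + m%:~R + d - 1 < y by near: y; apply: lt_nbhsr; lra.
  by lra.
have : y < s + m%:~R + 1 by near: y; apply: lt_nbhsl; lra.
by lra.
Unshelve. all: by end_near. Qed.

Lemma periodize_near x : 0 < frac_from s x < d -> exists m : int, frac_from s x = x - s - m%:~R /\
  \forall y \near x, forall G, W G y = G (y - s - m%:~R).
Proof.
move=> /andP[l r]; pose m := Num.floor (x - s); exists m; split=> //.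
have l' : s + m%:~R < x by move: l; rewrite /frac_from -/m; lra.
have r' : x < s + m%:~R + d by move: r; rewrite /frac_from -/m; lra.
have /andP[d0 d1] := d01.
near=> y => G.
have h1 : s + m%:~R < y by near: y; exact: lt_nbhsr.
have h2 : y < s + m%:~R + d by near: y; exact: lt_nbhsl.
rewrite (@periodize_clip _ _ m); last by apply/andP; split; lra.
by rewrite /clip ifT//; apply/andP; split; lra.
Unshelve. all: by end_near. Qed.

Definition end_zero (G : R -> R) : Prop :=
  (\forall r \near (0 : R), G r = 0) /\ (\forall r \near d, G r = 0).

Lemma near0_deriv (G G' : R -> R) x : (forall x : R, is_derive x 1 G (G' x)) ->
  (\forall r \near x, G r = 0) -> \forall r \near x, G' r = 0.
Proof.
move=> dG /near_join; apply: filterS => r N.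
have H : is_derive r 1 G 0.
  by apply: (isd_near (isd_cst 0 r)); apply: filterS N.
exact: isd_unique (dG r) H.
Qed.

Lemma clip_near0 (G : R -> R) r : ~~ (0 < r < d) -> end_zero G ->
  \forall y \near r, clip G y = 0.
Proof.
have /andP[d0 d1] := d01.
move=> nr [z0 zd].
have [l|l|e] := ltgtP 0 r; last 2 first.
- by near=> y; rewrite /clip ltNge (_ : y <= 0)//; apply: ltW; near: y; exact: lt_nbhsl.
- by rewrite -e; apply: filterS z0 => y Gy; rewrite /clip Gy; case: ifP.
have [h|h|e] := ltgtP r d; last 2 first.
- near=> y.
  by rewrite /clip [y < d]ltNge (_ : d <= y) ?andbF//; apply: ltW; near: y; exact: lt_nbhsr.
- by rewrite e; apply: filterS zd => y Gy; rewrite /clip Gy; case: ifP.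
by move: nr; rewrite l h.
Unshelve. all: by end_near. Qed.

(** At the ends of the arc both sides vanish locally. *)
Lemma clip_derive (G G' : R -> R) r : (forall x : R, is_derive x 1 G (G' x)) ->
  end_zero G -> is_derive r 1 (clip G) (clip G' r).
Proof.
move=> dG zG; have [/andP[l h]|nr] := boolP (0 < r < d); last first.
  rewrite {2}/clip (negbTE nr); apply: (isd_near (isd_cst 0 r)).
  by apply: filterS (clip_near0 nr zG) => y ->.
rewrite {2}/clip l h /=; apply: (isd_near (dG r)); near=> y.
rewrite /clip ifT//; apply/andP; split; near: y; [exact: lt_nbhsr|exact: lt_nbhsl].
Unshelve. all: by end_near. Qed.

Lemma periodize_near0 (G : R -> R) x : ~~ (0 < frac_from s x < d) -> end_zero G -> \forall y \near x, W G y = 0.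
Proof.
have /andP[d0 d1] := d01.
move=> nx zG; have [m Hm] := periodize_local x.
have nr : ~~ (0 < x - s - m%:~R < d).
  apply: contra nx => /andP[l r]; rewrite (@frac_from_eq s x m) ?l//.
  by apply/andP; split; lra.
have c : continuous (fun y : R => y - s - m%:~R) by cont.
have N := c x _ (clip_near0 nr zG).
have {}N : nbhs x ((fun y : R => y - s - m%:~R) @^-1` _) := N.
by apply: filterS2 Hm N => y ->.
Qed.

Lemma periodize_derive (G G' : R -> R) x : (forall x : R, is_derive x 1 G (G' x)) ->
  end_zero G -> is_derive x 1 (W G) (W G' x).
Proof.
move=> dG zG; have [m Hm] := periodize_local x.
rewrite (nbhs_singleton Hm).
have d1 : is_derive x 1 (fun y : R => y - s - m%:~R) 1.
  by apply: (isd_eq (isd_add (isd_add (isd_id x) (isd_cst (- s) x)) (isd_cst (- m%:~R) x))); ring.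
apply: (isd_near (isd_eq (isd_comp d1 (clip_derive _ dG zG)) (mul1r _))).
by apply: filterS Hm => y ->.
Qed.

Lemma end_zero_deriv (G G' : R -> R) : (forall x : R, is_derive x 1 G (G' x)) ->
  end_zero G -> end_zero G'.
Proof. by move=> dG [z0 zd]; split; exact: near0_deriv dG _. Qed.

Lemma differentiable_fst (p : R * R) : differentiable (fst : R * R -> R) p.
Proof. by apply: linear_differentiable => q; exact: (@ct_fst R). Qed.

Lemma fst_differentiable (w w' : R -> R) (p : R * R) : (forall x : R, is_derive x 1 w (w' x)) ->
  differentiable (fun p : R * R => w p.1) p.
Proof.
move=> dw; apply: differentiable_comp; first exact: differentiable_fst.
by apply/derivable1_diffP; have [] := dw p.1.
Qed.

Lemma fst_derive (w w' : R -> R) (v p : R * R) : (forall x : R, is_derive x 1 w (w' x)) ->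
  'D_v (fun p : R * R => w p.1) p = v.1 * w' p.1.
Proof.
move=> dw.
have -> : 'D_v (fun p : R * R => w p.1) p = 'D_(v.1) w p.1 by [].
have [dw1 dw2] := dw p.1.
rewrite deriveE; last by apply/derivable1_diffP.
have {1}-> : v.1 = v.1 *: (1 : R) by rewrite /GRing.scale/= mulr1.
rewrite linearZ /=.
by rewrite -deriveE ?dw2//; apply/derivable1_diffP.
Qed.

(** Functions of the first coordinate are stable under directional derivatives,
    which keep them zero near the ends of the arc. *)
Lemma periodize_iter (G : R -> R) (l : seq (R * R)) (c : R) : smooth1 G -> end_zero G ->
  exists c' G', [/\ smooth1 G', end_zero G' &
    iter_deriv l (fun p : R * R => c * W G p.1) = (fun p => c' * W G' p.1)].
Proof.
move=> sG zG; elim: l => [|v l [c' [G' [sG' zG' E]]]]; first by exists c, G.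
have [G2 [d2 s2]] := smooth1_deriv sG'.
exists (c' * v.1), G2; split=> //; first exact: end_zero_deriv d2 zG'.
rewrite /= -/(iter_deriv l _) E funeqE => p.
have dW x := isd_scale c' (periodize_derive x d2 zG').
by rewrite (fst_derive v p dW); ring.
Qed.

Lemma periodize_smooth G : smooth1 G -> end_zero G -> smooth_on setT (fun p : R * R => W G p.1).
Proof.
move=> sG zG l p _.
have -> : (fun p : R * R => W G p.1) = (fun p => 1 * W G p.1).
  by rewrite funeqE => q; rewrite mul1r.
have [c' [G' [sG' zG' ->]]] := periodize_iter l 1 sG zG.
have [G2 [d2 s2]] := smooth1_deriv sG'.
exact: fst_differentiable (fun x => isd_scale c' (periodize_derive x d2 zG')).
Qed.

Definition lift1 (w : R -> R) : torus 1 b -> R := fun t => w (repr t).1.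

Lemma lift1_pr (w : R -> R) p : (forall x, w (x + 1) = w x) -> lift1 w (pr p) = w p.1.
Proof.
move=> pw.
have pn x (n : nat) : w (x + n%:R) = w x.
  by elim: n => [|n IHn]; rewrite ?addr0// -natr1 addrA pw IHn.
have pz x (m : int) : w (x + m%:~R) = w x.
  case: m => n; first exact: pn.
  by rewrite NegzE mulrNz -(pn _ n.+1) subrK.
rewrite /lift1; have : pr (repr (pr p)) = pr p by exact: reprK.
move=> /pr_eqP/andP[/=]; rewrite divr1 => /intrP[m Em] _.
by rewrite -(pz p.1 m) -Em; congr w; ring.
Qed.

(** The saturation of an open set is the union of its translates by the lattice. *)
Lemma pr_open (U : set (R * R)) : open U -> open (pr @` U).
Proof.
move=> oU.
have E : pr @^-1` (pr @` U) = \bigcup_(m : int * int)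
   ((fun p : R * R => (p.1 + m.1%:~R, p.2 + m.2%:~R * b)) @^-1` U).
  apply/seteqP; split.
    move=> p [q Uq] /pr_eqP/andP[/=]; rewrite divr1 => /intrP[m Em] /intrP[n En].
    exists (m, n) => //=.
    rewrite (_ : (_, _) = q)//; case: q Uq Em En => q1 q2 _ /= Em En; congr pair.
      by rewrite -Em; ring.
    by rewrite -En; field; rewrite gt_eqF.
  move=> [p1 p2] [m _ /= Um]; exists (p1 + m.1%:~R, p2 + m.2%:~R * b) => //.
  by rewrite pr_shift2// pr_shift1.
suff : open (pr @^-1` (pr @` U)) by [].
rewrite E; apply: bigcup_open => m _; apply: open_comp => // p _.
have c1 : continuous (fun p : R * R => p.1 + m.1%:~R) by cont.
have c2 : continuous (fun p : R * R => p.2 + m.2%:~R * b) by cont.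
exact: (ct_pair c1 c2).
Qed.

Lemma periodize_test G : smooth1 G -> end_zero G -> test_function (arc s d) (lift1 (W G)).
Proof.
have /andP[d0 d1] := d01.
move=> sG zG.
have E : lift1 (W G) \o pr = fun p => W G p.1.
  by rewrite funeqE => p /=; rewrite lift1_pr//; exact: periodize_per.
split; first by rewrite E; exact: periodize_smooth.
move=> t; rewrite -[t]reprK -/(pr (repr t)); case: (repr t) => x y clo.
apply/arcP => //; apply: contrapT => /negP nx.
have N := periodize_near0 nx zG.
have Np : \forall p \near (x, y), W G p.1 = 0 by exact: (cvg_fst N).
have [U [oU Uxy] U0] : exists2 U : set (R * R), open U /\ U (x, y) & forall p, U p -> W G p.1 = 0.
  exists (interior [set p : R * R | W G p.1 = 0]); last by move=> p /interior_subset.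
  by split; [exact: open_interior|exact: Np].
have oV : open (pr @` U) by exact: pr_open.
have [t' [/= ft' [p Up pt']]] : ([set p | lift1 (W G) p != 0] `&` pr @` U) !=set0.
  by apply: clo; apply: open_nbhs_nbhs; split => //; exists (x, y).
by move: ft'; rewrite -pt' lift1_pr ?U0 ?eqxx//; exact: periodize_per.
Qed.

End Arcs.

(** * The eigenfunction above an arc *)

Section ArcApproximation.
Context {R : realType} (b : R).
Hypothesis b0 : 0 < b.
Local Notation pr := (@torus_pi R 1 b).
Local Notation mu := (@lebesgue_measure R \x @lebesgue_measure R)%E.
Implicit Types (x y r z : R) (f : torus 1 b -> R).

(** Dominated convergence: the cell has finite measure. *)
Lemma L2_dominated (F : (R * R -> R)^nat) (U : R * R -> R) (M : R) :
  (forall n, continuous (F n)) -> (forall p, F n p @[n --> \oo] --> U p) ->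
  (forall n p, `|F n p| <= M) -> (forall p, `|U p| <= M) -> L2_cvg 1 b F U.
Proof.
move=> cF FU bF bU.
have mc := measurable_cell b.
have mF n : measurable_fun (cell 1 b : set (measurableTypeR R * measurableTypeR R)) (F n).
  exact: cont_measurable.
have mU : measurable_fun (cell 1 b : set (measurableTypeR R * measurableTypeR R)) U.
  by apply: (measurable_fun_cvg mF) => p _; exact: FU.
split=> //.
have [] := @dominated_convergence _ _ _ mu (cell 1 b) mc
  (fun n p => ((F n p - U p) ^+ 2)%:E) (fun=> 0%E) (fun=> ((2 * M) ^+ 2)%:E).
- by move=> n; apply/measurable_EFinP; apply: measurable_funX; exact: measurable_funB.
- exact: measurable_cst.
- apply: aeW => p _.
  have h : (F n p - U p) @[n --> \oo] --> U p - U p by apply: cvgB; [exact: FU|exact: cvg_cst].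
  have h2 : (F n p - U p) ^+ 2 @[n --> \oo] --> 0.
    rewrite (_ : (fun n => _) = (fun n => (F n p - U p) * (F n p - U p))).
      by rewrite subrr in h; have := cvgM h h; rewrite mulr0; exact.
    by apply/funext => n; rewrite expr2.
  by apply: cvg_EFin; [exact: nearW|exact: h2].
- exact: (@cont_integrable R b b0 (fun=> (2 * M) ^+ 2) (@ct_cst _ _ _)).
- apply: aeW => p n _; rewrite /= lee_fin ger0_norm ?sqr_ge0//.
  rewrite -[leLHS](real_normK (num_real _)); apply: lerXn2r; rewrite ?nnegrE//.
    by have := le_trans (normr_ge0 _) (bU p); lra.
  by apply: (le_trans (ler_normB _ _)); have := bF n p; have := bU p; lra.
move=> _ _; rewrite integral0; exact.
Unshelve. all: by end_near. Qed.

Variables (s d : R).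
Hypothesis d01 : 0 < d < 1.
Local Notation W := (periodize s d).

Let d0 : 0 < d. Proof. by case/andP: d01. Qed.

Definition arc_sin r := sin (pi / d * r).
Definition arc_cos r := pi / d * cos (pi / d * r).
(** A smooth substitute for the sine, which vanishes near the ends of the arc,
    where [n.+1 * arc_sin r <= 1]. *)
Definition arc_approx (n : nat) r := n.+1%:R^-1 * rho (n.+1%:R * arc_sin r - 1).
Definition arc_approx' (n : nat) r := rho' (n.+1%:R * arc_sin r - 1) * arc_cos r.

Let isd_lin (a x : R) : is_derive x 1 (fun x => a * x) a.
Proof. by apply: (isd_eq (isd_scale a (isd_id x))); ring. Qed.

Lemma arc_sin_derive x : is_derive x 1 arc_sin (arc_cos x).
Proof. exact: (isd_sin (isd_lin (pi / d) x)). Qed.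

Lemma arc_cos_derive x : is_derive x 1 arc_cos (- (pi / d) ^+ 2 * arc_sin x).
Proof.
by apply: (isd_eq (isd_scale (pi / d) (isd_cos (isd_lin (pi / d) x)))); rewrite /arc_sin; ring.
Qed.

Lemma ct_arc_sin : continuous arc_sin. Proof. by rewrite /arc_sin; cont. Qed.
Lemma ct_arc_cos : continuous arc_cos. Proof. by rewrite /arc_cos; cont. Qed.

Lemma arc_approx_smooth n : smooth1 (arc_approx n).
Proof.
move=> k; apply: Cn_mul; first exact: Cn_cst.
apply: (Cn_comp (rho_smooth (R:=R) k)); apply: Cn_add; last exact: Cn_cst.
apply: Cn_mul; first exact: Cn_cst.
have [Cs _] := @Cn_sincos R k.
by apply: (Cn_comp Cs); apply: Cn_mul; [exact: Cn_cst|exact: Cn_id].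
Qed.

Lemma arc_approx_derive n x : is_derive x 1 (arc_approx n) (arc_approx' n x).
Proof.
have d1 := isd_add (isd_scale n.+1%:R (arc_sin_derive x)) (isd_cst (-1) x).
apply: (isd_eq (isd_scale n.+1%:R^-1 (isd_comp d1 (rho_derive _)))).
by rewrite /arc_approx'; field.
Qed.

(** Near the ends the sine is small and the argument of [rho] is negative. *)
Lemma arc_approx_end n : end_zero d (arc_approx n).
Proof.
have near0 x : arc_sin x = 0 -> \forall r \near x, arc_approx n r = 0.
  move=> s0; pose h r := n.+1%:R * arc_sin r - 1.
  have ch : continuous h by have := ct_arc_sin => ?; rewrite /h; cont.
  have N : \forall t \near h x, t < 0 by apply: lt_nbhsl; rewrite /h s0; lra.
  have {}N : nbhs x (h @^-1` _) := ch x _ N.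
  by apply: filterS N => r /= hr; rewrite /arc_approx rho_le0 ?mulr0//; exact: ltW.
split; apply: near0; first by rewrite /arc_sin mulr0 sin0.
by rewrite /arc_sin mulfVK ?sinpi// gt_eqF.
Qed.

Lemma arc_sin_gt0 r : 0 < r < d -> 0 < arc_sin r.
Proof.
move=> /andP[r0 rd]; apply: sin_gt0_pi; have pi0 := pi_gt0 R.
rewrite mulr_gt0 ?divr_gt0//= -mulrA gtr_pMr//.
by rewrite mulrC ltr_pdivrMr// mul1r.
Qed.

Lemma arc_sin_le1 r : `|arc_sin r| <= 1.
Proof. exact: sin_max. Qed.

Lemma arc_cos_le r : `|arc_cos r| <= pi / d.
Proof.
rewrite normrM ger0_norm ?divr_ge0 ?pi_ge0 ?(ltW d0)//.
by rewrite ler_piMr ?divr_ge0 ?pi_ge0 ?(ltW d0)// cos_max.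
Qed.

Lemma arc_approx_bounds n r : arc_sin r - 2 / n.+1%:R <= arc_approx n r /\
  (0 <= arc_sin r -> 0 <= arc_approx n r <= arc_sin r).
Proof.
have N0 : 0 < n.+1%:R :> R by rewrite ltr0n.
have i0 : 0 <= n.+1%:R^-1 :> R by rewrite invr_ge0 ltW.
rewrite /arc_approx; set t := n.+1%:R * arc_sin r - 1.
have -> : arc_sin r = n.+1%:R^-1 * (t + 1) by rewrite /t; field.
have -> : n.+1%:R^-1 * (t + 1) - 2 / n.+1%:R = n.+1%:R^-1 * (t - 1) by ring.
have [h|h] := leP 0 t.
  have /andP[r1 r2] := rho_bounds h.
  have r0 : 0 <= rho t.
    by rewrite /rho mulr_ge0// /flat; case: ifP => // _; rewrite hornerC mul1r expR_ge0.
  split; first exact: ler_wpM2l.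
  by move=> _; rewrite mulr_ge0//=; apply: ler_wpM2l => //; lra.
rewrite rho_le0 ?mulr0 ?lexx; last exact: ltW.
by split=> [|-> //]; apply: mulr_ge0_le0 => //; lra.
Qed.

Lemma arc_approx_cvg r : 0 <= arc_sin r -> arc_approx n r @[n --> \oo] --> arc_sin r.
Proof.
move=> s0; apply/cvgrPdist_le => e e0; near=> n.
have [h1 /(_ s0)/andP[h2 h3]] := arc_approx_bounds n r.
rewrite ger0_norm ?subr_ge0//.
have : n.+1%:R^-1 < e / 2.
  near: n; have e20 : 0 < e / 2 by lra.
  have [N _ HN] := @near_infty_natSinv_lt R (PosNum e20).
  by exists N => // n Nn; exact: HN.
move: h1; set i := n.+1%:R^-1; clearbody i => h1 hi.
by lra.
Unshelve. all: by end_near. Qed.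

Lemma arc_approx'_cvg r : 0 < arc_sin r -> arc_approx' n r @[n --> \oo] --> arc_cos r.
Proof.
move=> s0; rewrite -[X in _ --> X]mul1r.
apply: cvgM; last exact: cvg_cst.
apply/cvgrPdist_le => e e0; near=> n.
have /andP[h1 h2] := rho'_bounds (n.+1%:R * arc_sin r - 1).
rewrite ger0_norm ?subr_ge0//.
pose K := 1 + (1 + e^-1) .
have K1 : 1 < K - e^-1 by rewrite /K; lra.
have big : K < n.+1%:R * arc_sin r - 1.
  have : (K + 1) / arc_sin r < n.+1%:R.
    near: n; have [N _ HN] := @nbhs_infty_gtr R ((K + 1) / arc_sin r).
    by exists N => // n Nn; apply: HN => /=; exact: leqW.
  by rewrite ltr_pdivrMr//; lra.
have ei : 0 < e^-1 by rewrite invr_gt0.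
have z0 : 0 < n.+1%:R * arc_sin r - 1 by rewrite /K in big; lra.
have := rho'_lower z0; set z := n.+1%:R * _ - 1 in big z0 *.
have zi : z^-1 <= e by rewrite -[leRHS]invrK lef_pV2 ?posrE//; rewrite /K in big; lra.
have zi1 : z^-1 <= 1 by rewrite invf_le1//; rewrite /K in big; lra.
have zi0 : 0 < z^-1 by rewrite invr_gt0.
by move=> h; nra.
Unshelve. all: by end_near. Qed.

End ArcApproximation.

Section ArcEigenvalue.
Context {R : realType} (b : R).
Hypothesis b0 : 0 < b.
Local Notation pr := (@torus_pi R 1 b).
Local Notation mu := (@lebesgue_measure R \x @lebesgue_measure R)%E.
Implicit Types (x y r z : R) (f : torus 1 b -> R) (K : R -> R) (g : R * R -> R).
Variables (s d : R).
Hypothesis d01 : 0 < d < 1.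
Local Notation W := (periodize s d).
Local Notation S := (arc_sin d).
Local Notation C := (arc_cos d).

Let d0 : 0 < d. Proof. by case/andP: d01. Qed.
Let d1 : d < 1. Proof. by case/andP: d01. Qed.

(** The cut-off of [K] may jump at the ends of the arc, but the other factor
    vanishes there. *)
Lemma arc_mul_ct K g : continuous K -> continuous g ->
  (forall p, ~ arc s d (pr p) -> \forall q \near p, g q = 0) ->
  continuous (fun p => W K p.1 * g p).
Proof.
move=> cK cg g0 [x y].
have [ax|nx] := boolP (0 < frac_from s x < d).
  have [m [_ Hm]] := periodize_near d01 ax.
  have Np : \forall p \near (x, y), forall G, W G p.1 = G (p.1 - s - m%:~R) by exact: (cvg_fst Hm).
  apply: (@ct_near _ _ (fun p => K (p.1 - s - m%:~R) * g p)).
    have c1 : continuous (fun p : R * R => K (p.1 - s - m%:~R)).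
      by apply: (ct_comp cK); cont.
    exact: (ct_mul c1 cg).
  by apply: filterS Np => p ->.
apply: (@ct_near _ _ (fun=> 0)); first exact: cst_continuous.
have := g0 (x, y); rewrite arcP// => /(_ (negP nx)).
by apply: filterS => q ->; rewrite mulr0.
Qed.

(** Integration by parts in [x]: the difference of the integrands is the
    derivative of the periodic function [arc_cos * f], of vanishing integral. *)
Lemma arc_weak f : test_function (arc s d) f ->
  boxint 0 1 0 b (fun p => W C p.1 * dx f p) = (pi / d) ^+ 2 * boxint 0 1 0 b (fun p => W S p.1 * f (pr p)).
Proof.
move=> tf; have [cf cfx cfy dfx dfy] := test_C1 tf.
have f0 p : ~ arc s d (pr p) -> \forall q \near p, f (pr q) = 0 by exact: test_near0 tf.
have fx0 p : ~ arc s d (pr p) -> \forall q \near p, dx f q = 0.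
  by move=> np; apply: filterS (test_near0_grad tf np) => q [].
have c1 := arc_mul_ct (@ct_arc_cos R d) cfx fx0.
have c2 := arc_mul_ct (@ct_arc_sin R d) cf f0.
have c3 := arc_mul_ct (@ct_arc_cos R d) cf f0.
pose Hx p := W C p.1 * dx f p - (pi / d) ^+ 2 * (W S p.1 * f (pr p)).
have cH : continuous Hx.
  exact: (ct_add c1 (ct_opp (ct_mul (@ct_cst _ _ ((pi / d) ^+ 2)) c2))).
have dH x y : is_derive x 1 (fun x => W C (x, y).1 * (f \o pr) (x, y)) (Hx (x, y)).
  have [ax|nx] := boolP (0 < frac_from s x < d).
    have [m [_ Hm]] := periodize_near d01 ax.
    have dl : is_derive x 1 (fun y : R => y - s - m%:~R) 1.
      by apply: (isd_eq (isd_add (isd_add (isd_id x) (isd_cst (- s) x)) (isd_cst (- m%:~R) x))); ring.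
    apply: (@isd_near _ (fun t => C (t - s - m%:~R) * (f \o pr) (t, y))); last first.
      by apply: filterS Hm => t ->.
    apply: (isd_eq (isd_mul (isd_comp dl (arc_cos_derive d _)) (dfx x y))).
    by rewrite /Hx /= !(nbhs_singleton Hm) /=; ring.
  have na : ~ arc s d (pr (x, y)) by rewrite arcP//; exact/negP.
  have [z1 z2 _] := test_zero tf na.
  rewrite /Hx z1 z2 !mulr0 subr0.
  apply: (isd_near (isd_cst 0 x)).
  have H := f0 _ na.
  have c : (fun t : R => (t, y)) @ x --> (x, y).
    by have h := @ct_pair R R (fun t => t) (fun=> y) (@ct_id R) (@ct_cst R R y); exact: (h x).
  have {}H : nbhs x ((fun t : R => (t, y)) @^-1` _) := c _ H.
  by apply: filterS H => t /= ->; rewrite mulr0.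
pose V x := segint 0 b (fun y => W C (x, y).1 * (f \o pr) (x, y)).
have dV x : is_derive x 1 V (segint 0 b (fun y => Hx (x, y))) by exact: (isd_segint 0 b x c3 cH dH).
have E0 : boxint 0 1 0 b Hx = 0.
  have -> : boxint 0 1 0 b Hx = V 1 - V 0.
    exact: (@segint_FTC R _ V 0 1 ler01 (ct_segint cH) (fun x _ => dV x)).
  rewrite -[X in V X - _]add0r (_ : V (0 + 1) = V 0) ?subrr//.
  by apply: eq_segint => y _ /=; rewrite periodize_per pr_per1.
have := E0; rewrite /Hx boxintB.
- by rewrite boxintZ; [move/eqP; rewrite subr_eq0 => /eqP|exact: c2].
- exact: c1.
- exact: (ct_mul (@ct_cst _ _ ((pi / d) ^+ 2)) c2).
Qed.

Lemma periodize_bound K (M : R) x : (forall r, `|K r| <= M) -> `|W K x| <= M.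
Proof.
move=> H; rewrite /periodize /clip; case: ifP => // _.
by rewrite normr0; exact: le_trans (normr_ge0 _) (H 0).
Qed.

Lemma periodize_approx_derive n x : is_derive x 1 (W (arc_approx d n)) (W (arc_approx' d n) x).
Proof. exact: (periodize_derive s d01 x (arc_approx_derive d n) (arc_approx_end d01 n)). Qed.

Lemma periodize_approx'_ct n : continuous (W (arc_approx' d n)).
Proof.
have [g2 [dg2 _]] := smooth1_deriv (@arc_approx_smooth R d n).
have E : g2 = arc_approx' d n.
  by rewrite funeqE => x; exact: isd_unique (dg2 x) (arc_approx_derive d n x).
have [g3 [dg3 _]] : exists h : R -> R, (forall x : R, is_derive x 1 g2 (h x)) /\ smooth1 h.
  by apply: smooth1_deriv => k; have [h [dh Ch]] := arc_approx_smooth d n k.+1;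
     rewrite (_ : g2 = h)// funeqE => x; exact: isd_unique (dg2 x) (dh x).
rewrite -E => x; apply: is_derive_continuous.
exact: (periodize_derive s d01 x dg3 (end_zero_deriv dg2 (arc_approx_end d01 n))).
Qed.

Lemma periodize_cvg (Kn : nat -> R -> R) K x : (forall r, 0 < r < d -> Kn n r @[n --> \oo] --> K r) ->
  W (Kn n) x @[n --> \oo] --> W K x.
Proof.
move=> H; rewrite /periodize /clip; case: ifP => [h|_]; first exact: H.
exact: cvg_cst.
Qed.

Lemma arc_sin_mass : segint 0 d (fun r => S r ^+ 2) = d / 2.
Proof.
pose P r := r / 2 - d / (2 * pi) * (arc_sin d r * cos (pi / d * r)).
have pi0 := pi_gt0 R.
have -> : d / 2 = P d - P 0.
  by rewrite /P /arc_sin mulfVK ?gt_eqF// sinpi mulr0 sin0; ring.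
apply: segint_FTC; [exact: ltW|exact: ct_exp (@ct_arc_sin R d)|move=> x _].
have dl : is_derive x 1 (fun x => pi / d * x) (pi / d).
  by apply: (isd_eq (isd_scale (pi / d) (isd_id x))); ring.
have dh : is_derive x 1 (fun x : R => x / 2) (1 / 2).
  by apply: (isd_eq (isd_mul (isd_id x) (isd_cst (2^-1) x))); ring.
apply: (isd_eq (isd_add dh (isd_opp (isd_scale (d / (2 * pi))
  (isd_mul (arc_sin_derive d x) (isd_cos dl)))))).
have cs := cos2Dsin2 (pi / d * x).
rewrite /arc_cos /arc_sin.
have -> : d / (2 * pi) * (pi / d * cos (pi / d * x) * cos (pi / d * x) +
   sin (pi / d * x) * (pi / d * - sin (pi / d * x))) =
   (cos (pi / d * x) ^+ 2 - sin (pi / d * x) ^+ 2) / 2.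
  by move: (@pi R) pi0 => q q0; field; rewrite (gt_eqF d0) (gt_eqF q0).
by lra.
Qed.

(** The limit has mass [b * d / 2]; for [n] larger than [8] the lower bound
    [S - 2 / n] of the approximation leaves a positive part of it. *)
Lemma arc_approx_mass : exists n, 0 < boxint 0 1 0 b (fun p => W (arc_approx d n) p.1 ^+ 2).
Proof.
have [N _ HN] := @nbhs_infty_gtr R 8.
have N8 : 8 < N.+1%:R :> R by apply: HN => /=.
exists N; set w := W (arc_approx d N).
have cw : continuous w by move=> x; apply: is_derive_continuous; exact: periodize_approx_derive.
have cw2 : continuous (fun x => w x ^+ 2) by exact: ct_exp cw.
have -> : boxint 0 1 0 b (fun p => w p.1 ^+ 2) = b * segint 0 1 (fun x => w x ^+ 2).
  rewrite /boxint -segintZ//; apply: eq_segint => x _ /=.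
  by rewrite segint_cst ?ltW//; ring.
apply: mulr_gt0 => //.
rewrite -(@segint_periodic _ _ 1 s ler01 cw2); last by move=> y; rewrite /w periodize_per.
have s1 : s + d <= s + 1 by rewrite lerD2l ltW.
have s0 : s <= s + d by rewrite lerDl ltW.
rewrite (segint_chasles s0 s1 cw2) ltr_wpDr//; first by apply: segint_ge0 => x _; exact: sqr_ge0.
have cg : continuous (fun r => S r ^+ 2) by exact: ct_exp (@ct_arc_sin R d).
have [A dA] := segint_prim 0 cg.
have EA : segint 0 d (fun r => S r ^+ 2) = A d - A 0.
  by apply: segint_FTC => //; [exact: ltW|move=> x /andP[x0 _]; exact: dA].
apply: (@lt_le_trans _ _ (A (s + d - s) - 4 / N.+1%:R * (s + d) - (A (s - s) - 4 / N.+1%:R * s))).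
  rewrite subrr (_ : s + d - s = d); last by ring.
  rewrite (_ : _ - _ = A d - A 0 - 4 / N.+1%:R * d); last by ring.
  rewrite -EA arc_sin_mass (_ : d / 2 - _ = d * (1 / 2 - 4 / N.+1%:R)); last by field.
  by apply: mulr_gt0 => //; rewrite subr_gt0 ltr_pdivrMr//; lra.
apply: (@segint_le_prim R (fun x => w x ^+ 2) (fun x => A (x - s) - 4 / N.+1%:R * x)
  (fun x => S (x - s) ^+ 2 - 4 / N.+1%:R) _ _ s0 cw2).
  move=> x /andP[sx _].
  have dl : is_derive x 1 (fun y : R => y - s) 1.
    by apply: (isd_eq (isd_add (isd_id x) (isd_cst (- s) x))); ring.
  have dA' : is_derive (x - s) 1 A (S (x - s) ^+ 2) by apply: dA; rewrite subr_ge0.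
  apply: (isd_eq (isd_add (isd_comp dl dA') (isd_opp (isd_scale (4 / N.+1%:R) (isd_id x))))).
  by ring.
move=> x /andP[sx xs].
set i := 4 / N.+1%:R.
have i0 : 0 < i by rewrite divr_gt0.
have [ax|nx] := boolP (0 < x - s < d); last first.
  suff -> : S (x - s) = 0 by rewrite expr0n/= sub0r; have := sqr_ge0 (w x); lra.
  move: nx; rewrite negb_and -!leNgt => /orP[h|h].
    by rewrite (_ : x - s = 0) ?/arc_sin ?mulr0 ?sin0//; lra.
  by rewrite (_ : x - s = d) ?/arc_sin ?mulfVK ?sinpi ?gt_eqF//; lra.
have wE : w x = arc_approx d N (x - s).
  rewrite /w (@periodize_clip _ s d d01 _ x 0) subr0 /clip ?ax//.
  by move: ax => /andP[h1 h2]; apply/andP; split; lra.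
rewrite wE; have S0 := arc_sin_gt0 d01 ax.
have [h1 /(_ (ltW S0))/andP[h2 h3]] := arc_approx_bounds d N (x - s).
have := ler_norm (S (x - s)); have := arc_sin_le1 d (x - s).
move: h1; have -> : 2 / N.+1%:R = i / 2 by rewrite /i; field.
set a := arc_approx _ _ _ in h2 h3 *; set t := arc_sin d (x - s) in h3 S0 *.
clearbody i a t; move=> h1 h4 h5.
have [h|h] := leP (i / 2) t; last first.
  have : t * t <= i / 2 * 1 by apply: ler_pM; lra.
  by have := sqr_ge0 a; rewrite expr2; lra.
have : (t - i / 2) ^+ 2 <= a ^+ 2 by apply: lerXn2r; rewrite ?nnegrE//; lra.
have : i * t <= i * 1 by apply: ler_wpM2l; lra.
by have := sqr_ge0 (i / 2); lra.
Qed.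

(** The eigenfunction is the sine of the arc, cut off; it belongs to the form
    domain as the limit of its approximations, whose values and gradients converge
    pointwise and are bounded, and [arc_weak] is its equation. *)
Lemma arc_eigenvalue : dirichlet_eigenvalue (arc s d : set (torus 1 b)) ((pi / d) ^+ 2).
Proof.
have prE K (p : R * R) : lift1 (b:=b) (W K) (pr p) = W K p.1.
  by rewrite lift1_pr//; exact: periodize_per.
have comp K : lift1 (b:=b) (W K) \o pr = fun p => W K p.1 by rewrite funeqE => p; exact: prE.
have fdx n : dx (lift1 (b:=b) (W (arc_approx d n))) = fun p => W (arc_approx' d n) p.1.
  rewrite funeqE => p; rewrite /dx comp.
  by rewrite (fst_derive (1, 0) p (periodize_approx_derive n)) mul1r.
have fdy n : dy (lift1 (b:=b) (W (arc_approx d n))) = fun p => 0.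
  rewrite funeqE => p; rewrite /dy comp.
  by rewrite (fst_derive (0, 1) p (periodize_approx_derive n)) mul0r.
have test n : test_function (arc s d) (lift1 (b:=b) (W (arc_approx d n))).
  by apply: periodize_test => //; [exact: arc_approx_smooth|exact: arc_approx_end].
have pd0 : 0 <= pi / d by rewrite divr_ge0 ?pi_ge0 ?(ltW d0).
have S_ge0 r : 0 < r < d -> 0 <= S r by move=> /(arc_sin_gt0 d01)/ltW.
have ctW n : continuous (fun p : R * R => W (arc_approx d n) p.1).
  apply: (ct_comp _ (@ct_fst R)) => x.
  by apply: is_derive_continuous; exact: periodize_approx_derive.
have bW n x : `|W (arc_approx d n) x| <= 1.
  rewrite /periodize /clip; case: ifP => [h|_]; last by rewrite normr0.
  have [_ /(_ (S_ge0 _ h))/andP[h1 h2]] := arc_approx_bounds d n (frac_from s x).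
  rewrite ger0_norm//; apply: (le_trans h2); apply: (le_trans (ler_norm _)).
  exact: arc_sin_le1.
exists (lift1 (W S)), (lift1 (W C)), (fun=> 0); split.
- exists (fun n => lift1 (W (arc_approx d n))); split=> //.
  + under eq_fun do rewrite comp.
    rewrite comp; apply: (@L2_dominated _ _ b0 _ _ 1) => //.
    * move=> p; apply: periodize_cvg => r /S_ge0; exact: arc_approx_cvg.
    * by move=> p; apply: periodize_bound => r; exact: arc_sin_le1.
  + under eq_fun do rewrite fdx.
    rewrite comp; apply: (@L2_dominated _ _ b0 _ _ (pi / d)) => //.
    * by move=> n; apply: (ct_comp _ (@ct_fst R)); exact: periodize_approx'_ct.
    * by move=> p; apply: periodize_cvg => r /(arc_sin_gt0 d01); exact: arc_approx'_cvg.
    * move=> n p; apply: periodize_bound => r; rewrite normrM.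
      have /andP[h1 h2] := rho'_bounds (n.+1%:R * arc_sin d r - 1).
      rewrite ger0_norm//; apply: (le_trans _ (arc_cos_le d01 r)).
      by rewrite ler_piMl.
    * by move=> p; apply: periodize_bound => r; exact: arc_cos_le.
  + under eq_fun do rewrite fdy.
    apply: (@L2_dominated _ _ b0 _ _ 0) => //.
    * by move=> n; exact: cst_continuous.
    * by move=> p; exact: cvg_cst.
    * by move=> n p; rewrite normr0.
    * by move=> p /=; rewrite normr0.
- have [n npos] := arc_approx_mass.
  apply: (@lt_le_trans _ _ (\int[mu]_(p in cell 1 b) (W (arc_approx d n) p.1 ^+ 2)%:E)%E).
    by rewrite (cell_integral b0 (ct_exp (n:=2) (ctW n))) lte_fin.
  have cvS : measurable_fun (cell 1 b : set (measurableTypeR R * measurableTypeR R))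
      (fun p => W S p.1).
    apply: (@measurable_fun_cvg _ _ _ _ (fun n p => W (arc_approx d n) p.1)).
      by move=> k; exact: cont_measurable.
    by move=> p _; apply: periodize_cvg => r /S_ge0; exact: arc_approx_cvg.
  under [leRHS]eq_integral do rewrite prE.
  apply: ge0_le_integral.
  + exact: measurable_cell.
  + by move=> p _; rewrite lee_fin sqr_ge0.
  + apply/measurable_EFinP; apply: measurable_funX; exact: cont_measurable.
  + by apply/measurable_EFinP; apply: measurable_funX.
  + move=> p _; rewrite lee_fin /periodize /clip; case: ifP => [h|_] //.
    have s0 := S_ge0 _ h.
    have [_ /(_ s0)/andP[h1 h2]] := arc_approx_bounds d n (frac_from s p.1).
    by apply: lerXn2r; rewrite ?nnegrE.
move=> f tf; have [cf cfx cfy _ _] := test_C1 tf.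
have fx0 p : ~ arc s d (pr p) -> \forall q \near p, dx f q = 0.
  by move=> np; apply: filterS (test_near0_grad tf np) => q [].
have f0 p : ~ arc s d (pr p) -> \forall q \near p, f (pr q) = 0 by exact: test_near0 tf.
have c1 := arc_mul_ct (@ct_arc_cos R d) cfx fx0.
have c2 := arc_mul_ct (@ct_arc_sin R d) cf f0.
transitivity (boxint 0 1 0 b (fun p => W C p.1 * dx f p)).
  rewrite -(cell_Rintegral b0 c1); congr Rintegral; rewrite funeqE => p.
  by rewrite prE mul0r addr0.
rewrite (arc_weak tf); congr (_ * _).
rewrite -(cell_Rintegral b0 c2); congr Rintegral; rewrite funeqE => p.
by rewrite prE.
Qed.

End ArcEigenvalue.

(** * The partition into equal arcs *)

Section ArcPartition.
Context {R : realType} (b : R).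
Hypothesis b0 : 0 < b.
Local Notation pr := (@torus_pi R 1 b).
Implicit Types (x y r : R) (p q : R * R).
Variables (n : nat) (t : R).
Hypothesis n0 : (0 < n)%N.
Local Notation k := n.+1.

Let kR : 0 < k%:R :> R. Proof. by rewrite ltr0n. Qed.
Let kne : k%:R != 0 :> R. Proof. by rewrite pnatr_eq0. Qed.

(** The strips, translated by [(t, 0)]. *)
Definition arcs (i : 'I_k) : set (torus 1 b) := arc (t + i%:R / k%:R) k%:R^-1.

(** Indexes the arc of the torus covered by the [j]-th strip of the plane, [j] an
    integer. *)
Definition arc_index (j : int) : 'I_k := inord `|(j %% k)%Z|.

Lemma arc_index_mod (j : int) : (arc_index j)%:R = j%:~R - k%:R * (j %/ k)%Z%:~R :> R.
Proof.
have kz : (k : int) != 0 by [].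
have m0 := modz_ge0 j kz; have mk : (j %% k)%Z < k%:Z by rewrite ltz_pmod.
have : `|(j %% k)%Z|%:Z = (j %% k)%Z by rewrite gez0_abs.
rewrite /arc_index inordK; last by rewrite -ltz_nat gez0_abs.
move=> E; rewrite -[LHS]/(`|(j %% k)%Z|%:Z%:~R) E.
have := congr1 (fun z : int => z%:~R : R) (divz_eq j k); rewrite /= intrD intrM => ->.
by rewrite -[(Posz k)%:~R]/(k%:R); ring.
Qed.

Lemma arc_index_pred (j : int) : arc_index (j - 1) != arc_index j.
Proof.
apply/eqP => E; have := arc_index_mod (j - 1); rewrite E arc_index_mod intrB => H.
have {}H : k%:R * ((j %/ k)%Z - ((j - 1) %/ k)%Z)%:~R = 1 :> R.
  by rewrite intrB; move: H; rewrite -[1%:~R]/(1 : R); lra.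
have : ((k : int) * ((j %/ k)%Z - ((j - 1) %/ k)%Z))%:~R = 1%:~R :> R.
  by rewrite intrM H.
move/eqP; rewrite eqr_int => /eqP /(congr1 absz); rewrite abszM /= => /eqP.
by rewrite muln_eq1 => /andP[/eqP[e]]; move: n0; rewrite e.
Qed.

Lemma mem_arc_index (j : int) x y : t + j%:~R / k%:R < x < t + (j + 1)%:~R / k%:R ->
  arcs (arc_index j) (pr (x, y)).
Proof.
move=> /andP[l h]; exists (x - (j %/ k)%Z%:~R, y); last first.
  by rewrite -mulrNz pr_shift1.
rewrite /= arc_index_mod.
have E : t + (j%:~R - k%:R * (j %/ k)%Z%:~R) / k%:R = t + j%:~R / k%:R - (j %/ k)%Z%:~R by field.
rewrite E; move: h; rewrite intrD -[1%:~R]/(1 : R) => h.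
have {}h : x < t + j%:~R / k%:R + k%:R^-1 by move: h; rewrite mulrDl div1r addrA.
set Q := (_ %/ _)%Z%:~R; set J := j%:~R / k%:R in l h *; set K := k%:R^-1 in h *; clearbody Q J K.
by apply/andP; split; lra.
Qed.

Lemma arcs_strip (i : 'I_k) p : arcs i (pr p) ->
  exists j : int, t + j%:~R / k%:R < p.1 < t + (j + 1)%:~R / k%:R /\ arc_index j = i.
Proof.
move=> [q /= /andP[l h] /pr_eqP/andP[+ _]]; rewrite divr1 => /intrP[m Em].
exists (i%:Z - k%:Z * m); split.
  have E : (i%:Z - k%:Z * m)%:~R / k%:R = i%:R / k%:R - m%:~R :> R.
    by rewrite intrB intrM -[X in (X - _) / _ = _]/(i%:R) -[X in (_ - X * _) / _ = _]/(k%:R); field.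
  rewrite [(_ - _ + 1)%:~R]intrD mulrDl E -[1%:~R]/(1 : R) div1r.
  have -> : p.1 = q.1 - m%:~R by rewrite -Em; ring.
  move: l h; set M := m%:~R; set I := i%:R / k%:R; set K := k%:R^-1 => l h.
  by apply/andP; split; lra.
have -> : i%:Z - k%:Z * m = (- m) * k%:Z + i%:Z by ring.
apply/val_inj; rewrite /arc_index modzMDl modz_small ?ltz_nat ?ltn_ord//=.
by rewrite inordK ?absz_nat.
Qed.

Lemma arcs_open i : open (arcs i).
Proof.
apply: pr_open => //.
have -> : [set p : R * R | t + i%:R / k%:R < p.1 < t + i%:R / k%:R + k%:R^-1] =
    (fst : R * R -> R) @^-1` `]t + i%:R / k%:R, t + i%:R / k%:R + k%:R^-1[.
  by apply/seteqP; split => p /=; rewrite in_itv.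
by apply: open_comp => [p _|]; [exact: (@ct_fst R)|exact: interval_open].
Qed.

Lemma arcs_nonempty i : arcs i !=set0.
Proof.
exists (pr (t + i%:R / k%:R + k%:R^-1 / 2, 0)); eexists; last reflexivity.
have : 0 < k%:R^-1 :> R by rewrite invr_gt0.
rewrite /=; set I := i%:R / k%:R; set K := k%:R^-1; clearbody I K => h.
by apply/andP; split; lra.
Qed.

Lemma strip_index_unique (j j' : int) x : t + j%:~R / k%:R < x < t + (j + 1)%:~R / k%:R ->
  t + j'%:~R / k%:R < x < t + (j' + 1)%:~R / k%:R -> j = j'.
Proof.
have H (i : int) : t + i%:~R / k%:R < x < t + (i + 1)%:~R / k%:R ->
    Num.floor (k%:R * (x - t)) = i.
  move=> /andP[l h]; apply: floor_def; apply/andP; split.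
    by rewrite mulrC -ler_pdivrMr// lerBrDl ltW.
  by rewrite mulrC -ltr_pdivlMr// ltrBlDl.
by move=> /H <- /H.
Qed.

Lemma arcs_disjoint i i' p : arcs i (pr p) -> arcs i' (pr p) -> i = i'.
Proof.
move=> /arcs_strip[j [h <-]] /arcs_strip[j' [h' <-]].
by rewrite (strip_index_unique h h').
Qed.

(** By the floor of [k * (x - t)], a point of the plane is in an open strip or on
    one of the separating lines. *)
Lemma off_arcs p : (forall i, ~ arcs i (pr p)) <-> exists j : int, p.1 = t + j%:~R / k%:R.
Proof.
split=> [off|[j E] i /arcs_strip[j' [/andP[l h] _]]].
  exists (Num.floor (k%:R * (p.1 - t))); set j := Num.floor _.
  have /andP[l h] := floor_itv (k%:R * (p.1 - t)); rewrite -/j in l h.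
  have l' : t + j%:~R / k%:R <= p.1.
    by rewrite -lerBrDl ler_pdivrMr// mulrC.
  have h' : p.1 < t + (j + 1)%:~R / k%:R.
    by rewrite -ltrBlDl ltr_pdivlMr// mulrC.
  move: l'; rewrite le_eqVlt => /predU1P[<-//|l'].
  by case: (off (arc_index j)); rewrite (surjective_pairing p); apply: mem_arc_index; rewrite l'.
move: l h; rewrite E !ltrD2l !ltr_pM2r ?invr_gt0// !ltr_int => l h.
by move: h; rewrite ltzD1 leNgt l.
Qed.

Lemma slice_near (U : set (torus 1 b)) x y : nbhs (pr (x, y)) U ->
  \forall z \near x, U (pr (z, y)).
Proof.
move=> HU.
have c : continuous (fun z : R => pr (z, y)).
  move=> z; apply: (@continuous_comp _ _ _ (fun z : R => (z, y)) pr).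
    exact: (@ct_pair R R (fun t => t) (fun=> y) (@ct_id R) (@ct_cst R R y) z).
  exact: pr_continuous.
exact: c x _ HU.
Qed.

(** The points slightly to the right of [x] are in the same strip even if [x] is
    on its left side. *)
Lemma adherent_right (U : set (torus 1 b)) x y (j : int) :
  nbhs (pr (x, y)) U -> t + j%:~R / k%:R <= x < t + (j + 1)%:~R / k%:R ->
  U `&` arcs (arc_index j) !=set0.
Proof.
move=> HU /andP[l h].
have N : \forall z \near x^'+, U (pr (z, y)) /\ x < z < t + (j + 1)%:~R / k%:R.
  near=> z; split.
    by near: z; have := slice_near HU; exact: cvg_within.
  apply/andP; split; first by near: z; exact: nbhs_right_gt.
  by near: z; exact: nbhs_right_lt.
have [z [Uz /andP[xz zh]]] := @filter_ex _ _ (at_right_proper_filter x) _ N.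
exists (pr (z, y)); split=> //; apply: mem_arc_index.
by rewrite zh andbT; exact: le_lt_trans xz.
Unshelve. all: by end_near. Qed.

(** A point on a separating line is adherent to the strip on its left as well. *)
Lemma adherent_left (U : set (torus 1 b)) x y (j : int) :
  nbhs (pr (x, y)) U -> x = t + j%:~R / k%:R -> U `&` arcs (arc_index (j - 1)) !=set0.
Proof.
move=> HU xE.
have kx : t + (j - 1)%:~R / k%:R < x.
  by rewrite xE ltrD2l ltr_pM2r ?invr_gt0// ltr_int gtrBl.
have N : \forall z \near x^'-, U (pr (z, y)) /\ t + (j - 1)%:~R / k%:R < z < x.
  near=> z; split.
    by near: z; have := slice_near HU; exact: cvg_within.
  apply/andP; split; last by near: z; exact: nbhs_left_lt.
  by near: z; exact: nbhs_left_gt.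
have [z [Uz /andP[xz zh]]] := @filter_ex _ _ (at_left_proper_filter x) _ N.
exists (pr (z, y)); split=> //; apply: mem_arc_index.
by rewrite xz /= subrK -xE.
Unshelve. all: by end_near. Qed.

Lemma floor_strip x : exists j : int, t + j%:~R / k%:R <= x < t + (j + 1)%:~R / k%:R.
Proof.
exists (Num.floor (k%:R * (x - t))).
have /andP[l h] := floor_itv (k%:R * (x - t)).
apply/andP; split; first by rewrite -lerBrDl ler_pdivrMr// [_ * k%:R]mulrC.
by rewrite -ltrBlDl ltr_pdivlMr// [_ * k%:R]mulrC.
Qed.

Lemma adherent_arc (q : torus 1 b) : exists i, closure (arcs i) q.
Proof.
rewrite -[q]reprK -/(pr (repr q)); case: (repr q) => x y.
have [j hj] := floor_strip x; exists (arc_index j) => U HU.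
by rewrite setIC; exact: adherent_right HU hj.
Qed.

(** A point outside an arc is either in another one or on a line separating two
    distinct arcs. *)
Lemma adherent_other (q : torus 1 b) i (U : set (torus 1 b)) : ~ arcs i q -> nbhs q U ->
  exists2 i', i' != i & U `&` arcs i' !=set0.
Proof.
rewrite -[q]reprK -/(pr (repr q)); case: (repr q) => x y ni HU.
have [j hj] := floor_strip x.
have [ji|/negPn/eqP ji] := boolP (arc_index j != i).
  by exists (arc_index j) => //; exact: adherent_right HU hj.
exists (arc_index (j - 1)); first by rewrite -ji arc_index_pred.
apply: (adherent_left HU); move: hj => /andP[+ h].
rewrite le_eqVlt => /predU1P[//|l].
by case: ni; rewrite -ji; apply: mem_arc_index; rewrite l.
Qed.

Lemma arcs_partition : is_partition arcs.
Proof.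
split=> [i|i j ij]; first by split; [exact: arcs_open|exact: arcs_nonempty].
apply/seteqP; split=> // q; rewrite -[q]reprK -/(pr (repr q)) => -[h1 h2].
by move: ij; rewrite (arcs_disjoint h1 h2) eqxx.
Qed.

Lemma closure_off (i i' : 'I_k) (q : torus 1 b) : closure (arcs i) q -> arcs i' q -> i = i'.
Proof.
move=> cq aq; have [q' []] : arcs i `&` arcs i' !=set0.
  by apply: cq; apply: open_nbhs_nbhs; split=> //; exact: arcs_open.
by rewrite -[q']reprK -/(pr (repr q')); exact: arcs_disjoint.
Qed.

(** A point interior to the closure of an arc but outside the arc would be near
    another arc, disjoint from this closure. *)
Lemma arcs_strong : strong arcs.
Proof.
split.
  by apply/seteqP; split=> // q _; have [i hi] := adherent_arc q; exists i.
move=> i; apply/seteqP; split=> q; last first.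
  move=> aq; apply: (filterS (@subset_closure _ _)).
  by apply: open_nbhs_nbhs; split=> //; exact: arcs_open.
move=> iq; apply: contrapT => nq.
have [i' ii' [q' [cq' aq']]] := adherent_other nq iq.
by move: ii'; rewrite (closure_off cq' aq') eqxx.
Qed.

Lemma arcs_boundary : boundary_set arcs = ~` \bigcup_i arcs i.
Proof.
have iE i : interior (arcs i) = arcs i.
  apply/seteqP; split=> q; first exact: interior_subset.
  by move=> aq; apply: open_nbhs_nbhs; split=> //; exact: arcs_open.
have E : \bigcup_i (closure (arcs i) `\` interior (arcs i)) = ~` \bigcup_i arcs i.
  apply/seteqP; split=> q.
    move=> [i _ []]; rewrite iE => cq nq [i' _ aq].
    by apply: nq; rewrite (closure_off cq aq).
  move=> nq; have [i ci] := adherent_arc q; exists i => //; split=> //.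
  by rewrite iE => aq; apply: nq; exists i.
rewrite /boundary_set E; apply/esym/closure_id.
by apply: open_closedC; apply: bigcup_open => i _; exact: arcs_open.
Qed.

Lemma boundary_lines p : boundary_set arcs (pr p) <-> exists j : int, p.1 = t + j%:~R / k%:R.
Proof.
rewrite arcs_boundary -off_arcs; split=> [h i ai|h [i _ ai]]; last exact: h i ai.
by apply: h; exists i.
Qed.

End ArcPartition.

(** * Regularity, and the translated strips *)

Section AffineSmooth.
Context {R : realType}.
Implicit Types (p v : R * R) (x y : R).

(** A flattening of the vertical lines, the boundary set being required to become
    horizontal. *)
Definition swap_affine (c c' : R) p : R * R := (p.2 + c, p.1 + c').

Lemma swap_affine_diff c c' p : is_diff p (swap_affine c c') (fun v => (v.2, v.1)).
Proof.
have d1 : is_diff p (fst : R * R -> R) fst.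
  by split; [exact: differentiable_fst|apply: diff_lin => q; exact: (@ct_fst R)].
have d2 : is_diff p (snd : R * R -> R) snd.
  have cs : continuous (snd : R * R -> R) by move=> q; exact: (@ct_snd R).
  by split; [exact: linear_differentiable|exact: diff_lin].
have e1 : is_diff p ((snd : R * R -> R) + cst c) (snd + 0).
  exact: is_diffD.
have e2 : is_diff p ((fst : R * R -> R) + cst c') (fst + 0).
  exact: is_diffD.
have := is_diff_pair e1 e2.
by rewrite !addr0.
Qed.

Lemma swap_affine_smooth c c' (U : set (R * R)) : smooth_on U (swap_affine c c').
Proof.
have H (l : seq (R * R)) : iter_deriv l (swap_affine c c') = swap_affine c c' \/
    exists a, iter_deriv l (swap_affine c c') = fun=> a.
  elim: l => [|v l [E|[a E]]]; first by left.
    right; exists (v.2, v.1); rewrite /= -/(iter_deriv l _) E funeqE => p.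
    have [dA dE] := swap_affine_diff c c' p.
    by rewrite deriveE// dE.
  right; exists 0; rewrite /= -/(iter_deriv l _) E funeqE => p.
  by rewrite -[fun=> a]/(cst a) derive_cst.
move=> l p _; case: (H l) => [->|[a ->]]; last exact: differentiable_cst.
by have [] := swap_affine_diff c c' p.
Qed.

End AffineSmooth.

Section ArcRegular.
Context {R : realType} (b : R).
Hypothesis b0 : 0 < b.
Local Notation pr := (@torus_pi R 1 b).
Implicit Types (x y r : R) (p q : R * R).
Variables (n : nat) (t : R).
Hypothesis n0 : (0 < n)%N.
Local Notation k := n.+1.

(** The boundary set consists of vertical lines: there are no singular points, and
    exchanging the coordinates straightens it. *)
Lemma arcs_regular : regular (arcs t (b:=b) (n:=n)).
Proof.
have kR : 0 < k%:R :> R by rewrite ltr0n.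
pose K : R := k%:R^-1; have i0 : 0 < K by rewrite invr_gt0.
exists set0; split => //.
move=> [x1 x2] [Nx _].
have [j /= xj] := (boundary_lines b0 n t (x1, x2)).1 Nx.
pose U := [set q : R * R | x1 - K < q.1 < x1 + K].
pose V := [set q : R * R | - K < q.2 < K].
have oU : open U.
  have -> : U = (fst : R * R -> R) @^-1` `]x1 - K, x1 + K[.
    by apply/seteqP; split => p /=; rewrite in_itv.
  by apply: open_comp => [p _|]; [exact: (@ct_fst R)|exact: interval_open].
have oV : open V.
  have -> : V = (snd : R * R -> R) @^-1` `]- K, K[.
    by apply/seteqP; split => p /=; rewrite in_itv.
  by apply: open_comp => [p _|]; [exact: (@ct_snd R)|exact: interval_open].
exists U, V, (swap_affine 0 (- x1)), (swap_affine x1 0); split => //.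
- by split=> //; rewrite /U /=; apply/andP; split; lra.
- by split; exact: swap_affine_smooth.
- rewrite /U /V /swap_affine; split=> -[y1 y2] /= /andP[l h].
    split; first by apply/andP; split; lra.
    by congr pair; ring.
  split; first by apply/andP; split; lra.
  by congr pair; ring.
apply/seteqP; split=> z.
  move=> [[y1 y2] [/(boundary_lines b0 n t)[j' /= yj] Uy] <-].
  move: Uy; rewrite /U /V /swap_affine /= => /andP[l h].
  suff E : j' = j.
    have e : y1 = x1 by rewrite yj E -xj.
    by rewrite e; split; [apply/andP; split|]; lra.
  apply/eqP; rewrite eq_le -[(j' <= j)]ltzD1 -[(j <= j')]ltzD1.
  have kj (i i' : int) : t + i%:~R / k%:R < t + i'%:~R / k%:R + K -> i < i' + 1.
    rewrite /K -addrA ltrD2l -[X in _ + X]div1r -mulrDl ltr_pM2r//.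
    by rewrite -[1 in X in X -> _]/(1%:~R) -intrD ltr_int.
  by apply/andP; split; apply: kj; rewrite -yj -xj; lra.
move=> [Vz z2]; exists (x1, z.1); last first.
  by rewrite /swap_affine /= subrr addr0 -[0]z2 -surjective_pairing.
split; last by rewrite /U /=; apply/andP; split; lra.
by apply/(boundary_lines b0 n t); exists j.
Qed.

(** Only the horizontal part of the translation matters, the strips being
    invariant by vertical ones. *)
Lemma translate_strip (v : R * R) (i : 'I_k) : translate v (strip 1 b i) = arcs v.1 i.
Proof.
have kR : 0 < k%:R :> R by rewrite ltr0n.
have iE : i%:R / k%:R + k%:R^-1 = i.+1%:R / k%:R :> R.
  by rewrite -[i.+1%:R]natr1 mulrDl div1r.
apply/seteqP; split=> T.
  move=> [x [z [/= /andP[l h] _] zx] <-]; exists (z + v).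
    rewrite /= -addrA iE; set I := i%:R / k%:R in l *; set J := i.+1%:R / k%:R in h *.
    by apply/andP; split; lra.
  apply/pr_eqP; move/pr_eqP: zx; rewrite /lattice_rel/=.
  rewrite (_ : z.1 + v.1 - (x.1 + v.1) = z.1 - x.1); last by ring.
  by rewrite (_ : z.2 + v.2 - (x.2 + v.2) = z.2 - x.2)//; ring.
move=> [q /= /andP[l h] <-]; exists (q - v); last by rewrite subrK.
rewrite -addrA iE in h.
pose m := Num.floor ((q.2 - v.2) / b).
have /andP[ml mh] := floor_itv ((q.2 - v.2) / b).
rewrite -/m in ml mh.
exists (q.1 - v.1, q.2 - v.2 + (- m)%:~R * b); last exact: pr_shift2.
rewrite /=; split.
  set I := i%:R / k%:R in l *; set J := i.+1%:R / k%:R in h *.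
  by apply/andP; split; lra.
rewrite ler_pdivlMr// in ml; rewrite ltr_pdivrMr// intrD -[1%:~R]/(1 : R) in mh.
by rewrite mulrNz; apply/andP; split; lra.
Qed.

End ArcRegular.

(** * The minimal energy *)

Section LowerBound.
Context {R : realType} (b : R).
Hypothesis b0 : 0 < b.
Local Notation pr := (@torus_pi R 1 b).
Variables (n : nat) (th : R).
Hypothesis n0 : (0 < n)%N.
Local Notation k := n.+1.
Local Notation om := (k%:R * pi : R).
Hypothesis omth : om < th.
Hypothesis thb2 : th * b < 2 * pi.
Hypothesis thb1 : odd k -> th * b < pi.
Implicit Types (D : 'I_k -> set (torus 1 b)).

Let om0 : 0 < om. Proof. by rewrite mulr_gt0 ?ltr0n// pi_gt0. Qed.

Lemma energy_tests D (m e : R) : (energy D <= m%:E)%E -> 0 < e ->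
  forall j, exists f, [/\ test_function (D j) f, 0 < sqnorm f & dirichlet f <= (m + e) * sqnorm f].
Proof.
move=> Em e0 j.
have gm : (ground_energy (D j) < (m + e / 2)%:E)%E.
  apply: (@le_lt_trans _ _ m%:E); last by rewrite lte_fin; lra.
  by apply: le_trans Em; exact: (le_bigmax _ (fun i => ground_energy (D i))).
have [_ [l el <-] lm] := ereal_inf_lt gm.
have e20 : 0 < e / 2 by lra.
have [f [tf Nf Ef]] := eigenvalue_test b0 el e20.
exists f; split=> //; apply: (le_trans Ef); apply: ler_wpM2r; first exact: ltW.
by move: lm; rewrite lte_fin; lra.
Qed.

(** By [vertical_circle], as [th * b < pi] for [k] odd. *)
Lemma low_energy_circles D (m : R) : m < th ^+ 2 ->
  (forall j, exists f, [/\ test_function (D j) f, 0 < sqnorm f & dirichlet f <= m * sqnorm f]) ->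
  odd k -> forall j, exists xi, forall y, D j (pr (xi, y)).
Proof.
move=> mth H ok j; have [f [tf Nf Ef]] := H j.
apply: (vertical_circle b0 tf (th := th)).
- by rewrite ltW// (lt_trans om0).
- exact: thb1.
- by apply: (le_lt_trans Ef); rewrite ltr_pM2r.
Qed.

Lemma om_lt_th : om ^+ 2 < th ^+ 2.
Proof. by rewrite ltr_sqr// nnegrE ltW// (lt_trans om0). Qed.

(** If the energy were smaller than [om ^+ 2], test functions would have all
    quotients smaller than [om ^+ 2] by a fixed amount, and [partition_stability]
    would bound a squared norm by a negative number. *)
Lemma partition_lower_bound D : is_partition D -> ((om ^+ 2)%:E <= energy D)%E.
Proof.
move=> [_ DD]; rewrite leNgt; apply/negP => lowD.
have [m mom Em] : exists2 m : R, m < om ^+ 2 & (energy D <= m%:E)%E.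
  case E : (energy D) lowD => [r| |] // lowD.
    by exists r => //; rewrite -lte_fin.
  by exists 0; rewrite ?leNye// exprn_gt0.
pose e := (om ^+ 2 - m) / 2.
have e0 : 0 < e by rewrite /e; lra.
have H := energy_tests Em e0.
have me : m + e < th ^+ 2 by have := om_lt_th; rewrite /e; lra.
have circ := low_energy_circles me H.
have [sg [_ _ _ stab]] := partition_stability b0 n0 omth thb2 DD circ.
have [f Hf] := choice H.
have tf j : test_function (D j) (f j) by have [] := Hf j.
have Nf j : 0 < sqnorm (f j) by have [] := Hf j.
have [x0 [c [al [_ c1 S]]]] := stab f tf Nf.
have cst0 := stab_cst_gt0 (isT : (0 < k)%N) omth.
have : \sum_j c j ^+ 2 * (dirichlet (f j) / sqnorm (f j) - om ^+ 2) <= \sum_j c j ^+ 2 * - e.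
  apply: ler_sum => j _; apply: ler_wpM2l; first exact: sqr_ge0.
  have [_ _ Ef] := Hf j.
  have : dirichlet (f j) / sqnorm (f j) <= m + e by rewrite ler_pdivrMr.
  by rewrite /e; lra.
rewrite -mulr_suml c1 mul1r => S2.
have := le_trans S S2; rewrite leNgt => /negP; apply.
apply: (@lt_le_trans _ _ 0); first by rewrite oppr_lt0.
by apply: mulr_ge0; [exact: ltW|apply: boxint_ge0 => x y _ _; exact: sqr_ge0].
Qed.

Lemma arcs_energy (t : R) (s : 'S_k) : (energy (fun i => arcs t (b:=b) (n:=n) (s i)) <= (om ^+ 2)%:E)%E.
Proof.
apply: bigmax_le => [|i _]; first exact: leNye.
have kR : 0 < k%:R :> R by rewrite ltr0n.
have d01 : 0 < (k%:R : R)^-1 < 1.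
  by rewrite invr_gt0 kR /= invf_lt1// ltr1n.
have := arc_eigenvalue b0 (t + (s i)%:R / k%:R) d01.
rewrite invrK [pi * _]mulrC => ei.
by apply: ereal_inf_lbound; exists (om ^+ 2).
Qed.

Lemma min_energyE : min_energy 1 b k = (om ^+ 2)%:E.
Proof.
apply/eqP; rewrite eq_le; apply/andP; split; last first.
  by apply: le_ereal_inf_tmp => _ [D pD <-]; exact: partition_lower_bound.
apply: le_trans (arcs_energy 0 1%g).
apply: ereal_inf_lbound; exists (fun i => arcs 0 ((1%g : 'S_k) i)) => //.
have [h1 h2] := arcs_partition b0 n 0.
by split=> [i|i j ij]; [exact: h1|apply: h2; rewrite !perm1].
Qed.

Lemma arcs_minimal (t : R) (s : 'S_k) D : (forall i, D (s i) = arcs t i) -> minimal_partition D.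
Proof.
move=> Ds.
have DE : D = fun i => arcs t ((s^-1)%g i).
  by rewrite funeqE => i; rewrite -Ds permKV.
have [h1 h2] := arcs_partition b0 n t.
have pD : is_partition D.
  rewrite DE; split=> [i|i j ij]; first exact: h1.
  by apply: h2; apply: contra ij => /eqP/perm_inj ->.
have bigE (F : 'I_k -> set (torus 1 b)) : \bigcup_i F ((s^-1)%g i) = \bigcup_i F i.
  apply/seteqP; split=> q [i _ Fi]; first by exists ((s^-1)%g i).
  by exists (s i) => //; rewrite permK.
have bdE : boundary_set D = boundary_set (arcs (b:=b) (n:=n) t).
  rewrite /boundary_set DE.
  by rewrite (bigE (fun i => closure (arcs t i) `\` interior (arcs t i))).
split=> //.
- apply/eqP; rewrite eq_le; apply/andP; split.
    by rewrite min_energyE DE; exact: arcs_energy.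
  by apply: ereal_inf_lbound; exists D.
- have [s1 s2] := @arcs_strong R b b0 n t n0.
  split; last by move=> i; rewrite DE; exact: s2.
  by rewrite DE (bigE (fun i => closure (arcs t i))).
- by have := arcs_regular b0 n t; rewrite /regular bdE.
Qed.

End LowerBound.

(** The number [th] is halfway between [k * pi] and [pi / b] or [2 * pi / b]: the
    condition on [b] says that these are in this order. *)
Lemma threshold_exists (R : realType) (b : R) k : (0 < k)%N -> 0 < b ->
  b < (if odd k then 1 / k%:R else 2 / k%:R) ->
  exists th, [/\ k%:R * pi < th, th * b < 2 * pi & odd k -> th * b < pi].
Proof.
move=> k0 b0 bk; have kR : 0 < k%:R :> R by rewrite ltr0n.
have pi0 := pi_gt0 R.
pose c : R := if odd k then 1 else 2.
have c12 : 0 < c <= 2 by rewrite /c; case: ifP => _; apply/andP; split; lra.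
have {}bk : b * k%:R < c.
  by rewrite -ltr_pdivlMr//; move: bk; rewrite /c; case: ifP.
have bp : k%:R * pi * b < c * pi.
  by rewrite mulrC mulrA ltr_pM2r.
exists ((k%:R * pi + c * pi / b) / 2).
have e : (k%:R * pi + c * pi / b) / 2 * b = (k%:R * pi * b + c * pi) / 2.
  by move: (@pi R) => q; field; rewrite gt_eqF.
have cp : c * pi <= 2 * pi by rewrite ler_pM2r//; case/andP: c12.
split.
- have : k%:R * pi < c * pi / b by rewrite ltr_pdivlMr.
  by lra.
- by rewrite e; lra.
- by move=> ok; rewrite e; move: bp; rewrite /c ok; lra.
Qed.

(** * A function close to the sine in a domain cannot vanish nearby *)

Section TwoSquares.
Context {R : realType}.
Implicit Types (x y z r a c d e w xl xr yl yr : R) (v s : R -> R) (f u F : R * R -> R).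

Lemma ct_inv (T : topologicalType) (f : T -> R) : (forall x : T, f x != 0) -> continuous f ->
  continuous (fun z : T => (f z)^-1).
Proof. by move=> f0 cf z; apply: cvgV => //; exact: cf. Qed.

Lemma segint_shift a w v : 0 <= w -> continuous v -> segint a (a + w) v = segint 0 w (fun z => v (a + z)).
Proof.
move=> w0 cv; have [A dA] := segint_prim a cv.
have -> : segint a (a + w) v = A (a + w) - A a.
  have aw : a <= a + w by rewrite lerDl.
  have dA0 x : a <= x <= a + w -> is_derive x 1 A (v x) by move=> /andP[ax _]; exact: dA.
  exact: (segint_FTC aw cv dA0).
have cv' : continuous (fun z : R => v (a + z)) by exact: (ct_comp cv (ct_add (@ct_cst _ _ a) (@ct_id R))).
rewrite -[X in A (a + w) - A X]addr0; apply: esym.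
have dAa x : 0 <= x <= w -> is_derive x 1 (fun z => A (a + z)) (v (a + x)).
  move=> /andP[x0 _].
  have dl : is_derive x 1 (fun z => a + z) 1.
    by apply: (isd_eq (isd_add (isd_cst a x) (isd_id x))); ring.
  have dA' : is_derive (a + x) 1 A (v (a + x)) by apply: dA; rewrite lerDl.
  by apply: (isd_eq (isd_comp dl dA')); ring.
exact: (segint_FTC w0 cv' dAa).
Qed.

Lemma segint_sub a a' c c' v : continuous v -> (forall x, a' <= x <= c' -> 0 <= v x) ->
  a' <= a -> a <= c -> c <= c' -> segint a c v <= segint a' c' v.
Proof.
move=> cv v0 h1 h2 h3.
rewrite (segint_chasles h1 (le_trans h2 h3) cv) (segint_chasles h2 h3 cv).
have p1 : 0 <= segint a' a v.
  by apply: segint_ge0 => x /andP[l h]; apply: v0; rewrite l (le_trans h)// (le_trans h2).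
have p2 : 0 <= segint c c' v.
  by apply: segint_ge0 => x /andP[l h]; apply: v0; rewrite h andbT (le_trans h1)// (le_trans h2).
by lra.
Qed.

Lemma boxint_sub a a' c c' d d' e e' F : continuous F ->
  (forall x y, a' <= x <= c' -> d' <= y <= e' -> 0 <= F (x, y)) ->
  a' <= a -> a <= c -> c <= c' -> d' <= d -> d <= e -> e <= e' ->
  boxint a c d e F <= boxint a' c' d' e' F.
Proof.
move=> cF F0 h1 h2 h3 h4 h5 h6.
apply: (@le_trans _ _ (boxint a c d' e' F)).
  apply: le_segint; [exact: ct_segint|exact: ct_segint|move=> x /andP[l h]].
  apply: (segint_sub (ct_slice2 cF)) => // y; apply: F0.
  by rewrite (le_trans h1 l) (le_trans h h3).
apply: (segint_sub (ct_segint cF)) => // x xs; apply: segint_ge0 => y; exact: F0.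
Qed.

Lemma segint_norm a c v : continuous v -> `|segint a c v| <= segint a c (fun x => `|v x|).
Proof.
move=> cv; have cn : continuous (fun x => `|v x|) by cont.
rewrite ler_norml; apply/andP; split.
  rewrite -mulN1r -segintZ//; apply: le_segint => //; first by cont.
  by move=> x _; rewrite mulN1r lerNl -normrN; exact: ler_norm.
by apply: le_segint => // x _; exact: ler_norm.
Qed.

(** Translating the window changes each value of [v] by at most the integral of
    [`|v'|]. *)
Lemma window_shift1 v v' xl xr a1 a2 w : 0 <= w -> continuous v -> continuous v' ->
  (forall x, is_derive x 1 v (v' x)) ->
  xl <= a1 -> a1 + w <= xr -> xl <= a2 -> a2 + w <= xr ->
  segint a2 (a2 + w) v - segint a1 (a1 + w) v <= w * segint xl xr (fun x => `|v' x|).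
Proof.
move=> w0 cv cv' dv h1 h2 h3 h4.
have cn : continuous (fun x => `|v' x|) by cont.
have pt z1 z2 : xl <= z1 <= xr -> xl <= z2 <= xr -> v z2 - v z1 <= segint xl xr (fun x => `|v' x|).
  wlog le12 : z1 z2 / z1 <= z2 => [H|].
    have [h|/ltW h] := leP z1 z2; first exact: H.
    move=> /andP[l1 r1] /andP[l2 r2].
    have -> : v z2 - v z1 = - segint z2 z1 v'.
      by rewrite (segint_FTC h cv' (fun x _ => dv x)); ring.
    apply: (@le_trans _ _ (segint z2 z1 (fun x => `|v' x|))); last exact: (segint_sub cn).
    by apply: le_trans (segint_norm _ _ cv'); rewrite -normrN ler_norm.
  move=> /andP[l1 r1] /andP[l2 r2].
  rewrite -(segint_FTC le12 cv' (fun x _ => dv x)).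
  apply: (@le_trans _ _ (segint z1 z2 (fun x => `|v' x|))); last exact: (segint_sub cn).
  by apply: le_trans (segint_norm _ _ cv'); exact: ler_norm.
rewrite (segint_shift a1 w0 cv) (segint_shift a2 w0 cv).
have cs a : continuous (fun z : R => v (a + z)) by exact: (ct_comp cv (ct_add (@ct_cst _ _ a) (@ct_id R))).
rewrite -segintB//.
have -> : w * segint xl xr (fun x => `|v' x|) = segint 0 w (fun=> segint xl xr (fun x => `|v' x|)).
  by rewrite segint_cst// subr0 mulrC.
apply: le_segint; [by cont|by cont|move=> z /andP[z0 zw]].
by apply: pt; apply/andP; split; lra.
Qed.

Lemma window_shift_x F Fx xl xr a1 a2 w d e : 0 <= w -> continuous F -> continuous Fx ->
  (forall x y, is_derive x 1 (fun x => F (x, y)) (Fx (x, y))) ->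
  xl <= a1 -> a1 + w <= xr -> xl <= a2 -> a2 + w <= xr ->
  boxint a2 (a2 + w) d e F - boxint a1 (a1 + w) d e F <= w * boxint xl xr d e (fun p => `|Fx p|).
Proof.
move=> w0 cF cFx dF h1 h2 h3 h4.
have := @window_shift1 _ _ xl xr a1 a2 w w0 (ct_segint (c:=d) (d:=e) cF) (ct_segint (c:=d) (d:=e) cFx)
  (fun x => isd_segint d e x cF cFx dF) h1 h2 h3 h4.
move=> /le_trans; apply; apply: ler_wpM2l => //.
have cn : continuous (fun p => `|Fx p|) by cont.
apply: le_segint; [by have := ct_segint (c:=d) (d:=e) cFx => ?; cont|exact: (ct_segint cn)|move=> x _].
exact: (segint_norm _ _ (ct_slice2 cFx)).
Qed.

Lemma window_shift_y F Fy yl yr c1 c2 w a e : 0 <= w -> continuous F -> continuous Fy ->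
  (forall x y, is_derive y 1 (fun y => F (x, y)) (Fy (x, y))) ->
  yl <= c1 -> c1 + w <= yr -> yl <= c2 -> c2 + w <= yr ->
  boxint a e c2 (c2 + w) F - boxint a e c1 (c1 + w) F <= w * boxint a e yl yr (fun p => `|Fy p|).
Proof.
move=> w0 cF cFy dF h1 h2 h3 h4.
have cn : continuous (fun p => `|Fy p|) by cont.
have ci c d : continuous (fun x => segint c d (fun y => F (x, y))) by exact: ct_segint.
have cj : continuous (fun x => segint yl yr (fun y => `|Fy (x, y)|)) by exact: (ct_segint cn).
rewrite /boxint -(segintB a e (ci _ _) (ci _ _)) -(segintZ w a e cj).
apply: le_segint.
- exact: (ct_add (ci _ _) (ct_opp (ci _ _))).
- exact: (ct_mul (@ct_cst _ _ w) cj).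
move=> x _; exact: (window_shift1 w0 (ct_slice2 cF) (ct_slice2 cFy) (dF x)).
Qed.

Lemma abs_sin_le x : `|sin x| <= `|x|.
Proof.
have pos z : 0 <= z -> `|sin z| <= z.
  move=> z0.
  have dp (t : R) : is_derive t 1 (fun y => y + sin y) (1 + cos t).
    exact: (isd_add (isd_id t) (is_derive_sin t)).
  have dm (t : R) : is_derive t 1 (fun y => y - sin y) (1 - cos t).
    exact: (isd_add (isd_id t) (isd_opp (is_derive_sin t))).
  have p0 (t : R) : 0 <= 1 + cos t by have := cos_geN1 t; lra.
  have m0 (t : R) : 0 <= 1 - cos t by have := cos_le1 t; lra.
  have := is_derive_mono z0 (fun t _ => dp t) (fun t _ => p0 t).
  have := is_derive_mono z0 (fun t _ => dm t) (fun t _ => m0 t).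
  by rewrite sin0 subr0 addr0 => h1 h2; rewrite ler_norml; apply/andP; split; lra.
have [x0|/ltW x0] := leP 0 x; first by rewrite (ger0_norm x0); exact: pos.
by rewrite -normrN -sinN (ler0_norm x0); apply: pos; rewrite oppr_ge0.
Qed.

Lemma cos_lower x : 1 - x ^+ 2 / 2 <= cos x.
Proof.
have -> : cos x = 1 - 2 * sin (x / 2) ^+ 2.
  have := cos2Dsin2 (x / 2); have -> : cos x = cos (x / 2 + x / 2) by congr cos; field.
  by rewrite cosD -!expr2; lra.
have : sin (x / 2) ^+ 2 <= (x / 2) ^+ 2.
  rewrite -[leLHS](real_normK (num_real _)) -[leRHS](real_normK (num_real _)).
  by apply: lerXn2r; rewrite ?nnegrE//; exact: abs_sin_le.
by rewrite exprMn exprVn => h; lra.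
Qed.

Definition pos2 r : R := if 0 < r then r ^+ 2 else 0.
(** A [C1] function bounded below by [c / 2] which coincides with [s] where
    [s >= c]: its inverse is a [C1] function on the whole line. *)
Definition lift_pos c s x : R := s x + (2 * c)^-1 * pos2 (c - s x).

Lemma pos2_derive r : is_derive r 1 pos2 (r + `|r|).
Proof.
have [r0|r0|->] := ltgtP r 0.
- rewrite ltr0_norm// subrr; apply: (isd_near (isd_cst 0 r)).
  near=> y; rewrite /pos2 ltNge (_ : y <= 0)//; apply: ltW; near: y; exact: lt_nbhsl.
- rewrite gtr0_norm//; apply: (@isd_near _ (fun y => y * y)).
    by apply: (isd_eq (isd_mul (isd_id r) (isd_id r))); ring.
  by near=> y; rewrite /pos2 ifT ?expr2//; near: y; exact: lt_nbhsr.
- rewrite normr0 addr0; apply: (@isd_quadratic _ _ 1) => x; rewrite mul1r /pos2.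
  by case: ifP => _; [rewrite ger0_norm// sqr_ge0|rewrite normr0 sqr_ge0].
Unshelve. all: by end_near. Qed.

Lemma lift_pos_eq c s x : c <= s x -> lift_pos c s x = s x.
Proof. by move=> cs; rewrite /lift_pos /pos2 subr_gt0 ltNge cs /= mulr0 addr0. Qed.

Lemma lift_pos_ge c s x : 0 < c -> c / 2 <= lift_pos c s x.
Proof.
move=> c0; have [cs|sc] := leP c (s x); first by rewrite lift_pos_eq//; lra.
rewrite /lift_pos /pos2 subr_gt0 sc.
have -> : s x + (2 * c)^-1 * (c - s x) ^+ 2 = c / 2 + (2 * c)^-1 * s x ^+ 2.
  by field; rewrite gt_eqF.
by rewrite lerDl mulr_ge0 ?sqr_ge0// invr_ge0; lra.
Qed.

Lemma sqr_add_le a c : (a + c) ^+ 2 <= 2 * (a ^+ 2 + c ^+ 2).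
Proof. by have := sqr_ge0 (a - c); rewrite sqrrB sqrrD; lra. Qed.

Lemma young_abs (eta a d : R) : 0 < eta -> `|a| * `|d| <= (eta^-1 * a ^+ 2 + eta * d ^+ 2) / 2.
Proof.
move=> eta0; rewrite -[a ^+ 2](real_normK (num_real a)) -[d ^+ 2](real_normK (num_real d)).
set x := `|a|; set y := `|d|; rewrite -subr_ge0.
have -> : (eta^-1 * x ^+ 2 + eta * y ^+ 2) / 2 - x * y = eta^-1 / 2 * (x - eta * y) ^+ 2.
  by field; rewrite gt_eqF.
by rewrite mulr_ge0 ?sqr_ge0// divr_ge0// invr_ge0 ltW.
Qed.

(** The balance of [two_squares]: [i11], [i21], [i22] are the integrals of
    [cos (pi * h)] over the first square, its translate below or above the second
    one, and the second one. *)
Lemma squares_balance (w L ei eta q E H i11 i21 i22 X Y : R) :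
  i21 - i11 <= X -> i22 - i21 <= Y -> i22 = w * w -> i11 <= q * E - w * w ->
  X <= w * (L / 2 * (ei * E + eta * H)) -> Y <= w * (L / 2 * (ei * E + eta * H)) ->
  w * L * eta * H <= w ^+ 2 -> w ^+ 2 <= E * (q + w * L * ei).
Proof.
move=> h1 h2 i2 h3 h4 h5 h6; rewrite i2 in h2.
have e1 : w * (L / 2 * (ei * E + eta * H)) = (w * L * ei * E + w * L * eta * H) / 2 by field.
rewrite e1 in h4 h5.
have -> : E * (q + w * L * ei) = q * E + w * L * ei * E by ring.
rewrite expr2 in h6 *.
move: h1 h2 h3 h4 h5 h6.
move: (w * w) (q * E) (w * L * ei * E) (w * L * eta * H) => a c d e; clear; lra.
Qed.

(** With [h = u / s], the function [cos (pi * h)] is [1] on the square off [D] and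
    about [-1] on the square inside [D], in mean. Moving the first square to the
    second one changes the integral by at most the L1 norm of the gradient
    [pi * sin (pi * h) * grad h], where [`|sin (pi * h)| <= pi * `|h - 1|] on [D]
    and [sin (pi * h) = 0] elsewhere. As [grad h] is bounded in L2, all is
    controlled by the L2 distance of [f] to [s], since [u = f] on [D]. *)
Lemma two_squares s s' xl xr yl yr a1 a2 c1 c2 w c M :
  0 < w -> 0 < c -> 0 <= M -> continuous s -> continuous s' ->
  (forall x, is_derive x 1 s (s' x)) -> (forall x, xl <= x <= xr -> c <= s x) ->
  xl <= a1 -> a1 + w <= xr -> xl <= a2 -> a2 + w <= xr ->
  yl <= c1 -> c1 + w <= yr -> yl <= c2 -> c2 + w <= yr ->
  exists2 de, 0 < de & forall (u ux uy f : R * R -> R) (D : set (R * R)),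
    C1 u ux uy -> continuous f ->
    (forall p, D p -> u p = f p) -> (forall p, ~ D p -> u p = 0) ->
    (forall x y, a1 <= x <= a1 + w -> c1 <= y <= c1 + w -> D (x, y)) ->
    (forall x y, a2 <= x <= a2 + w -> c2 <= y <= c2 + w -> ~ D (x, y)) ->
    boxint xl xr yl yr (fun p => u p ^+ 2) <= M ->
    boxint xl xr yl yr (fun p => ux p ^+ 2) <= M ->
    boxint xl xr yl yr (fun p => uy p ^+ 2) <= M ->
    de <= boxint xl xr yl yr (fun p => (f p - s p.1) ^+ 2).
Proof.
move=> w0 c0 M0 cs cs' ds sc xa1 ax1 xa2 ax2 yc1 cy1 yc2 cy2.
have pi0 := pi_gt0 R.
have w00 := ltW w0.
(* The multiplier [q] below is equal to [1 / s] on the rectangle. *)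
pose sh := lift_pos c s.
pose sh' x := s' x + (2 * c)^-1 * (- s' x * (c - s x + `|c - s x|)).
have dsh x : is_derive x 1 sh (sh' x).
  have d1 : is_derive x 1 (fun x => c - s x) (- s' x).
    by apply: (isd_eq (isd_add (isd_cst c x) (isd_opp (ds x)))); ring.
  exact: (isd_add (ds x) (isd_scale (2 * c)^-1 (isd_comp d1 (pos2_derive _)))).
have sh_ge x : c / 2 <= sh x by exact: lift_pos_ge.
have sh0 x : 0 < sh x by apply: lt_le_trans (sh_ge x); rewrite divr_gt0.
have csh : continuous sh by move=> x; exact: is_derive_continuous (dsh x).
have csh' : continuous sh' by rewrite /sh'; cont.
pose q x := (sh x)^-1.
pose q' x := - (sh' x * (sh x ^+ 2)^-1).
have dq x : is_derive x 1 q (q' x) by exact: (isd_inv (lt0r_neq0 (sh0 x)) (dsh x)).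
have cq : continuous q by apply: ct_inv => // x; exact: lt0r_neq0.
have cq' : continuous q'.
  apply: ct_opp; apply: (ct_mul csh'); apply: ct_inv; last by cont.
  by move=> x; apply: lt0r_neq0; exact: exprn_gt0.
pose Q := 2 / c.
have Q0 : 0 < Q by rewrite divr_gt0.
have qQ x : 0 < q x <= Q.
  rewrite /q invr_gt0 sh0 /= /Q -[leRHS]invrK lef_pV2 ?posrE ?invr_gt0//.
  by rewrite invf_div.
have [Q' [Q'0 HQ']] : exists Q', 0 <= Q' /\ forall x, xl <= x <= xr -> `|q' x| <= Q'.
  have cq2 : continuous (fun p : R * R => q' p.1) by apply: (ct_comp cq'); exact: (@ct_fst R).
  have [B [B0 HB]] := box_bounded xl xr 0 0 cq2.
  by exists B; split=> // x xs; apply: (HB x 0 xs); rewrite lexx.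
pose H := 2 * (Q ^+ 2 + Q' ^+ 2) * M.
have H0 : 0 <= H by rewrite /H !mulr_ge0// addr_ge0// sqr_ge0.
pose L := pi ^+ 2 * Q.
have L0 : 0 < L by rewrite mulr_gt0// exprn_gt0.
(* Then [w * L * eta * H] is at most half of [2 * w ^+ 2], the variation of
   the integral of [P] from one square to the other. *)
pose eta := w / (L * (H + 1)).
have H1 : 0 < H + 1 by lra.
have eta0 : 0 < eta by rewrite divr_gt0// mulr_gt0.
pose T := pi ^+ 2 / 2 * Q ^+ 2 + w * L * eta^-1.
have T0 : 0 < T.
  apply: addr_gt0; first by rewrite !mulr_gt0 ?exprn_gt0 ?invr_gt0.
  by rewrite !mulr_gt0// invr_gt0.
exists (w ^+ 2 / T); first by rewrite divr_gt0// exprn_gt0.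
move=> u ux uy f D [cu cux cuy dux duy] cf uD uN B1 B2 Mu Mux Muy.
rewrite ler_pdivrMr//.
have cs2 : continuous (fun p : R * R => s p.1) by exact: (ct_comp cs (@ct_fst R)).
have cq2 : continuous (fun p : R * R => q p.1) by exact: (ct_comp cq (@ct_fst R)).
have cq2' : continuous (fun p : R * R => q' p.1) by exact: (ct_comp cq' (@ct_fst R)).
pose h p := u p * q p.1.
pose hx p := ux p * q p.1 + u p * q' p.1.
pose hy p := uy p * q p.1.
have ch : continuous h by exact: (ct_mul cu cq2).
have chx : continuous hx by exact: (ct_add (ct_mul cux cq2) (ct_mul cu cq2')).
have chy : continuous hy by exact: (ct_mul cuy cq2).
pose P p := cos (pi * h p).
pose Px p := pi * hx p * - sin (pi * h p).
pose Py p := pi * hy p * - sin (pi * h p).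
have cP : continuous P by rewrite /P; cont.
have cPx : continuous Px by rewrite /Px; cont.
have cPy : continuous Py by rewrite /Py; cont.
have dPx x y : is_derive x 1 (fun x => P (x, y)) (Px (x, y)).
  exact: (isd_cos (isd_scale pi (isd_mul (dux x y) (dq x)))).
have dPy x y : is_derive y 1 (fun y => P (x, y)) (Py (x, y)).
  apply: (isd_eq (isd_cos (isd_scale pi (isd_mul (duy x y) (isd_cst (q x) y))))).
  by rewrite /Py /hy /h /=; ring.
have hD p : D p -> xl <= p.1 <= xr -> `|h p - 1| <= Q * `|f p - s p.1|.
  move=> Dp xs; have sx := sc _ xs.
  have s0 : 0 < s p.1 by apply: lt_le_trans sx.
  have -> : h p - 1 = q p.1 * (f p - s p.1).
    rewrite /h uD// /q /sh lift_pos_eq//; field; exact: lt0r_neq0.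
  by rewrite normrM; have /andP[q0 qle] := qQ p.1; rewrite (gtr0_norm q0) ler_wpM2r.
have sinB p : xl <= p.1 <= xr -> `|sin (pi * h p)| <= pi * Q * `|f p - s p.1|.
  move=> xs; case: (pselect (D p)) => Dp.
    have -> : pi * h p = pi * (h p - 1) + pi by ring.
    rewrite sinDpi normrN (le_trans (abs_sin_le _))// normrM (gtr0_norm pi0) -mulrA.
    by apply: ler_wpM2l; [exact: ltW|exact: hD].
  rewrite /h uN// mul0r mulr0 sin0 normr0.
  by apply: mulr_ge0 => //; apply: mulr_ge0; exact: ltW.
pose E := boxint xl xr yl yr (fun p => (f p - s p.1) ^+ 2).
have cE : continuous (fun p => (f p - s p.1) ^+ 2) by exact: (ct_exp (ct_add cf (ct_opp cs2))).
have E0 : 0 <= E by apply: boxint_ge0 => x y _ _; exact: sqr_ge0.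
have grad (g : R * R -> R) : continuous g -> boxint xl xr yl yr (fun p => g p ^+ 2) <= H ->
    boxint xl xr yl yr (fun p => `|pi * g p * - sin (pi * h p)|) <= L / 2 * (eta^-1 * E + eta * H).
  move=> cg gH.
  have cg2 : continuous (fun p => g p ^+ 2) by cont.
  apply: (@le_trans _ _ (boxint xl xr yl yr
    (fun p => L / 2 * (eta^-1 * (f p - s p.1) ^+ 2 + eta * g p ^+ 2)))).
    apply: le_boxint; [by cont| |].
      exact: (ct_mul (@ct_cst _ _ _) (ct_add (ct_mul (@ct_cst _ _ _) cE) (ct_mul (@ct_cst _ _ _) cg2))).
    move=> x y xs ys; rewrite normrM normrN normrM (gtr0_norm pi0).
    have Y := young_abs (f (x, y) - s x) (g (x, y)) eta0.
    have S := sinB (x, y) xs.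
    apply: (@le_trans _ _ (pi * `|g (x, y)| * (pi * Q * `|f (x, y) - s x|))).
      by apply: ler_wpM2l => //; rewrite mulr_ge0// ltW.
    have -> : pi * `|g (x, y)| * (pi * Q * `|f (x, y) - s x|) =
        L * (`|f (x, y) - s x| * `|g (x, y)|) by rewrite /L; ring.
    rewrite [leRHS](_ : _ = L * ((eta^-1 * (f (x, y) - s x) ^+ 2 + eta * g (x, y) ^+ 2) / 2)) /=.
      by apply: ler_wpM2l; [exact: ltW|exact: Y].
    by ring.
  rewrite boxintZ; last first.
    exact: (ct_add (ct_mul (@ct_cst _ _ _) cE) (ct_mul (@ct_cst _ _ _) cg2)).
  apply: ler_wpM2l; first by rewrite divr_ge0// ltW.
  rewrite boxintD; [|exact: (ct_mul (@ct_cst _ _ _) cE)|exact: (ct_mul (@ct_cst _ _ _) cg2)].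
  rewrite (boxintZ eta^-1 _ _ _ _ cE) (boxintZ eta _ _ _ _ cg2) lerD2l.
  by apply: ler_wpM2l => //; exact: ltW.
have Q2M : Q ^+ 2 * M <= H /\ 2 * (Q ^+ 2 * M + Q' ^+ 2 * M) <= H.
  have a0 : 0 <= Q ^+ 2 * M by rewrite mulr_ge0// sqr_ge0.
  have a1' : 0 <= Q' ^+ 2 * M by rewrite mulr_ge0// sqr_ge0.
  have HE : H = 2 * (Q ^+ 2 * M + Q' ^+ 2 * M) by rewrite /H; ring.
  rewrite HE; split=> //.
  by move: a0 a1'; move: (Q ^+ 2 * M) (Q' ^+ 2 * M) => A B; clear; lra.
have qsq x : q x ^+ 2 <= Q ^+ 2.
  by have /andP[l r] := qQ x; apply: lerXn2r; rewrite ?nnegrE// ltW.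
have c2u : continuous (fun p => u p ^+ 2) by cont.
have c2ux : continuous (fun p => ux p ^+ 2) by cont.
have c2uy : continuous (fun p => uy p ^+ 2) by cont.
have Hhy : boxint xl xr yl yr (fun p => hy p ^+ 2) <= H.
  apply: (@le_trans _ _ (Q ^+ 2 * M)); last by case: Q2M.
  apply: (@le_trans _ _ (boxint xl xr yl yr (fun p => Q ^+ 2 * uy p ^+ 2))).
    apply: le_boxint; [exact: (ct_exp chy)|exact: (ct_mul (@ct_cst _ _ _) c2uy)|].
    by move=> x y _ _; rewrite /hy exprMn mulrC ler_wpM2r// sqr_ge0.
  by rewrite boxintZ//; apply: ler_wpM2l => //; exact: sqr_ge0.
have Hhx : boxint xl xr yl yr (fun p => hx p ^+ 2) <= H.
  apply: (@le_trans _ _ (2 * (Q ^+ 2 * M + Q' ^+ 2 * M))); last by case: Q2M.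
  apply: (@le_trans _ _ (boxint xl xr yl yr (fun p => 2 * (Q ^+ 2 * ux p ^+ 2 + Q' ^+ 2 * u p ^+ 2)))).
    apply: le_boxint; [exact: (ct_exp chx)| |].
      exact: (ct_mul (@ct_cst _ _ _) (ct_add (ct_mul (@ct_cst _ _ _) c2ux) (ct_mul (@ct_cst _ _ _) c2u))).
    move=> x y xs _; rewrite /hx /=.
    have e1 : (ux (x, y) * q x) ^+ 2 <= Q ^+ 2 * ux (x, y) ^+ 2.
      by rewrite exprMn mulrC ler_wpM2r// sqr_ge0.
    have e2 : (u (x, y) * q' x) ^+ 2 <= Q' ^+ 2 * u (x, y) ^+ 2.
      rewrite exprMn mulrC ler_wpM2r ?sqr_ge0// -[leLHS](real_normK (num_real _)).
      by apply: lerXn2r; rewrite ?nnegrE//; exact: HQ'.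
    by apply: le_trans (sqr_add_le _ _) _; apply: ler_wpM2l => //; exact: lerD.
  rewrite boxintZ; last exact: (ct_add (ct_mul (@ct_cst _ _ _) c2ux) (ct_mul (@ct_cst _ _ _) c2u)).
  rewrite boxintD; [|exact: (ct_mul (@ct_cst _ _ _) c2ux)|exact: (ct_mul (@ct_cst _ _ _) c2u)].
  rewrite (boxintZ _ _ _ _ _ c2ux) (boxintZ _ _ _ _ _ c2u).
  have A1 := ler_wpM2l (sqr_ge0 Q) Mux; have A2 := ler_wpM2l (sqr_ge0 Q') Mu.
  exact: (ler_wpM2l (ler0n R 2) (lerD A1 A2)).
have Gx := grad hx chx Hhx; have Gy := grad hy chy Hhy.
have cnx : continuous (fun p => `|Px p|) by cont.
have cny : continuous (fun p => `|Py p|) by cont.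
have mx := @window_shift_x P Px xl xr a1 a2 w c1 (c1 + w) w00 cP cPx dPx xa1 ax1 xa2 ax2.
have my := @window_shift_y P Py yl yr c1 c2 w a2 (a2 + w) w00 cP cPy dPy yc1 cy1 yc2 cy2.
have aw a : a <= a + w by rewrite lerDl.
have sx : boxint xl xr c1 (c1 + w) (fun p => `|Px p|) <= boxint xl xr yl yr (fun p => `|Px p|).
  by apply: (boxint_sub cnx) => //; rewrite (le_trans xa1)// (le_trans (aw a1)).
have sy : boxint a2 (a2 + w) yl yr (fun p => `|Py p|) <= boxint xl xr yl yr (fun p => `|Py p|).
  by apply: (boxint_sub cny) => //; rewrite (le_trans yc1)// (le_trans (aw c1)).
have RIIc (r a d : R) : boxint a (a + w) d (d + w) (fun=> r) = r * w * w.
  rewrite /boxint (@eq_segint _ _ (fun=> r * w)); last by move=> x _; rewrite segint_cst// addrC addKr.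
  by rewrite segint_cst// [a + w]addrC addrK.
have I2 : boxint a2 (a2 + w) c2 (c2 + w) P = w * w.
  rewrite -[RHS](mul1r) mulrA -(RIIc 1 a2 c2); apply: eq_boxint => x y xs ys.
  by rewrite /P /h (uN _ (B2 x y xs ys)) mul0r mulr0 cos0.
have I1 : boxint a1 (a1 + w) c1 (c1 + w) P <= pi ^+ 2 / 2 * Q ^+ 2 * E - w * w.
  apply: (@le_trans _ _ (boxint a1 (a1 + w) c1 (c1 + w)
     (fun p => pi ^+ 2 / 2 * Q ^+ 2 * (f p - s p.1) ^+ 2 - 1))).
    apply: le_boxint; [exact: cP| |].
      exact: (ct_add (ct_mul (@ct_cst _ _ _) cE) (ct_opp (@ct_cst _ _ 1))).
    move=> x y xs ys; rewrite /P.
    have xs' : xl <= x <= xr.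
      by case/andP: xs => l r; rewrite (le_trans xa1 l) (le_trans r ax1).
    have := hD (x, y) (B1 x y xs ys) xs'; rewrite /= => hh.
    have -> : pi * h (x, y) = pi * (h (x, y) - 1) + pi by ring.
    rewrite cosDpi; have := cos_lower (pi * (h (x, y) - 1)).
    have : (h (x, y) - 1) ^+ 2 <= Q ^+ 2 * (f (x, y) - s x) ^+ 2.
      rewrite -[leLHS](real_normK (num_real _)) -[(f _ - _) ^+ 2](real_normK (num_real _)) -exprMn.
      by apply: lerXn2r; rewrite ?nnegrE// mulr_ge0// ltW.
    move=> h1 h2.
    have h3 : pi ^+ 2 / 2 * (h (x, y) - 1) ^+ 2 <= pi ^+ 2 / 2 * (Q ^+ 2 * (f (x, y) - s x) ^+ 2).
      by apply: ler_wpM2l => //; rewrite divr_ge0// sqr_ge0.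
    rewrite lerNl opprB -[pi ^+ 2 / 2 * _ * _]mulrA; apply: le_trans h2.
    by rewrite lerD2l lerN2 exprMn mulrAC.
  rewrite boxintB; [|exact: (ct_mul (@ct_cst _ _ _) cE)|exact: ct_cst].
  rewrite (boxintZ _ _ _ _ _ cE) RIIc mul1r lerD2r; apply: ler_wpM2l.
    by rewrite mulr_ge0 ?sqr_ge0// divr_ge0// sqr_ge0.
  by apply: (boxint_sub cE) => // x y _ _; exact: sqr_ge0.
have etaH : w * L * eta * H <= w ^+ 2.
  have -> : w * L * eta * H = w ^+ 2 * (H / (H + 1)).
    by rewrite /eta; field; rewrite (gt_eqF H1) (gt_eqF L0).
  by rewrite ler_piMr ?sqr_ge0// ler_pdivrMr// mul1r lerDl.
have WX : w * boxint xl xr c1 (c1 + w) (fun p => `|Px p|) <= w * (L / 2 * (eta^-1 * E + eta * H)).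
  exact: (ler_wpM2l w00 (le_trans sx Gx)).
have WY : w * boxint a2 (a2 + w) yl yr (fun p => `|Py p|) <= w * (L / 2 * (eta^-1 * E + eta * H)).
  exact: (ler_wpM2l w00 (le_trans sy Gy)).
exact: (squares_balance mx my I2 I1 WX WY etaH).
Qed.

End TwoSquares.

(** * Limiting profile of minimal partitions *)

Section Normalization.
Context {R : realType}.
Implicit Types (x y z r : R) (u ux uy G : R * R -> R).

Lemma C1_scale r u ux uy : C1 u ux uy ->
  C1 (fun p => r * u p) (fun p => r * ux p) (fun p => r * uy p).
Proof.
move=> [c1 c2 c3 d1 d2]; split.
- exact: (ct_mul (@ct_cst _ _ r) c1).
- exact: (ct_mul (@ct_cst _ _ r) c2).
- exact: (ct_mul (@ct_cst _ _ r) c3).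
- by move=> x y; exact: (isd_scale r (d1 x y)).
- by move=> x y; exact: (isd_scale r (d2 x y)).
Qed.

Lemma boxint_window x0 c d G : continuous G -> (forall x y, G (x + 1, y) = G (x, y)) ->
  boxint x0 (x0 + 1) c d G = boxint 0 1 c d G.
Proof.
move=> cG pG; apply: (segint_periodic x0 ler01 (ct_segint cG)) => x.
by apply: eq_segint => y _; exact: pG.
Qed.

Lemma sin_lipschitz x y : (sin x - sin y) ^+ 2 <= (x - y) ^+ 2.
Proof.
have -> : sin x - sin y = 2 * (cos ((x + y) / 2) * sin ((x - y) / 2)).
  have {1}-> : x = (x + y) / 2 + (x - y) / 2 by field.
  have {3}-> : y = (x + y) / 2 - (x - y) / 2 by field.
  by rewrite sinD sinB; ring.
have -> : (x - y) ^+ 2 = 2 ^+ 2 * ((x - y) / 2) ^+ 2 by field.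
rewrite !exprMn ler_pM2l ?exprn_gt0//.
have h : sin ((x - y) / 2) ^+ 2 <= ((x - y) / 2) ^+ 2.
  rewrite -[leLHS](real_normK (num_real _)) -[leRHS](real_normK (num_real _)).
  by apply: lerXn2r; rewrite ?nnegrE//; exact: abs_sin_le.
rewrite exprMn in h.
by apply: le_trans h; rewrite ler_piMl ?sqr_ge0.
Qed.

End Normalization.

Section Normalized.
Context {R : realType} (b : R).
Hypothesis b0 : 0 < b.
Local Notation pr := (@torus_pi R 1 b).
Variables (n : nat).
Local Notation k := n.+1.
Local Notation om := (k%:R * pi : R).
Local Notation M := (4 * b * (om ^+ 2 + 1)).
Implicit Types (D : 'I_k -> set (torus 1 b)) (x y r : R).

(** Dividing by [al] requires a lower bound: the combination of normalized tests
    has norm [1], so it cannot be close to a small multiple of the sine. Moving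
    the origin from [x1] to [x0] costs an error proportional to [eta]. *)
Lemma normalized_tests D (e : 'I_k -> R -> R) (f : 'I_k -> torus 1 b -> R) (c : 'I_k -> R)
    (al x0 x1 ep eta : R) :
  (forall i j, i != j -> D i `&` D j = set0) ->
  (forall j x, e j x ^+ 2 = 1) ->
  (forall j x, e j (x + 1) = (-1) ^+ k * e j x) ->
  (forall j f, test_function (D j) f ->
      C1 (fun p => e j p.1 * f (pr p)) (fun p => e j p.1 * dx f p) (fun p => e j p.1 * dy f p)) ->
  (forall j, [/\ test_function (D j) (f j), 0 < sqnorm (f j) & dirichlet (f j) <= (om ^+ 2 + 1) * sqnorm (f j)]) ->
  \sum_j c j ^+ 2 = 1 ->
  boxint 0 1 0 b (fun p => (\sum_j c j * ((Num.sqrt (sqnorm (f j)))^-1 * (e j p.1 * f j (pr p)))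
      - al * sin (om * (p.1 - x1))) ^+ 2) <= ep ->
  ep <= 1 / 4 -> `|x1 - x0| <= eta ->
  exists u ux uy : 'I_k -> R * R -> R,
  [/\ forall j, C1 (u j) (ux j) (uy j), forall j p, ~ D j (pr p) -> u j p = 0,
      forall j x y, u j (x + 1, y) = (-1) ^+ k * u j (x, y),
      forall j, [/\ boxint 0 1 0 b (fun p => u j p ^+ 2) <= M,
        boxint 0 1 0 b (fun p => ux j p ^+ 2) <= M & boxint 0 1 0 b (fun p => uy j p ^+ 2) <= M] &
      boxint 0 1 0 b (fun p => (\sum_j u j p - sin (om * (p.1 - x0))) ^+ 2)
        <= 8 * b * ep + 2 * b * (om * eta) ^+ 2].
Proof.
move=> DD e2 eS eC Hf c1 S ep4 xx.
have om0 : 0 < om by rewrite mulr_gt0 ?ltr0n// pi_gt0.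
have tf j : test_function (D j) (f j) by have [] := Hf j.
have Nf j : 0 < sqnorm (f j) by have [] := Hf j.
pose r j := (Num.sqrt (sqnorm (f j)))^-1.
have r2 j : r j ^+ 2 = (sqnorm (f j))^-1 by rewrite /r exprVn sqr_sqrtr// ltW.
pose v j p := r j * (e j p.1 * f j (pr p)).
pose vx j p := r j * (e j p.1 * dx (f j) p).
pose vy j p := r j * (e j p.1 * dy (f j) p).
have Cv j : C1 (v j) (vx j) (vy j) by exact: (C1_scale (r j) (eC j _ (tf j))).
have cv j : continuous (v j) by have [? _ _ _ _] := Cv j.
have cvx j : continuous (vx j) by have [_ ? _ _ _] := Cv j.
have cvy j : continuous (vy j) by have [_ _ ? _ _] := Cv j.
have vS j x y : v j (x + 1, y) = (-1) ^+ k * v j (x, y) by rewrite /v /= pr_per1 eS; ring.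
have v0 j p : ~ D j (pr p) -> v j p = 0.
  by move=> nD; have [z _ _] := test_zero (tf j) nD; rewrite /v z !mulr0.
have vv i j p : i != j -> v i p * v j p = 0.
  move=> ij; have [nD|nD] : ~ D i (pr p) \/ ~ D j (pr p).
    apply/not_andP => -[Di Dj].
    have : (D i `&` D j) (pr p) by split.
    by rewrite DD.
  - by rewrite (v0 i _ nD) mul0r.
  - by rewrite (v0 j _ nD) mulr0.
have mass j : boxint 0 1 0 b (fun p => v j p ^+ 2) = 1.
  have [cf _ _ _ _] := test_C1 (tf j).
  transitivity (boxint 0 1 0 b (fun p => r j ^+ 2 * f j (pr p) ^+ 2)).
    by apply: eq_boxint => x y _ _; rewrite /v /= !exprMn e2 mul1r.
  by rewrite (boxintZ _ _ _ _ _ (ct_exp cf)) -/(sqnorm (f j)) r2 mulVf// gt_eqF.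
have energy_v j : boxint 0 1 0 b (fun p => vx j p ^+ 2) <= om ^+ 2 + 1 /\
    boxint 0 1 0 b (fun p => vy j p ^+ 2) <= om ^+ 2 + 1.
  have [_ cfx cfy _ _] := test_C1 (tf j).
  have : r j ^+ 2 * dirichlet (f j) <= om ^+ 2 + 1.
    by have [_ _ Ef] := Hf j; rewrite r2 mulrC ler_pdivrMr.
  have c2 := ct_add (ct_exp (n:=2) cfx) (ct_exp (n:=2) cfy).
  rewrite /dirichlet -(boxintZ (r j ^+ 2) 0 1 0 b c2) => Er.
  split; apply: le_trans Er; apply: le_boxint.
  - exact: (ct_exp (cvx j)).
  - exact: (ct_mul (@ct_cst _ _ _) c2).
  - move=> x y _ _; rewrite /vx /= !exprMn e2 mul1r ler_wpM2l ?sqr_ge0//.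
    by rewrite lerDl sqr_ge0.
  - exact: (ct_exp (cvy j)).
  - exact: (ct_mul (@ct_cst _ _ _) c2).
  - move=> x y _ _; rewrite /vy /= !exprMn e2 mul1r ler_wpM2l ?sqr_ge0//.
    by rewrite lerDr sqr_ge0.
pose g p := \sum_j c j * v j p.
pose s x (p : R * R) := sin (om * (p.1 - x)).
have cg : continuous g by apply: ct_sum => j; exact: (ct_mul (@ct_cst _ _ _) (cv j)).
have cs x : continuous (fun p : R * R => s x p) by rewrite /s; cont.
have mg : boxint 0 1 0 b (fun p => g p ^+ 2) = 1.
  have cvj j : continuous (fun p : R * R => c j ^+ 2 * v j p ^+ 2).
    exact: (ct_mul (@ct_cst R _ (c j ^+ 2)) (ct_exp (n:=2) (cv j))).
  transitivity (boxint 0 1 0 b (fun p => \sum_j c j ^+ 2 * v j p ^+ 2)).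
    by apply: eq_boxint => x y _ _; rewrite /g sqr_sum_orth// => i j; exact: vv.
  rewrite boxint_sum// -[RHS]c1; apply: eq_bigr => j _.
  transitivity (c j ^+ 2 * boxint 0 1 0 b (fun p => v j p ^+ 2)); last by rewrite mass mulr1.
  exact: (boxintZ (c j ^+ 2) 0 1 0 b (ct_exp (n:=2) (cv j))).
have cga : continuous (fun p : R * R => (g p - al * s x1 p) ^+ 2).
  exact: (ct_exp (ct_add cg (ct_opp (ct_mul (@ct_cst _ _ al) (cs x1))))).
have RIIc (d : R) : boxint 0 1 0 b (fun=> d) = d * b.
  rewrite /boxint (@eq_segint _ _ (fun=> d * b)); last by move=> x _; rewrite segint_cst ?subr0// ltW.
  by rewrite segint_cst// subr0 mulr1.
have al4 : 1 <= 4 * b * al ^+ 2.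
  have : boxint 0 1 0 b (fun p => g p ^+ 2) <=
      boxint 0 1 0 b (fun p => 2 * (g p - al * s x1 p) ^+ 2 + 2 * al ^+ 2).
    apply: le_boxint; [exact: (ct_exp cg)| |].
      exact: (ct_add (ct_mul (@ct_cst _ _ 2) cga) (@ct_cst _ _ _)).
    move=> x y _ _; have := sqr_add_le (g (x, y) - al * s x1 (x, y)) (al * s x1 (x, y)).
    rewrite subrK mulrDr => /le_trans; apply; rewrite lerD2l ler_pM2l// exprMn.
    rewrite ler_piMr ?sqr_ge0// /s /=.
    by rewrite -[leRHS](cos2Dsin2 (om * (x - x1))) lerDr sqr_ge0.
  rewrite mg boxintD; [|exact: (ct_mul (@ct_cst _ _ 2) cga)|exact: ct_cst].
  rewrite (boxintZ _ _ _ _ _ cga) RIIc => h.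
  move: S h; rewrite -/(boxint 0 1 0 b (fun p => (g p - al * s x1 p) ^+ 2)).
  move: (boxint 0 1 0 b _) => I; move: (al ^+ 2) => A S h.
  have -> : 4 * b * A = 2 * (2 * A * b) by ring.
  by move: S h ep4; set B := 2 * A * b; clear; lra.
have al0 : 0 < al ^+ 2.
  rewrite lt_neqAle sqr_ge0 andbT eq_sym; apply/negP => /eqP E.
  by move: al4; rewrite E mulr0 ler10.
have ane : al != 0 by move: al0; rewrite exprn_even_gt0.
have alV : (al^-1) ^+ 2 <= 4 * b by rewrite exprVn -div1r ler_pdivrMr.
pose q j := al^-1 * c j.
have q4 j : q j ^+ 2 <= 4 * b.
  rewrite /q exprMn -[leRHS]mulr1; apply: ler_pM; rewrite ?sqr_ge0//.
  by rewrite -c1 (bigD1 j)//= lerDl; apply: sumr_ge0 => i _; exact: sqr_ge0.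
have scaled j (w : 'I_k -> R * R -> R) : continuous (w j) ->
    boxint 0 1 0 b (fun p => w j p ^+ 2) <= om ^+ 2 + 1 ->
    boxint 0 1 0 b (fun p => (q j * w j p) ^+ 2) <= M.
  move=> cw hw.
  have -> : boxint 0 1 0 b (fun p => (q j * w j p) ^+ 2) =
      q j ^+ 2 * boxint 0 1 0 b (fun p => w j p ^+ 2).
    rewrite -(boxintZ _ _ _ _ _ (ct_exp cw)).
    by apply: eq_boxint => x y _ _; rewrite exprMn.
  apply: ler_pM (q4 j) hw; first exact: sqr_ge0.
  by apply: boxint_ge0 => x y _ _; exact: sqr_ge0.
exists (fun j p => q j * v j p), (fun j p => q j * vx j p), (fun j p => q j * vy j p); split.
- by move=> j; exact: C1_scale.
- by move=> j p nD; rewrite v0 ?mulr0.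
- by move=> j x y; rewrite vS mulrCA.
- move=> j; have [h1 h2] := energy_v j; split.
  + by apply: (scaled j v (cv j)); rewrite mass lerDr sqr_ge0.
  + exact: (scaled j vx (cvx j) h1).
  + exact: (scaled j vy (cvy j) h2).
have cS : continuous (fun p : R * R => \sum_j q j * v j p - s x0 p).
  apply: (ct_add _ (ct_opp (cs x0))).
  by apply: ct_sum => j; exact: (ct_mul (@ct_cst _ _ _) (cv j)).
apply: (@le_trans _ _ (boxint 0 1 0 b (fun p => 8 * b * (g p - al * s x1 p) ^+ 2 +
   2 * (om * eta) ^+ 2))).
  apply: le_boxint; [exact: (ct_exp cS)| |].
    exact: (ct_add (ct_mul (@ct_cst _ _ _) cga) (@ct_cst _ _ _)).
  move=> x y _ _.
  have -> : \sum_j q j * v j (x, y) = al^-1 * g (x, y).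
    by rewrite /g mulr_sumr; apply: eq_bigr => j _; rewrite [RHS](mulrA al^-1).
  rewrite -/(s x0 (x, y)).
  have -> : al^-1 * g (x, y) - s x0 (x, y) =
    al^-1 * (g (x, y) - al * s x1 (x, y)) + (s x1 (x, y) - s x0 (x, y)).
    by field.
  apply: (le_trans (sqr_add_le _ _)); rewrite mulrDr; apply: lerD.
    have -> : 8 * b * (g (x, y) - al * s x1 (x, y)) ^+ 2 =
      2 * (4 * b * (g (x, y) - al * s x1 (x, y)) ^+ 2) by ring.
    rewrite exprMn; apply: (ler_wpM2l (ler0n R 2)).
    exact: (ler_wpM2r (sqr_ge0 _) alV).
  rewrite ler_pM2l//; apply: (le_trans (sin_lipschitz _ _)).
  have -> : om * ((x, y).1 - x1) - om * ((x, y).1 - x0) = om * - (x1 - x0) by rewrite /=; ring.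
  rewrite [leLHS](exprMn _ om) [leRHS](exprMn _ om); apply: (ler_wpM2l (sqr_ge0 om)).
  rewrite -[leLHS](real_normK (num_real _)) normrN.
  by apply: lerXn2r; rewrite ?nnegrE//; exact: le_trans (normr_ge0 _) xx.
rewrite boxintD; [|exact: (ct_mul (@ct_cst _ _ _) cga)|exact: ct_cst].
rewrite (boxintZ _ _ _ _ _ cga) RIIc; apply: lerD.
  by apply: ler_wpM2l S; rewrite mulr_ge0// ltW.
by rewrite le_eqVlt mulrAC eqxx.
Qed.

End Normalized.

Section Profile.
Context {R : realType} (b : R).
Hypothesis b0 : 0 < b.
Local Notation pr := (@torus_pi R 1 b).
Variables (n : nat) (th : R).
Hypothesis n0 : (0 < n)%N.
Local Notation k := n.+1.
Local Notation om := (k%:R * pi : R).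
Hypothesis omth : om < th.
Hypothesis thb2 : th * b < 2 * pi.
Hypothesis thb1 : odd k -> th * b < pi.
Local Notation M := (4 * b * (om ^+ 2 + 1)).
Implicit Types (D : 'I_k -> set (torus 1 b)) (x y r : R).

Let om0 : 0 < om. Proof. by rewrite mulr_gt0 ?ltr0n// pi_gt0. Qed.

(** For each error [d] the stability inequality provides an origin between [0] and
    [1]; [x0] is a cluster point of these origins as [d] tends to [0]. *)
Lemma limiting_profile D : is_partition D -> energy D = (om ^+ 2)%:E ->
  exists x0, forall ep, 0 < ep -> exists u ux uy : 'I_k -> R * R -> R,
  [/\ forall j, C1 (u j) (ux j) (uy j), forall j p, ~ D j (pr p) -> u j p = 0,
      forall j, [/\ boxint x0 (x0 + 1) 0 b (fun p => u j p ^+ 2) <= M,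
        boxint x0 (x0 + 1) 0 b (fun p => ux j p ^+ 2) <= M &
        boxint x0 (x0 + 1) 0 b (fun p => uy j p ^+ 2) <= M] &
      boxint x0 (x0 + 1) 0 b (fun p => (\sum_j u j p - sin (om * (p.1 - x0))) ^+ 2) <= ep].
Proof.
move=> [_ DD] ED.
have tests e : 0 < e -> forall j, exists f,
    [/\ test_function (D j) f, 0 < sqnorm f & dirichlet f <= (om ^+ 2 + e) * sqnorm f].
  by move=> e0; apply: energy_tests => //; rewrite ED.
have circ : odd k -> forall j, exists xi, forall y, D j (pr (xi, y)).
  pose e := (th ^+ 2 - om ^+ 2) / 2.
  have lt2 := om_lt_th omth.
  have e0 : 0 < e by rewrite /e; lra.
  have me : om ^+ 2 + e < th ^+ 2 by rewrite /e; lra.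
  exact: (low_energy_circles b0 omth thb1 me (tests e e0)).
have [sg [sg2 sgS sgC stab]] := partition_stability b0 n0 omth thb2 DD circ.
have K0 := stab_cst_gt0 (isT : (0 < k)%N) omth.
set K := stab_cst _ _ in stab K0.
pose P (d x : R) := 0 <= x <= 1 /\ exists (f : 'I_k -> torus 1 b -> R) (c : 'I_k -> R) (al : R),
  [/\ forall j, [/\ test_function (D j) (f j), 0 < sqnorm (f j) & dirichlet (f j) <= (om ^+ 2 + 1) * sqnorm (f j)],
      \sum_j c j ^+ 2 = 1 &
      boxint 0 1 0 b (fun p => (\sum_j c j * ((Num.sqrt (sqnorm (f j)))^-1 * (sg j p.1 * f j (pr p)))
      - al * sin (om * (p.1 - x))) ^+ 2) <= d].
have exP d : 0 < d -> exists x, P d x.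
  move=> d0; pose e := Num.min 1 (K * d).
  have e0 : 0 < e by rewrite lt_min ltr01 mulr_gt0.
  have e1 : e <= 1 by rewrite ge_min lexx.
  have eK : e <= K * d by rewrite ge_min lexx orbT.
  have [f Hf] := choice (tests e e0).
  have tf j : test_function (D j) (f j) by have [] := Hf j.
  have Nf j : 0 < sqnorm (f j) by have [] := Hf j.
  have [x [c [al [x01 c1 S]]]] := stab f tf Nf.
  exists x; split=> //; exists f, c, al; split=> //.
    move=> j; have [h1 h2 h3] := Hf j; split=> //; apply: (le_trans h3).
    by apply: ler_wpM2r; [exact: ltW|rewrite lerD2l].
  rewrite -(ler_pM2l K0); apply: le_trans eK; apply: (le_trans S).
  rewrite -[leRHS]mul1r -[in leRHS]c1 mulr_suml; apply: ler_sum => j _.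
  apply: ler_wpM2l; first exact: sqr_ge0.
  by have [_ Nj Ef] := Hf j; rewrite lerBlDl ler_pdivrMr.
have exS (m : nat) : exists x, P m.+1%:R^-1 x by apply: exP; rewrite invr_gt0 ltr0n.
have [xs Hxs] := choice exS.
have [x0 [_ clx0]] : `[0 : R, 1]%classic `&` cluster (xs @ \oo) !=set0.
  have F01 : (xs @ \oo) `[0 : R, 1]%classic.
    by apply: (@filterE _ \oo) => m; rewrite /= in_itv/=; have [] := Hxs m.
  exact: (@segment_compact R 0 1 _ _ F01).
exists x0 => ep ep0.
(* With these values each of the two errors of [normalized_tests] is at most
   [ep / 2]. *)
pose d := Num.min (1 / 4) (ep / (16 * b)).
pose eta := Num.min 1 (ep / (4 * b * om ^+ 2)).
have d0 : 0 < d by rewrite lt_min !divr_gt0// mulr_gt0.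
have Q0 : 0 < 4 * b * om ^+ 2 by apply: mulr_gt0; [exact: mulr_gt0|exact: exprn_gt0].
have eta0 : 0 < eta by rewrite lt_min ltr01 divr_gt0.
have [z [[m /= [dm <-]] zx]] :
    [set xs m | m in [set m | m.+1%:R^-1 < d]] `&` ball x0 eta !=set0.
  apply: clx0; last exact: nbhsx_ballx.
  have N : \forall m \near \oo, m.+1%:R^-1 < d by exact: near_infty_natSinv_lt (PosNum d0).
  by apply: (@filterS _ \oo _ _ _ _ N) => m dm; exists m.
have [x01 [f [c [al [Hf c1 S]]]]] := Hxs m.
have Sd := le_trans S (ltW dm).
have d4 : d <= 1 / 4 by rewrite ge_min lexx.
have xx : `|xs m - x0| <= eta.
  by rewrite distrC; apply: ltW; move: zx; rewrite -ball_normE.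
have [u [ux [uy [Cu u0 uS uM uE]]]] := normalized_tests b0 DD sg2 sgS sgC Hf c1 Sd d4 xx.
have s2 : ((-1) ^+ k * (-1) ^+ k : R) = 1 by rewrite -expr2 sqrr_sign.
have sq r : ((-1) ^+ k * r) ^+ 2 = r ^+ 2 by rewrite exprMn expr2 s2 mul1r.
exists u, ux, uy; split=> //.
  move=> j; have [h1 h2 h3] := uM j.
  have [c2 c3 c4 _ _] := Cu j; have sh := C1_shift (Cu j) (uS j).
  split; rewrite boxint_window//.
  - exact: (ct_exp c2).
  - by move=> x y; rewrite uS sq.
  - exact: (ct_exp c3).
  - by move=> x y; have [-> _] := sh x y; rewrite sq.
  - exact: (ct_exp c4).
  - by move=> x y; have [_ ->] := sh x y; rewrite sq.
rewrite boxint_window.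
- apply: (le_trans uE).
  have dE : 8 * b * d <= ep / 2.
    have : d <= ep / (16 * b) by rewrite ge_min lexx orbT.
    have b16 : 0 < 16 * b by exact: mulr_gt0.
    rewrite (ler_pdivlMr _ _ b16) => h.
    have -> : 8 * b * d = d * (16 * b) / 2 by field.
    by rewrite ler_pM2r ?invr_gt0.
  have etaE : 2 * b * (om * eta) ^+ 2 <= ep / 2.
    have eta1 : eta <= 1 by rewrite ge_min lexx.
    have : eta <= ep / (4 * b * om ^+ 2) by rewrite ge_min lexx orbT.
    rewrite (ler_pdivlMr _ _ Q0) => h.
    have h2 : eta ^+ 2 * (4 * b * om ^+ 2) <= eta * (4 * b * om ^+ 2).
      apply: ler_wpM2r; first exact: ltW.
      by rewrite expr2 ler_piMl// ltW.
    have -> : 2 * b * (om * eta) ^+ 2 = eta ^+ 2 * (4 * b * om ^+ 2) / 2 by field.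
    by rewrite ler_pM2r ?invr_gt0//; exact: le_trans h2 h.
  by rewrite [leRHS]splitr; exact: lerD.
- have cS : continuous (fun p : R * R => \sum_j u j p).
    by apply: ct_sum => j; have [] := Cu j.
  have cs : continuous (fun p : R * R => sin (om * (p.1 - x0))) by cont.
  exact: (ct_exp (ct_add cS (ct_opp cs))).
- move=> x y; rewrite /=.
  have -> : om * (x + 1 - x0) = om * (x - x0) + k%:R * pi by ring.
  rewrite sinDnpi -[RHS]sq (mulrBr ((-1) ^+ k)) mulr_sumr.
  by congr ((_ - _) ^+ 2); apply: eq_bigr => j _; exact: uS.
Qed.

End Profile.

(** * A domain that meets an arc is dense in it *)

Section Rigidity.
Context {R : realType} (b : R).
Hypothesis b0 : 0 < b.
Local Notation pr := (@torus_pi R 1 b).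
Variables (n : nat).
Hypothesis n0 : (0 < n)%N.
Local Notation k := n.+1.
Local Notation om := (k%:R * pi : R).
Implicit Types (D : 'I_k -> set (torus 1 b)) (x y r t : R).

Let kR : 0 < k%:R :> R. Proof. by rewrite ltr0n. Qed.
Let kne : k%:R != 0 :> R. Proof. by rewrite pnatr_eq0. Qed.

(** The second coordinate can be reduced modulo [b], which keeps the square inside
    the window [0 <= y <= b]. *)
Lemma inner_square t (i : 'I_k) (O : set (torus 1 b)) : open O -> O `&` arcs t i !=set0 ->
  exists x y w, [/\ 0 < w, t + i%:R / k%:R < x, x + w < t + i%:R / k%:R + k%:R^-1,
    0 <= y /\ y + w <= b &
    forall x' y', x <= x' <= x + w -> y <= y' <= y + w -> O (pr (x', y'))].
Proof.
move=> oO [q [Oq [p /= /andP[px pX] E]]].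
pose m := Num.floor (p.2 / b).
pose y := p.2 + (- m)%:~R * b.
have Oy : O (pr (p.1, y)).
  by rewrite pr_shift2// -surjective_pairing E.
have /andP[ml mr] := floor_itv (p.2 / b).
have y0 : 0 <= y.
  by move: ml; rewrite -/m ler_pdivlMr// /y intrN; lra.
have yb : y < b.
  by move: mr; rewrite -/m ltr_pdivrMr// /y intrN intrD -[1%:~R]/(1 : R); lra.
have : nbhs (p.1, y) (pr @^-1` O) by apply: open_nbhs_nbhs; split.
move=> /nbhs_ballP[r r0 Hr].
pose X := t + i%:R / k%:R + k%:R^-1.
pose w := Num.min (r / 2) (Num.min ((X - p.1) / 2) (b - y)).
have Xp : 0 < (X - p.1) / 2 by rewrite divr_gt0// subr_gt0.
have w0 : 0 < w by rewrite !lt_min Xp subr_gt0 yb divr_gt0.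
have wr : w <= r / 2 by rewrite ge_min lexx.
have wX : w <= (X - p.1) / 2 by rewrite !ge_min lexx !orbT.
have wb : w <= b - y by rewrite !ge_min lexx !orbT.
exists p.1, y, w; split=> //.
- by rewrite -/X; clearbody w X; lra.
- by split=> //; clearbody w y; lra.
- move=> x' y' /andP[h1 h2] /andP[h3 h4]; apply: (Hr (x', y')); split.
    by rewrite /ball /= ltr_norml; clearbody w; apply/andP; split; lra.
  by rewrite /ball /= ltr_norml; clearbody w; apply/andP; split; lra.
Qed.

Lemma sin_arc_pos t i x : t + i%:R / k%:R < x < t + i%:R / k%:R + k%:R^-1 ->
  0 < (-1) ^+ i * sin (om * (x - t)) :> R.
Proof.
move=> /andP[l h]; set z := x - t - i%:R / k%:R.
have -> : om * (x - t) = om * z + i%:R * pi.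
  by rewrite /z; move: (@pi R) => q; field.
rewrite sinDnpi mulrA -expr2 sqrr_sign mul1r.
have z0 : 0 < z by rewrite /z subr_gt0 ltrBrDl.
have z1 : k%:R * z < 1.
  by rewrite mulrC -ltr_pdivlMr// div1r /z !ltrBlDr (_ : k%:R^-1 + _ + t = t + i%:R / k%:R + k%:R^-1)//; ring.
have pi0 := pi_gt0 R.
apply: sin_gt0_pi; rewrite ?(mulr_gt0 (mulr_gt0 kR pi0) z0)//=.
by rewrite mulrAC -[ltRHS]mul1r ltr_pM2r.
Qed.

(** If a point of the arc is off the closure of [D i], there are a square in [D i]
    and one off [D i] above the arc, where the sine has constant sign and is
    bounded below between the two squares. By [two_squares] the distance of the
    sum of the [u j] to the sine stays away from [0]. *)
Lemma arc_in_closure D t (Mb : R) (i j : 'I_k) : 0 <= Mb -> open (D i) ->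
  (forall i j, i != j -> D i `&` D j = set0) ->
  (forall ep, 0 < ep -> exists u ux uy : 'I_k -> R * R -> R,
  [/\ forall j, C1 (u j) (ux j) (uy j), forall j p, ~ D j (pr p) -> u j p = 0,
      forall j, [/\ boxint t (t + 1) 0 b (fun p => u j p ^+ 2) <= Mb,
        boxint t (t + 1) 0 b (fun p => ux j p ^+ 2) <= Mb &
        boxint t (t + 1) 0 b (fun p => uy j p ^+ 2) <= Mb] &
      boxint t (t + 1) 0 b (fun p => (\sum_j u j p - sin (om * (p.1 - t))) ^+ 2) <= ep]) ->
  D i `&` arcs t j !=set0 -> arcs t j `<=` closure (D i).
Proof.
move=> M0 oD DD prof meet q aq; apply: contrapT => nq.
have oC : open (~` closure (D i)) by apply: closed_openC; exact: closed_closure.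
have [a1 [c1 [w1 [w10 l1 r1 [y1 z1] B1]]]] := inner_square oD meet.
have [a2 [c2 [w2 [w20 l2 r2 [y2 z2] B2]]]] : exists x y w, [/\ 0 < w, t + j%:R / k%:R < x,
    x + w < t + j%:R / k%:R + k%:R^-1, 0 <= y /\ y + w <= b &
    forall x' y', x <= x' <= x + w -> y <= y' <= y + w -> (~` closure (D i)) (pr (x', y'))].
  by apply: inner_square => //; exists q.
pose w := Num.min w1 w2.
have w0 : 0 < w by rewrite lt_min w10.
have ww1 : w <= w1 by rewrite ge_min lexx.
have ww2 : w <= w2 by rewrite ge_min lexx orbT.
pose sg : R := (-1) ^+ j.
have sg2 : sg ^+ 2 = 1 by rewrite sqrr_sign.
pose s x := sg * sin (om * (x - t)).
pose s' x := sg * (om * cos (om * (x - t))).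
have ds x : is_derive x 1 s (s' x).
  apply: (isd_scale sg).
  have d1 : is_derive x 1 (fun x : R => om * (x - t)) om.
    by apply: (isd_eq (isd_scale om (isd_add (isd_id x) (isd_opp (isd_cst t x))))); ring.
  exact: (isd_sin d1).
have cs : continuous s by rewrite /s; cont.
have cs' : continuous s' by rewrite /s'; cont.
pose xl := Num.min a1 a2; pose xr := Num.max (a1 + w) (a2 + w).
have xl1 : xl <= a1 by rewrite ge_min lexx.
have xl2 : xl <= a2 by rewrite ge_min lexx orbT.
have xr1 : a1 + w <= xr by rewrite le_max lexx.
have xr2 : a2 + w <= xr by rewrite le_max lexx orbT.
pose X := t + j%:R / k%:R.
have lX : X < xl by rewrite lt_min l1.
have rX : xr < X + k%:R^-1.
  rewrite gt_max; apply/andP; split.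
    by apply: le_lt_trans r1; rewrite lerD2l.
  by apply: le_lt_trans r2; rewrite lerD2l.
have xlr : xl <= xr by apply: (le_trans xl1); apply: le_trans xr1; rewrite lerDl ltW.
have [c c0 sc] : exists2 c, 0 < c & forall x, xl <= x <= xr -> c <= s x.
  have [m mI Hm] := @EVT_min R s xl xr xlr (continuous_subspaceT cs).
  exists (s m) => [|x xI]; last by apply: Hm; rewrite in_itv.
  move: mI; rewrite in_itv /= => /andP[ml mr]; apply: sin_arc_pos.
  by rewrite (lt_le_trans lX ml) (le_lt_trans mr rX).
have cy1 : c1 + w <= b by apply: le_trans z1; rewrite lerD2l.
have cy2 : c2 + w <= b by apply: le_trans z2; rewrite lerD2l.
have [de de0 Hde] := two_squares w0 c0 M0 cs cs' ds sc xl1 xr1 xl2 xr2 y1 cy1 y2 cy2.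
have de2 : 0 < de / 2 by rewrite divr_gt0.
have [u [ux [uy [Cu u0 uM uE]]]] := prof _ de2.
have tX : t <= X by rewrite lerDl divr_ge0.
have X1 : X + k%:R^-1 <= t + 1.
  rewrite /X -addrA lerD2l -[X in _ + X <= _]div1r -mulrDl ler_pdivrMr// mul1r natr1 ler_nat.
  exact: ltn_ord.
have txl : t <= xl := le_trans tX (ltW lX).
have xrt : xr <= t + 1 := le_trans (ltW rX) X1.
have sub (F : R * R -> R) : continuous F -> (forall p, 0 <= F p) ->
    boxint xl xr 0 b F <= boxint t (t + 1) 0 b F.
  move=> cF F0; apply: (boxint_sub cF) => //; exact: ltW.
have cS : continuous (fun p : R * R => \sum_j u j p).
  by apply: ct_sum => i'; have [? _ _ _ _] := Cu i'.
have csin : continuous (fun p : R * R => sin (om * (p.1 - t))) by cont.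
have sgsq r : (sg * r) ^+ 2 = r ^+ 2 by rewrite exprMn sg2 mul1r.
have bound (v : R * R -> R) : continuous v -> boxint t (t + 1) 0 b (fun p => v p ^+ 2) <= Mb ->
    boxint xl xr 0 b (fun p => (sg * v p) ^+ 2) <= Mb.
  move=> cv; apply: le_trans.
  rewrite (@eq_boxint _ _ _ _ _ _ (fun p => v p ^+ 2)); last by move=> x y _ _; exact: sgsq.
  by apply: sub => [|p]; [exact: (ct_exp cv)|exact: sqr_ge0].
have [cu cux cuy _ _] := Cu i; have [m1 m2 m3] := uM i.
have := Hde _ _ _ (fun p => sg * \sum_j u j p) (pr @^-1` D i) (C1_scale sg (Cu i))
  (ct_mul (@ct_cst _ _ sg) cS).
move=> H; have {}H : de <= boxint xl xr 0 b (fun p => (sg * \sum_j u j p - s p.1) ^+ 2).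
  apply: H.
  - move=> p Dp; congr (_ * _); rewrite (bigD1 i)//= big1 ?addr0// => i' ii'.
    apply: u0 => Dp'; have : (D i `&` D i') (pr p) by split.
    by rewrite DD// eq_sym.
  - by move=> p nD; rewrite u0// mulr0.
  - move=> x y /andP[h1 h2] /andP[h3 h4]; apply: B1.
      by rewrite h1 (le_trans h2)// lerD2l.
    by rewrite h3 (le_trans h4)// lerD2l.
  - move=> x y /andP[h1 h2] /andP[h3 h4] Dp.
    have : (~` closure (D i)) (pr (x, y)).
      apply: B2; first by rewrite h1 (le_trans h2)// lerD2l.
      by rewrite h3 (le_trans h4)// lerD2l.
    by apply; exact: subset_closure.
  - exact: bound.
  - exact: bound.
  - exact: bound.
have := le_trans H (le_trans (_ : _ <= boxint t (t + 1) 0 b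
   (fun p => (\sum_j u j p - sin (om * (p.1 - t))) ^+ 2)) uE).
have L : boxint xl xr 0 b (fun p => (sg * \sum_j u j p - s p.1) ^+ 2) <= boxint t (t + 1) 0 b
   (fun p => (\sum_j u j p - sin (om * (p.1 - t))) ^+ 2).
  rewrite (@eq_boxint _ _ _ _ _ _ (fun p => (\sum_j u j p - sin (om * (p.1 - t))) ^+ 2)).
    by apply: sub => [|p]; [exact: (ct_exp (ct_add cS (ct_opp csin)))|exact: sqr_ge0].
  by move=> x y _ _; rewrite /s -mulrBr sgsq.
by move=> /(_ L); rewrite leNgt ltr_pdivrMr// ltr_pMr// ltr1n.
Qed.

End Rigidity.

(** * Uniqueness of minimal partitions *)

Section Uniqueness.
Context {R : realType} (b : R).
Hypothesis b0 : 0 < b.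
Local Notation pr := (@torus_pi R 1 b).
Variables (n : nat) (th : R).
Hypothesis n0 : (0 < n)%N.
Local Notation k := n.+1.
Local Notation om := (k%:R * pi : R).
Hypothesis omth : om < th.
Hypothesis thb2 : th * b < 2 * pi.
Hypothesis thb1 : odd k -> th * b < pi.
Implicit Types (D : 'I_k -> set (torus 1 b)) (t : R).

(** Two domains that meet the same arc are dense in it, hence intersect each
    other; so the choice, for each domain, of an arc that it meets is injective,
    and therefore bijective. A domain meets no other arc than its own, so it is
    contained in it; conversely the arc is contained in the interior of the
    closure of the domain. *)
Lemma arcs_of_inclusions D t : is_partition D -> strong D ->
  (forall (i j : 'I_k), D i `&` arcs t j !=set0 -> arcs t j `<=` closure (D i)) ->
  exists s : 'S_k, forall i : 'I_k, D (s i) = arcs t i.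
Proof.
move=> [oD DD] [_ sD] incl.
have oneD (i i' j : 'I_k) : D i `&` arcs t j !=set0 -> D i' `&` arcs t j !=set0 -> i = i'.
  move=> Mi [q [D'q aq]]; apply: contrapT => /eqP ii'.
  have [q' [Dq' Dq'']] : D i `&` D i' !=set0.
    have cq : closure (D i) q := incl _ _ Mi _ aq.
    by apply: cq; apply: open_nbhs_nbhs; split=> //; have [] := oD i'.
  have : (D i `&` D i') q' by split.
  by rewrite DD.
have meets i : exists j : 'I_k, D i `&` arcs t j !=set0.
  have [oDi [q Dq]] := oD i; have [j cj] := @adherent_arc R b n t q; exists j.
  by rewrite setIC; apply: cj; apply: open_nbhs_nbhs; split.
have [psi Hpsi] := choice meets.
have ipsi : injective psi.
  by move=> i i' E; apply: (oneD i i' (psi i)) => //; rewrite E.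
exists (perm ipsi)^-1%g => j.
set i := (perm ipsi)^-1%g j.
have ij : psi i = j by rewrite -(permE ipsi) permKV.
rewrite -ij; apply/seteqP; split=> q Hq; last first.
  rewrite -(sD i); apply: (filterS (incl i _ (Hpsi i))).
  by apply: open_nbhs_nbhs; split=> //; exact: arcs_open.
apply: contrapT => nq.
have NU : nbhs q (D i) by apply: open_nbhs_nbhs; split=> //; have [] := oD i.
have [i' i'i meet] := adherent_other n0 nq NU.
pose i2 := (perm ipsi)^-1%g i'.
have E2 : psi i2 = i' by rewrite -(permE ipsi) permKV.
have M2 := Hpsi i2; rewrite E2 in M2.
by move: i'i; rewrite -E2 (oneD _ _ _ meet M2) eqxx.
Qed.

Lemma minimal_unique D : minimal_partition D -> exists t (s : 'S_k), forall i : 'I_k, D (s i) = arcs t i.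
Proof.
move=> [pD eD sD _].
have ED : energy D = (om ^+ 2)%:E by rewrite eD (min_energyE b0 n0 omth thb2 thb1).
have [t prof] := limiting_profile b0 n0 omth thb2 thb1 pD ED.
exists t; apply: arcs_of_inclusions => // i j meet.
have M0 : 0 <= 4 * b * (om ^+ 2 + 1).
  apply: mulr_ge0; first by apply: mulr_ge0 => //; exact: ltW.
  by rewrite addr_ge0// sqr_ge0.
have [oD DD] := pD; have [oDi _] := oD i.
exact: (arc_in_closure b0 M0 oDi DD prof meet).
Qed.

End Uniqueness.

Theorem theorem1p1 (R : realType) (k : nat) (hk : (2 <= k)%N) :
  let good_threshold (bk : R) :=
    forall b : R, 0 < b -> b < bk -> b <= 1 ->
      min_energy 1 b k = (k%:R ^+ 2 * pi ^+ 2)%:E /\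
      forall D : 'I_k -> set (torus 1 b),
        minimal_partition D <->
        exists (t : R * R) (s : 'S_k),
          forall i, D (s i) = translate t (strip 1 b i) in
  (exists bk : R, 0 < bk /\ good_threshold bk) /\
  good_threshold (if odd k then 1 / k%:R else 2 / k%:R).
Proof.
move=> good_threshold.
have main : good_threshold (if odd k then 1 / k%:R else 2 / k%:R).
  case: k hk @good_threshold => [//|n] n0 good_threshold b b0 bk _.
  have [th [omth thb2 thb1]] := threshold_exists (isT : (0 < n.+1)%N) b0 bk.
  split; first by rewrite (min_energyE b0 n0 omth thb2 thb1) exprMn.
  move=> D; split.
    move=> mD; have [t [s Ds]] := minimal_unique b0 n0 omth thb2 thb1 mD.
    by exists (t, 0), s => i; rewrite Ds translate_strip.
  move=> [t [s Ds]]; apply: (arcs_minimal b0 n0 omth thb2 thb1 (t := t.1) (s := s)) => i.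
  by rewrite Ds translate_strip.
split=> //; eexists; split; last exact: main.
have kR : 0 < k%:R :> R by rewrite ltr0n (leq_trans _ hk).
by case: ifP => _; rewrite divr_gt0.
Qed.
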